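(* Let $f:\mathbb{C}\to\mathbb{C}$ be an entire function with $0$ as an attracting fixed point and $f'(0)\neq 0$. Suppose that $f$ has finitely many critical points and that all Fatou components of $f$ are bounded open sets in $\mathbb{C}$. Let $\mathcal{A}(0)$ be the basin of attraction of $0$ and let $\Omega_i$ ($i=1,2,\dots$) be its connected components, indexed so that $0\in\Omega_1$. Then: (a) If all $\Omega_i$ are simply connected and $f^{-1}(0)\cap\Omega_1\neq\{0\}$, then there is a constant $C$ such that for every $i$ and every point $z_0\in\Omega_i$ there exists a point $q\in\Omega_i\cap\bigcup_{k\ge 0}f^{-k}(0)$ with $d_{\Omega_i}(z_0,q)\le C$. (b) Suppose that either all $\Omega_i$ are simply connected and $f^{-1}(0)\cap\Omega_1=\{0\}$, or at least one $\Omega_i$ is not simply connected. Let $p_0\in\Omega_1$, $p_0\neq 0$, be (sufficiently) close to $0$. Then there exists a constant $C$ such that for every $i$ and every point $z_0\in\Omega_i$ there is a point $q\in\Omega_i\cap\bigcup_{k\ge 0}f^{-k}(p_0)$ with $d_{\Omega_i}(z_0,q)\le C$.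
   Context: $f^n$ denotes the $n$-fold iterate of $f$ and $f^{-k}(w)$ denotes the set of all points $z\in\mathbb{C}$ with $f^k(z)=w$ ($f^{-0}(w)=\{w\}$). The fixed point $0$ is attracting if $|f'(0)|<1$. The basin of attraction of $0$ is $\mathcal{A}(0)=\{z\in\mathbb{C}: f^n(z)\to 0 \text{ as } n\to\infty\}$. The Fatou set of $f$ is the largest open subset of $\mathbb{C}$ on which the family of iterates $\{f^n\}$ is locally normal; its connected components are the Fatou components. For a domain $\Omega$, with $\triangle$ the unit disk, the Kobayashi metric at $z\in\Omega$ and a tangent vector $\xi$ is $F_\Omega(z,\xi)=\inf\{\lambda>0:\ \exists g:\triangle\to\Omega \text{ holomorphic},\ g(0)=z,\ \lambda g'(0)=\xi\}$, and the Kobayashi distance $d_\Omega(z_1,z_2)$ is the infimum over piecewise smooth curves $\gamma:[0,1]\to\Omega$ joining $z_1$ to $z_2$ of $\int_0^1F_\Omega(\gamma(t),\gamma'(t))\,dt$. ''Sufficiently close'' means that there is a neighborhood of $0$ such that the statement holds for every $p_0\neq 0$ in that neighborhood; the constant $C$ may depend on $f$ and $p_0$ but not on $z_0$ or $i$. *)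

(* Defs.v *)
From HB Require Import structures.
From mathcomp Require Import all_boot all_order all_algebra complex.
From mathcomp Require Import all_classical all_reals all_analysis.

Set Implicit Arguments.
Unset Strict Implicit.
Unset Printing Implicit Defensive.

Import Order.TTheory GRing.Theory Num.Theory numFieldNormedType.Exports.

Local Open Scope ring_scope.
Local Open Scope classical_set_scope.
Local Open Scope complex_scope.

(* numFieldNormedType only equips abstract numeric fields with their norm
   topology; these are the same structures on the concrete type R[i]. *)
HB.instance Definition _ (R : rcfType) := GRing.ComAlgebra.copy R[i] R[i]^o.
HB.instance Definition _ (R : rcfType) := Vector.copy R[i] R[i]^o.
HB.instance Definition _ (R : rcfType) := NormedModule.copy R[i] R[i]^o.

Section Dynamics.
Variable R : realType.
Implicit Types (f g : R[i] -> R[i]) (z w xi : R[i]) (A K U V : set R[i]).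
Implicit Types (F : set (R[i] -> R[i])) (gamma delta : R -> R[i]).

(* Here derivable is over the field R[i], i.e. complex differentiability;
   only meaningful as holomorphy for open A. *)
Definition holomorphic_on A f : Prop := forall z, A z -> derivable f z 1.

Definition unit_disk : set R[i] := [set z | `|z| < 1].

Definition components A : set (set R[i]) :=
  [set connected_component A z | z in A].

Definition basin f w : set R[i] := [set z | iter n f z @[n --> \oo] --> w].

Definition backward_orbit f w : set R[i] :=
  \bigcup_k [set z | iter k f z = w].

Definition cvg_loc_unif V (u : nat -> R[i] -> R[i]) g : Prop :=
  forall K, compact K -> K `<=` V -> {uniform K, u @ \oo --> g}.

Definition cvg_loc_unif_infty V (u : nat -> R[i] -> R[i]) : Prop :=
  forall K, compact K -> K `<=` V ->
  forall M : R, \forall n \near \oo, forall z, K z -> M%:C < `|u n z|.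

(* Normality in the sense of Montel, with the constant infinity allowed as a
   limit; V is meant to be a domain. *)
Definition normal_family F V : Prop :=
  forall u : nat -> R[i] -> R[i], (forall n, F (u n)) ->
  exists2 phi : nat -> nat, {homo phi : m n / (m < n)%N} &
    (exists g, cvg_loc_unif V (u \o phi) g) \/ cvg_loc_unif_infty V (u \o phi).

Definition locally_normal F U : Prop :=
  forall z, U z ->
  exists V, [/\ open V, connected V, V z, V `<=` U & normal_family F V].

Definition fatou_set f : set R[i] :=
  \bigcup_(U in [set U : set R[i] |
    open U /\ locally_normal (range (fun n => iter n f)) U]) U.

Definition path_connected A : Prop :=
  forall z w, A z -> A w -> exists gamma,
    [/\ {within `[0, 1], continuous gamma},
        (forall t, `[0, 1] t -> A (gamma t)), gamma 0 = z & gamma 1 = w].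

Definition null_homotopic_in A gamma : Prop :=
  exists H : R * R -> R[i],
    [/\ {within `[0, 1] `*` `[0, 1], continuous H},
        (forall s t, `[0, 1] s -> `[0, 1] t -> A (H (s, t))),
        (forall t, `[0, 1] t -> H (0, t) = gamma t /\ H (1, t) = gamma 0) &
        (forall s, `[0, 1] s -> H (s, 0) = gamma 0 /\ H (s, 1) = gamma 0)].

Definition simply_connected A : Prop :=
  path_connected A /\
  forall gamma, {within `[0, 1], continuous gamma} ->
    (forall t, `[0, 1] t -> A (gamma t)) -> gamma 0 = gamma 1 ->
    null_homotopic_in A gamma.

Definition curve_derive gamma (t : R) : R[i] :=
  derive1 (@complex.Re R \o gamma) t +i* derive1 (@complex.Im R \o gamma) t.

Definition C1_curve gamma : Prop :=
  [/\ forall t, derivable (@complex.Re R \o gamma) t 1,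
      forall t, derivable (@complex.Im R \o gamma) t 1 &
      continuous (curve_derive gamma)].

(* Each closed piece is the restriction of a C^1 curve defined on all of R;
   this includes one-sided differentiability at the nodes, and makes gamma
   continuous on [0, 1]. *)
Definition piecewise_smooth gamma : Prop :=
  exists (n : nat) (tau : nat -> R),
    [/\ tau 0%N = 0, tau n = 1,
        (forall j, (j < n)%N -> tau j < tau j.+1) &
        (forall j, (j < n)%N -> exists2 delta, C1_curve delta &
           forall t, `[tau j, tau j.+1] t -> gamma t = delta t)].

Definition kobayashi_metric A z xi : \bar R :=
  ereal_inf [set l%:E | l in [set l : R | 0 < l /\ exists g,
    [/\ holomorphic_on unit_disk g, (forall w, unit_disk w -> A (g w)),
        g 0 = z & l%:C * derive1 g 0 = xi]]].

(* curve_derive takes unspecified values at the finitely many nodes, which the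
   Lebesgue integral ignores. *)
Definition kobayashi_length A gamma : \bar R :=
  (\int[lebesgue_measure]_(t in `[0%R, 1%R])
     kobayashi_metric A (gamma t) (curve_derive gamma t))%E.

Definition kobayashi_dist A z w : \bar R :=
  ereal_inf [set kobayashi_length A gamma | gamma in [set gamma |
    [/\ piecewise_smooth gamma, (forall t, `[0, 1] t -> A (gamma t)),
        gamma 0 = z & gamma 1 = w]]].

End Dynamics.

(* Main.v *)
(* Two points that lie at phi(0) and phi(b), |b| <= 1/2, for a holomorphic disc
phi in a component are at bounded Kobayashi distance, so it suffices to join
every point x of the basin to the backward orbit of some p <> 0 in the
component of 0 by a chain of discs of uniformly bounded length; in (a), p is a
nonzero zero of f.  Chains of discs lift through f^m as long as they stay away
from the critical values of f^m on the component concerned, because bounded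
components of the basin are mapped properly.

Let B be the union of the components met by the orbits of 0 and of the critical
points in the basin.  There are finitely many of them, so B is bounded, and the
first iterate y = f^m(x) in B is reached without meeting a critical point.  Fix a
small d such that f maps {|w| <= d} into itself, and n such that f^n takes all
critical points in the basin into {|w| < d/2} together with their further
iterates.  If |f^n(y)| <= d, then y lies in a compact subset of B, and finitely
many discs in B lead from y to a preimage of p.  Otherwise iterate further until
|f^(n+1)(y)| <= d <= |f^n(y)|: such y form a compact subset of
{y in B : |f^n(y)| > d/2}, which orbits of critical points never enter, so that
chains of discs in this set still lift to the component of x. *)

Require Import Defs.
From HB Require Import structures.
From mathcomp Require Import all_boot all_order all_algebra complex.
From mathcomp Require Import all_classical all_reals all_analysis.
From mathcomp Require Import measurable_realfun.
From mathcomp Require Import ring lra.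

Set Implicit Arguments.
Unset Strict Implicit.
Unset Printing Implicit Defensive.

Import Order.TTheory GRing.Theory Num.Theory numFieldNormedType.Exports.

Local Open Scope ring_scope.
Local Open Scope classical_set_scope.

(** * Exactness of closed one-forms in the plane *)

Section RealAnalysis.
Variable R : realType.
Implicit Types (p q A B : R -> R -> R) (a b x y t K e : R).

(** The hypothesis on [f] is bare complex differentiability, whereas lifting discs needs local
    inverses and C^1 curves, hence a continuous derivative. The analysis up to
    [entire_derivative_continuous] mainly serves this purpose.

    The dynamical obstacle is that the critical values of all the iterates together may accumulate,
    notably at 0, so they cannot simply be deleted from the component of 0. For one fixed [n] they
    are finitely many, and a plane domain stays connected when finitely many points are removed.
    Connecting chains are therefore built through [f^n] only, and the further iterates, whose number
    depends on the point, are controlled by the choice of the stopping time. Deleting a closed disc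
    around 0 has the same aim: it is forward invariant and swallows the critical orbits.

    The endpoint of the chains must then lie outside that disc, which explains [p <> 0]: an
    invariant disc that misses [p] contains no point of the backward orbit of [p]. Uniformity comes
    from compactness of the set of starting points, since lifting preserves the number of discs in a
    chain. *)

Lemma MVT_bound_itv (F F' : R -> R) u v K : u <= v ->
  (forall t, u <= t <= v -> is_derive t 1 F (F' t)) ->
  (forall t, u <= t <= v -> `|F' t| <= K) -> `|F v - F u| <= K * (v - u).
Proof.
move=> uv dF1 bF1.
have [||c] := @MVT_segment _ F F' u v uv.
- by move=> x; rewrite in_itv/= => /andP[ux xv]; apply: dF1; rewrite !ltW.
- apply: derivable_within_continuous => x; rewrite in_itv/= => uxv.
  by apply: ex_derive; apply: dF1.
rewrite in_itv/= => ucv ->; rewrite normrM (@ger0_norm _ (v - u)) ?subr_ge0//.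
by rewrite ler_wpM2r ?subr_ge0// bF1.
Qed.

Lemma MVT_bound (F F' : R -> R) a b K :
  (forall t, `|t - a| <= `|b - a| -> is_derive t 1 F (F' t)) ->
  (forall t, `|t - a| <= `|b - a| -> `|F' t| <= K) ->
  `|F b - F a| <= K * `|b - a|.
Proof.
move=> dF bF.
have [ab|ba] := leP a b.
  rewrite (@ger0_norm _ (b - a)) ?subr_ge0//; apply: (@MVT_bound_itv _ F') => // t /andP[at_ tb].
    by apply: dF; rewrite !ger0_norm ?subr_ge0// lerB.
  by apply: bF; rewrite !ger0_norm ?subr_ge0// lerB.
rewrite distrC (distrC b a) (@ger0_norm _ (a - b)); last by rewrite subr_ge0 ltW.
apply: (@MVT_bound_itv _ F'); first exact: ltW.
  move=> t /andP[bt ta]; apply: dF; rewrite distrC (distrC b a).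
  by rewrite !ger0_norm ?subr_ge0// ?lerB// ltW.
move=> t /andP[bt ta]; apply: bF; rewrite distrC (distrC b a).
by rewrite !ger0_norm ?subr_ge0// ?lerB// ltW.
Qed.

(** Integrals from the base points [- n] differ by constants, so after subtracting the value at 0
    they agree on common domains and glue to one function on the line. *)
Lemma antiderivative (f : R -> R) : continuous f ->
  exists F : R -> R, F 0 = 0 /\ forall x, is_derive x 1 F (f x).
Proof.
move=> cf.
pose I (n : nat) x : R := (\int[lebesgue_measure]_(t in `[- n%:R, x]) f t)%R.
have dI n x : - n%:R < x -> is_derive x 1 (I n) (f x).
  move=> nx.
  have x1 : x < x + 1 by rewrite ltrDl.
  have fi : lebesgue_measure.-integrable `[- n%:R, x + 1] (EFin \o f).
    apply: continuous_compact_integrable; first exact: segment_compact.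
    by apply: continuous_subspaceT => z; exact: cf.
  have [d1 d2] := continuous_FTC1_closed x1 fi nx (cf x).
  by rewrite -d2 derive1E; apply: derivableP.
pose G n x := I n x - I n 0.
have dG n x : - n%:R < x -> is_derive x 1 (G n) (f x).
  move=> nx; rewrite -[f x]subr0.
  by apply: is_deriveB; apply: dI.
have G0 n : G n 0 = 0 by rewrite /G subrr.
have GE n m x : `|x| < n%:R -> `|x| < m%:R -> G n x = G m x.
  move=> xn xm.
  have := @MVT_bound (fun x => G n x - G m x) (fun=> 0) 0 x 0.
  rewrite !G0 !subr0 mul0r => H.
  have : `|G n x - G m x| <= 0.
    apply: H => // [t tx|t tx]; last by rewrite normr0.
    rewrite subr0 in tx.
    rewrite -(subrr (f t)); apply: is_deriveB; apply: dG.
      by have := le_lt_trans tx xn; rewrite ltr_norml => /andP[].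
    by have := le_lt_trans tx xm; rewrite ltr_norml => /andP[].
  by rewrite normr_le0 subr_eq0 => /eqP.
pose N x := (Num.truncn `|x|).+1.
have NP x : `|x| < (N x)%:R by rewrite /N truncnS_gt.
exists (fun x => G (N x) x); split; first exact: G0.
move=> x.
have H : \forall t \near x, G (N x) t = G (N t) t.
  have : `|t| @[t --> x] --> `|x| by apply: cvg_norm.
  move=> /cvgr_lt/(_ _ (NP x)); apply: filterS => t tx.
  by apply: GE.
apply: near_eq_is_derive H _; apply: dG.
by have := NP x; rewrite ltr_norml => /andP[].
Qed.

Lemma nested_intervals (s r : nat -> R) :
  (forall n, s n <= s n.+1) -> (forall n, s n.+1 + r n.+1 <= s n + r n) ->
  (forall n, 0 <= r n) ->
  exists l, forall n, s n <= l <= s n + r n.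
Proof.
move=> sS srS r0.
have sm n m : (n <= m)%N -> s n <= s m.
  by move=> nm; apply: (homo_leq (r := fun a b => a <= b)) nm => // ? ? ? /le_trans; apply.
have srm n m : (n <= m)%N -> s m + r m <= s n + r n.
  elim: m => [|m IH]; first by rewrite leqn0 => /eqP ->.
  by rewrite leq_eqVlt => /predU1P[->//|/IH]; exact/le_trans.
have ssr n m : s n <= s m + r m.
  have [nm|mn] := leqP n m; first by rewrite (le_trans (sm _ _ nm))// lerDl.
  by apply: le_trans (srm _ _ (ltnW mn)); rewrite lerDl.
exists (sup (range s)) => n; apply/andP; split.
  by apply: ub_le_sup; [exists (s 0%N + r 0%N) => _ [m _ <-]|exists n].
by apply: ge_sup; [exists (s 0%N), 0%N|move=> _ [m _ <-]].
Qed.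



(** The form [p dx + q dy] is differentiable at each point, and the shared coefficient [p2] encodes
    equality of the mixed partials. Differentiability is pointwise, which is what complex
    differentiability supplies. *)
Definition closed_form p q := forall x0 y0, exists p1 p2 q2 : R, forall e, 0 < e ->
  exists2 d, 0 < d & forall x y, `|x - x0| < d -> `|y - y0| < d ->
  `|p x y - (p x0 y0 + p1 * (x - x0) + p2 * (y - y0))| <=
    e * (`|x - x0| + `|y - y0|) /\
  `|q x y - (q x0 y0 + p2 * (x - x0) + q2 * (y - y0))| <=
    e * (`|x - x0| + `|y - y0|).

(** For the function [E = A - B] used below, this is minus the circulation of [p dx + q dy] around
    the rectangle with corner (x, y) and sides w, h. *)
Definition mixed_diff A x y w h :=
  A (x + w) (y + h) - A x (y + h) - A (x + w) y + A x y.

Section Goursat.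
Variables p q A B : R -> R -> R.
Hypothesis pq : closed_form p q.
Hypothesis dA : forall x y, is_derive x 1 (A ^~ y) (p x y).
Hypothesis dB : forall x y, is_derive y 1 (B x) (q x y).
Let E x y := A x y - B x y.

(** The linearised form at (x0, y0) is exact and contributes no circulation; what remains is small
    compared with the side lengths. *)
Lemma mixed_diff_local x0 y0 e : 0 < e -> exists2 d, 0 < d &
  forall x y w h, `|x - x0| <= `|w| -> `|y - y0| <= `|h| ->
  `|w| < d -> `|h| < d ->
  `|mixed_diff E x y w h| <= e * (`|w| + `|h|) ^+ 2.
Proof.
move=> e0; have [p1 [p2 [q2 H]]] := pq x0 y0.
(* Points of the rectangle lie within 2|w| and 2|h| of (x0, y0), which costs a factor 2 both here
   and in [d / 2]; the mean value bounds below then hold with [e / 4]. *)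
have e8 : 0 < e / 8 by rewrite divr_gt0.
have [d d0 {}H] := H _ e8; exists (d / 2); first by rewrite divr_gt0.
move=> x y w h xx0 yy0 wd hd.
(* The cross terms with [p2] cancel in [A1 - B1], and the other subtracted terms depend on one
   variable only, so mixed differences do not see them. *)
pose A1 x y := A x y - (p x0 y0 * x + p1 / 2 * (x - x0) ^+ 2 +
  p2 * (x - x0) * (y - y0)).
pose B1 x y := B x y - (q x0 y0 * y + q2 / 2 * (y - y0) ^+ 2 +
  p2 * (x - x0) * (y - y0)).
have -> : mixed_diff E x y w h = (A1 (x + w) (y + h) - A1 x (y + h)) -
    (A1 (x + w) y - A1 x y) - ((B1 (x + w) (y + h) - B1 (x + w) y) -
    (B1 x (y + h) - B1 x y)).
  by rewrite /mixed_diff /E /A1 /B1; field.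
pose s := `|w| + `|h|.
have bw := normr_ge0 w; have bh := normr_ge0 h.
have hA y' : `|y' - y0| <= 2 * `|h| ->
    `|A1 (x + w) y' - A1 x y'| <= (e / 4 * s) * `|w|.
  move=> hy'.
  have := @MVT_bound (A1 ^~ y') (fun t => p t y' - (p x0 y0 + p1 * (t - x0) +
    p2 * (y' - y0))) x (x + w) (e / 4 * s).
  rewrite (addrC x w) addrK; apply.
    move=> t _; apply: is_derive_eq.
    by rewrite /GRing.scale/=; field.
  move=> t tw.
  have tx0 : `|t - x0| <= 2 * `|w|.
    by rewrite (_ : t - x0 = (t - x) + (x - x0)); [have := ler_normD (t - x) (x - x0); lra|ring].
  have [||] := H t y'; [lra|lra|move=> + _].
  move=> /le_trans; apply.
  rewrite /s; nra.
have hB x' : `|x' - x0| <= 2 * `|w| ->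
    `|B1 x' (y + h) - B1 x' y| <= (e / 4 * s) * `|h|.
  move=> hx'.
  have := @MVT_bound (B1 x') (fun t => q x' t - (q x0 y0 + p2 * (x' - x0) +
    q2 * (t - y0))) y (y + h) (e / 4 * s).
  rewrite (addrC y h) addrK; apply.
    move=> t _; apply: is_derive_eq.
    by rewrite /GRing.scale/=; field.
  move=> t tw.
  have ty0 : `|t - y0| <= 2 * `|h|.
    by rewrite (_ : t - y0 = (t - y) + (y - y0)); [have := ler_normD (t - y) (y - y0); lra|ring].
  have [||] := H x' t; [lra|lra|move=> _].
  move=> /le_trans; apply.
  rewrite /s; nra.
have hyh : `|y + h - y0| <= 2 * `|h|.
  by rewrite (_ : _ - _ = h + (y - y0)); [have := ler_normD h (y - y0); lra|ring].
have hxw : `|x + w - x0| <= 2 * `|w|.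
  by rewrite (_ : _ - _ = w + (x - x0)); [have := ler_normD w (x - x0); lra|ring].
have a1 := hA _ hyh.
have a2 : `|A1 (x + w) y - A1 x y| <= e / 4 * s * `|w| by apply: hA; lra.
have b1 := hB _ hxw.
have b2 : `|B1 x (y + h) - B1 x y| <= e / 4 * s * `|h| by apply: hB; lra.
rewrite (le_trans (ler_normB _ _))//.
have n1 := ler_normB (A1 (x + w) (y + h) - A1 x (y + h)) (A1 (x + w) y - A1 x y).
have n2 := ler_normB (B1 (x + w) (y + h) - B1 (x + w) y) (B1 x (y + h) - B1 x y).
have -> : e * (`|w| + `|h|) ^+ 2 = 4 * (e / 4 * s * `|w|) + 4 * (e / 4 * s * `|h|).
  by rewrite /s; field.
have : 0 <= e / 4 * s * `|w| by rewrite !mulr_ge0// ?addr_ge0//; lra.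
have : 0 <= e / 4 * s * `|h| by rewrite !mulr_ge0// ?addr_ge0//; lra.
lra.
Qed.

Lemma mixed_diff_split x y w h : mixed_diff E x y w h =
  mixed_diff E x y (w / 2) (h / 2) + mixed_diff E (x + w / 2) y (w / 2) (h / 2) +
  mixed_diff E x (y + h / 2) (w / 2) (h / 2) +
  mixed_diff E (x + w / 2) (y + h / 2) (w / 2) (h / 2).
Proof.
have H (z u : R) : z + u / 2 + u / 2 = z + u by field.
by rewrite /mixed_diff !H; ring.
Qed.

(* Goursat's bisection *)
Lemma mixed_diff_eq0 x y w h : mixed_diff E x y w h = 0.
Proof.
pose r n : R := 2^-1 ^+ n.
have r0 n : 0 < r n by rewrite exprn_gt0.
have rS n : r n.+1 = r n / 2 by rewrite /r exprSr.
(* Subrectangles are addressed by a corner in the unit square, scaled by [w] and [h]; thus the signs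
   of [w] and [h], or their vanishing, do not matter. *)
pose D n (st : R * R) :=
  `|mixed_diff E (x + w * st.1) (y + h * st.2) (w * r n) (h * r n)|.
pose next (st st' : R * R) n := [/\ st.1 <= st'.1, st'.1 + r n.+1 <= st.1 + r n,
  st.2 <= st'.2, st'.2 + r n.+1 <= st.2 + r n & D n st <= 4 * D n.+1 st'].
have step n st : exists st', next st st' n.
  have rn := r0 n.
  pose c1 := D n.+1 st; pose c2 := D n.+1 (st.1 + r n.+1, st.2).
  pose c3 := D n.+1 (st.1, st.2 + r n.+1).
  pose c4 := D n.+1 (st.1 + r n.+1, st.2 + r n.+1).
  have H : D n st <= c1 + c2 + c3 + c4.
    rewrite /D mixed_diff_split /c1 /c2 /c3 /c4 /D /= rS.
    rewrite !mulrDr !(addrA x) !(addrA y) -!(mulrA _ (r n)).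
    by do 3!(apply: le_trans (ler_normD _ _) _; rewrite lerD2r).
  have [h1|h1] := leP (D n st) (4 * c1); first by exists st; split=> //; rewrite rS; lra.
  have [h2|h2] := leP (D n st) (4 * c2).
    by exists (st.1 + r n.+1, st.2); split=> //=; rewrite rS; lra.
  have [h3|h3] := leP (D n st) (4 * c3).
    by exists (st.1, st.2 + r n.+1); split=> //=; rewrite rS; lra.
  exists (st.1 + r n.+1, st.2 + r n.+1); split; try by rewrite /= rS; lra.
  by rewrite -/c4; lra.
pose nx n st := projT1 (cid (step n st)).
have nxP n st : next st (nx n st) n by rewrite /nx; case: cid.
pose u := fix u n : R * R := if n is m.+1 then nx m (u m) else (0, 0).
have uP n : next (u n) (u n.+1) n by apply: nxP.
have [a aP] : exists l, forall n, (u n).1 <= l <= (u n).1 + r n.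
  by apply: nested_intervals => n; [case: (uP n)|case: (uP n)|exact: ltW].
have [b bP] : exists l, forall n, (u n).2 <= l <= (u n).2 + r n.
  by apply: nested_intervals => n; [case: (uP n)|case: (uP n)|exact: ltW].
have DM n : `|mixed_diff E x y w h| * (r n * r n) <= D n (u n).
  elim: n => [|n IH]; first by rewrite /D /r/= !expr0 !mulr1 !mulr0 !addr0.
  by case: (uP n) => _ _ _ _ H; rewrite rS; lra.
apply/eqP; rewrite -normr_le0; apply/ler_addgt0Pl => e e0; rewrite addr0.
have W0 : 0 < (`|w| + `|h|) ^+ 2 + 1 by rewrite ltr_wpDl// sqr_ge0.
have [d d0 H] := mixed_diff_local (x + w * a) (y + h * b) (divr_gt0 e0 W0).
have [n [nw nh]] : exists n, `|w * r n| < d /\ `|h * r n| < d.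
  have : r n @[n --> \oo] --> 0.
    by apply: cvg_expr; rewrite ger0_norm ?invr_ge0// invf_lt1// ltr1n.
  have dd : 0 < d / (`|w| + `|h| + 1) by rewrite divr_gt0// ltr_wpDl// addr_ge0.
  move=> /cvgr0_norm_lt/(_ _ dd) [n _ /(_ n (leqnn _))] /=.
  rewrite ltr_pdivlMr ?ltr_wpDl ?addr_ge0// => nd.
  have := normr_ge0 (r n); have := normr_ge0 w; have := normr_ge0 h.
  by exists n; rewrite !normrM; split; nra.
have ab1 : `|x + w * (u n).1 - (x + w * a)| <= `|w * r n|.
  rewrite (_ : _ - _ = w * ((u n).1 - a)); last by ring.
  rewrite !normrM ler_wpM2l// ler_norml (gtr0_norm (r0 n)).
  by have := aP n; lra.
have ab2 : `|y + h * (u n).2 - (y + h * b)| <= `|h * r n|.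
  rewrite (_ : _ - _ = h * ((u n).2 - b)); last by ring.
  rewrite !normrM ler_wpM2l// ler_norml (gtr0_norm (r0 n)).
  by have := bP n; lra.
have := H _ _ _ _ ab1 ab2 nw nh.
rewrite -/(D n (u n)) => /(le_trans (DM n)).
rewrite !normrM (gtr0_norm (r0 n)) -mulrDl exprMn -(expr2 (r n)) [leRHS]mulrA.
rewrite ler_pM2r ?exprn_gt0//.
move=> /le_trans; apply; rewrite mulrAC ler_pdivrMr//.
by apply: ler_wpM2l; [exact: ltW|rewrite lerDl].
Qed.

End Goursat.

Lemma closed_form_continuous p q : closed_form p q ->
  (forall y, continuous (p ^~ y)) /\ (forall x, continuous (q x)).
Proof.
have est (c z z0 e : R) : 0 < e -> 0 <= c -> `|z - z0| < e / (c + 1) ->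
    c * `|z - z0| < e.
  move=> e0 c0; rewrite ltr_pdivlMr ?ltr_wpDl// mulrDr mulr1 => H.
  by have := normr_ge0 (z - z0); lra.
move=> pq; split=> [y x|x y]; apply/cvgrPdist_lt => e e0.
  have [a [b [c /(_ _ ltr01)[d d0 H]]]] := pq x y.
  exists (Num.min d (e / (`|a| + 1 + 1))).
    by rewrite /= lt_min d0 divr_gt0// !ltr_wpDl// addr_ge0.
  move=> t; rewrite /ball_/= distrC lt_min => /andP[td te].
  have [//||+ _] := H t y; first by rewrite subrr normr0.
  rewrite subrr normr0 mulr0 !addr0 mul1r => Ht.
  have {}te : (`|a| + 1) * `|t - x| < e by apply: est => //; rewrite addr_ge0.
  rewrite distrC (_ : p t y - p x y = (p t y - (p x y + a * (t - x))) + a * (t - x)); last by ring.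
  by apply: le_lt_trans (ler_normD _ _) _; rewrite normrM; lra.
have [a [b [c /(_ _ ltr01)[d d0 H]]]] := pq x y.
exists (Num.min d (e / (`|c| + 1 + 1))).
  by rewrite /= lt_min d0 divr_gt0// !ltr_wpDl// addr_ge0.
move=> t; rewrite /ball_/= distrC lt_min => /andP[td te].
have [|//|_] := H x t; first by rewrite subrr normr0.
rewrite subrr normr0 mulr0 addr0 add0r mul1r => Ht.
have {}te : (`|c| + 1) * `|t - y| < e by apply: est => //; rewrite addr_ge0.
rewrite distrC (_ : q x t - q x y = (q x t - (q x y + c * (t - y))) + c * (t - y)); last by ring.
by apply: le_lt_trans (ler_normD _ _) _; rewrite normrM; lra.
Qed.

(** Integrate along the y axis and then horizontally. As rectangles have no circulation, the other
    order gives the same function, and each order exhibits one of the two partial derivatives. *)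
Lemma closed_form_exact p q : closed_form p q ->
  exists F : R -> R -> R, (forall x y, is_derive x 1 (F ^~ y) (p x y)) /\
    (forall x y, is_derive y 1 (F x) (q x y)).
Proof.
move=> pq; have [cp cq] := closed_form_continuous pq.
have [A HA] := choice (fun y => antiderivative (cp y)).
have [B HB] := choice (fun x => antiderivative (cq x)).
exists (fun x y => A y x + B 0 y); split=> x y.
  rewrite -[p x y]addr0; apply: is_deriveD; exact: (HA y).2.
have -> : (fun y => A y x + B 0 y) = (fun y => A 0 x + B x y).
  apply/funext => t; have := @mixed_diff_eq0 p q (fun x y => A y x) B pq
    (fun x y => (HA y).2 x) (fun x y => (HB x).2 y) 0 0 x t.
  by rewrite /mixed_diff !add0r !(HA _).1 !(HB _).1; lra.
by rewrite -[q x y]add0r; apply: is_deriveD; exact: (HB x).2.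
Qed.

End RealAnalysis.

(** * The modulus as a real number, and the topology of R[i] through it *)

Section ComplexModulus.
Variable R : realType.
Implicit Types (z w : R[i]) (r e : R).

(** The norm of [R[i]] has values in [R[i]], which is only partially ordered; estimates are carried
    out in the real field instead. *)
Definition cmod z : R := Normc.normc z.

Lemma normrC z : `|z| = (cmod z)%:C%C.
Proof. by case: z. Qed.

Lemma cmodE z : cmod z = Num.sqrt (complex.Re z ^+ 2 + complex.Im z ^+ 2).
Proof. by case: z. Qed.

Lemma cmod_ge0 z : 0 <= cmod z. Proof. by rewrite cmodE sqrtr_ge0. Qed.

Lemma cmod0 : cmod 0 = 0. Proof. exact: Normc.normc0. Qed.

Lemma cmod1 : cmod 1 = 1. Proof. exact: Normc.normc1. Qed.

Lemma cmod_eq0 z : (cmod z == 0) = (z == 0).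
Proof. by apply/eqP/eqP => [/Normc.eq0_normc//|->]; rewrite cmod0. Qed.

Lemma cmod_gt0 z : (0 < cmod z) = (z != 0).
Proof. by rewrite lt_neqAle cmod_ge0 andbT eq_sym cmod_eq0. Qed.

Lemma cmodM z w : cmod (z * w) = cmod z * cmod w.
Proof. exact: Normc.normcM. Qed.

Lemma cmodV z : cmod z^-1 = (cmod z)^-1.
Proof. exact: Normc.normcV. Qed.

Lemma cmodN z : cmod (- z) = cmod z.
Proof. by case: z => a b; rewrite !cmodE /= !sqrrN. Qed.

Lemma cmodX z n : cmod (z ^+ n) = cmod z ^+ n.
Proof. by elim: n => [|n IH]; rewrite ?expr0 ?cmod1// !exprS cmodM IH. Qed.

Lemma cmod_distC z w : cmod (z - w) = cmod (w - z).
Proof. by rewrite -cmodN opprB. Qed.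

Lemma cmodD z w : cmod (z + w) <= cmod z + cmod w.
Proof. exact: le_normcD. Qed.

Lemma cmodB z w : cmod (z - w) <= cmod z + cmod w.
Proof. by rewrite -(cmodN w) cmodD. Qed.

Lemma cmod_dist_trans z w u : cmod (z - u) <= cmod (z - w) + cmod (w - u).
Proof. by rewrite -(subrK w z) -addrA addrK cmodD. Qed.

Lemma cmod_lerB z w : cmod z - cmod w <= cmod (z - w).
Proof. by rewrite lerBlDr -{1}(subrK w z) cmodD. Qed.

Lemma cmod_real r : cmod (r%:C)%C = `|r|.
Proof. by rewrite cmodE /= expr0n /= addr0 sqrtr_sqr. Qed.

Lemma cmod_i : cmod ('i)%C = 1.
Proof. by rewrite cmodE /= expr0n expr1n add0r sqrtr1. Qed.

Lemma cmod_Re z : `|complex.Re z| <= cmod z.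
Proof. by rewrite cmodE -sqrtr_sqr ler_wsqrtr// lerDl sqr_ge0. Qed.

Lemma cmod_Im z : `|complex.Im z| <= cmod z.
Proof. by rewrite cmodE -sqrtr_sqr ler_wsqrtr// lerDr sqr_ge0. Qed.

Lemma cmod_le_ReIm z : cmod z <= `|complex.Re z| + `|complex.Im z|.
Proof.
case: z => a b; rewrite cmodE /=.
rewrite -[leRHS]ger0_norm ?addr_ge0// -sqrtr_sqr ler_wsqrtr// sqrrD.
by rewrite !real_normK ?num_real// -addrA lerD2l lerDr mulrn_wge0// mulr_ge0.
Qed.

Lemma cmod_sqr z : cmod z ^+ 2 = complex.Re z ^+ 2 + complex.Im z ^+ 2.
Proof. by rewrite cmodE sqr_sqrtr// addr_ge0// sqr_ge0. Qed.

Lemma ReD z w : complex.Re (z + w) = complex.Re z + complex.Re w.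
Proof. by case: z w => ? ? []. Qed.

Lemma ImD z w : complex.Im (z + w) = complex.Im z + complex.Im w.
Proof. by case: z w => ? ? []. Qed.

Lemma ReB z w : complex.Re (z - w) = complex.Re z - complex.Re w.
Proof. by case: z w => ? ? []. Qed.

Lemma ImB z w : complex.Im (z - w) = complex.Im z - complex.Im w.
Proof. by case: z w => ? ? []. Qed.

Lemma ReM z w : complex.Re (z * w) =
  complex.Re z * complex.Re w - complex.Im z * complex.Im w.
Proof. by case: z w => ? ? []. Qed.

Lemma ImM z w : complex.Im (z * w) =
  complex.Re z * complex.Im w + complex.Im z * complex.Re w.
Proof. by case: z w => ? ? []. Qed.

Lemma cmod_eq_small z : (forall e, 0 < e -> cmod z <= e) -> z = 0.
Proof.
move=> H; apply/eqP; rewrite -cmod_eq0 eq_le cmod_ge0 andbT.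
by apply/ler_addgt0Pl => e e0; rewrite addr0 H.
Qed.

Definition cball z r : set R[i] := [set w | cmod (w - z) < r].

Lemma cballxx z r : 0 < r -> cball z r z.
Proof. by rewrite /cball/= subrr cmod0. Qed.

Lemma cball_shrink z w r : cball z r w ->
  exists2 s, 0 < s & cball w s `<=` cball z r.
Proof.
rewrite /cball/= => zw; exists (r - cmod (w - z)); first by rewrite subr_gt0.
by move=> u /= wu; have := cmod_dist_trans u w z; lra.
Qed.

Lemma gt0_real_complex (x : R[i]) : 0 < x -> exists2 r, 0 < r & x = (r%:C)%C.
Proof.
by case: x => a b; rewrite ltcE /= => /andP[/eqP -> a0]; exists a.
Qed.

Lemma nbhs_cballP z (A : set R[i]) :
  nbhs z A <-> exists2 r, 0 < r & cball z r `<=` A.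
Proof.
split.
  move=> /nbhs_ballP[x /= /gt0_real_complex[r r0 ->] H]; exists r => // w zw.
  by apply: H; rewrite -ball_normE /= normrC ltcR cmod_distC.
move=> [r r0 H]; apply/nbhs_ballP; exists (r%:C)%C; first by rewrite /= ltcR.
by move=> w; rewrite -ball_normE /= normrC ltcR cmod_distC => /H.
Qed.

Lemma nbhs_cball z r : 0 < r -> nbhs z (cball z r).
Proof. by move=> r0; apply/nbhs_cballP; exists r. Qed.

Lemma openP (A : set R[i]) :
  open A <-> forall z, A z -> exists2 r, 0 < r & cball z r `<=` A.
Proof.
rewrite openE; split => H z /H; first by move=> /nbhs_cballP.
by move=> ?; apply/nbhs_cballP.
Qed.

Lemma open_cball z r : open (cball z r).
Proof. by apply/openP => w /cball_shrink. Qed.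

Lemma continuousP_cmod (T : topologicalType) (f : T -> R[i]) (t : T) :
  {for t, continuous f} <->
  forall e, 0 < e -> \forall s \near t, cmod (f s - f t) < e.
Proof.
split=> H; first by move=> e e0; exact: (H _ (nbhs_cball _ e0)).
by move=> A /nbhs_cballP[r r0 rA]; apply: filterS (H r r0) => s /= ?; exact: rA.
Qed.

Lemma continuousP_cball (f : R[i] -> R[i]) z : {for z, continuous f} <->
  forall e, 0 < e -> exists2 d, 0 < d &
    forall w, cmod (w - z) < d -> cmod (f w - f z) < e.
Proof.
rewrite continuousP_cmod; split=> H e /H; first by move=> /nbhs_cballP.
by move=> ?; apply/nbhs_cballP.
Qed.

Lemma continuous_cmod : continuous cmod.
Proof.
move=> z; apply/(@cvgrPdist_lt _ _ _ (nbhs z)) => e e0; apply/nbhs_cballP; exists e => // w zw.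
rewrite /= ltr_norml; have := cmod_lerB z w; have := cmod_lerB w z.
by rewrite (cmod_distC z w) => ? ?; move: zw; rewrite /cball/= => ?; lra.
Qed.

End ComplexModulus.

(** * Calculus of complex derivatives *)

Section ComplexDerivative.
Variable R : realType.
Implicit Types (f g : R[i] -> R[i]) (z w d : R[i]) (r e : R).

(** In this division-free form [w = z] is no exception, and the error estimate is an inequality
    between reals. *)
Definition cdiff f z d := forall e, 0 < e -> exists2 r, 0 < r &
  forall w, cmod (w - z) < r ->
  cmod (f w - f z - d * (w - z)) <= e * cmod (w - z).

Lemma cdiff_cvg f z d : cdiff f z d <->
  (h^-1 *: (f (h + z) - f z)) @[h --> (0 : R[i])^'] --> d.
Proof.
have E h : h != 0 -> cmod (h^-1 *: (f (h + z) - f z) - d) =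
    cmod (f (h + z) - f z - d * h) / cmod h.
  by move=> h0; rewrite -cmodV -cmodM mulrBl mulfK// mulrC.
split=> H.
  move=> A /nbhs_cballP[e e0 eA].
  have [r r0 {}H] := H _ (divr_gt0 e0 (@ltr0n R 2)).
  rewrite /= /nbhs/=; apply/nbhs_cballP; exists r => // h; rewrite /cball/= subr0.
  move=> hr h0; apply: eA; rewrite /cball /= E//.
  rewrite ltr_pdivrMr ?cmod_gt0//.
  have /= := H (h + z); rewrite addrK => /(_ hr) /le_lt_trans; apply.
  by rewrite ltr_pM2r ?cmod_gt0//; lra.
move=> e e0.
have := H _ (nbhs_cball d e0); rewrite /= /nbhs/= => /nbhs_cballP[r r0 rH].
exists r => // w wr.
have [->|wz] := eqVneq w z; first by rewrite !subrr mulr0 subr0 cmod0 mulr0.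
have wz0 : w - z != 0 by rewrite subr_eq0.
have := rH (w - z); rewrite /cball/= subr0 => /(_ wr wz0).
by rewrite E// subrK ltr_pdivrMr ?cmod_gt0// => /ltW.
Qed.

Lemma derivableP_cdiff f z d :
  cdiff f z d <-> derivable f z 1 /\ derive1 f z = d.
Proof.
have E : (fun h : R[i] => h^-1 *: ((f \o shift z) (h *: (1 : R[i])) - f z)) =
    (fun h : R[i] => h^-1 *: (f (h + z) - f z)).
  by apply/funext => h /=; rewrite [h *: (1 : R[i])]mulr1.
rewrite cdiff_cvg /derivable /derive1 E; split => [H|[H <-]].
  split; first by apply/cvg_ex; exists d.
  exact: cvg_lim.
exact: H.
Qed.

Lemma cdiff_derive1 f z : derivable f z 1 -> cdiff f z (derive1 f z).
Proof. by move=> H; apply/derivableP_cdiff. Qed.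

Lemma cdiff_derivable f z d : cdiff f z d -> derivable f z 1.
Proof. by move=> /derivableP_cdiff[]. Qed.

Lemma cdiff_derive1E f z d : cdiff f z d -> derive1 f z = d.
Proof. by move=> /derivableP_cdiff[]. Qed.

Lemma cdiff_lipschitz f z d : cdiff f z d -> exists2 r, 0 < r &
  forall w, cmod (w - z) < r -> cmod (f w - f z) <= (cmod d + 1) * cmod (w - z).
Proof.
move=> /(_ 1 ltr01)[r r0 H]; exists r => // w /H; rewrite mul1r => {}H.
rewrite -(subrK (d * (w - z)) (f w - f z)) mulrDl mul1r addrC.
by apply: le_trans (cmodD _ _) _; rewrite cmodM lerD2l.
Qed.

Lemma cdiff_continuous f z d : cdiff f z d -> {for z, continuous f}.
Proof.
move=> /cdiff_lipschitz[r r0 H]; apply/continuousP_cball => e e0.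
have d1 : 0 < cmod d + 1 by rewrite ltr_wpDl// cmod_ge0.
exists (Num.min r (e / (cmod d + 1))); first by rewrite lt_min r0 divr_gt0.
move=> w; rewrite lt_min => /andP[/H wr we]; apply: le_lt_trans wr _.
by rewrite mulrC -ltr_pdivlMr.
Qed.

Lemma cdiff_near f g z d r : 0 < r -> (forall w, cmod (w - z) < r -> f w = g w) ->
  cdiff f z d -> cdiff g z d.
Proof.
move=> r0 fg H e /H[s s0 {}H]; exists (Num.min r s); first by rewrite lt_min r0.
move=> w; rewrite lt_min => /andP[wr ws]; rewrite -!fg ?H// subrr cmod0//.
Qed.

Lemma cdiff_cst a z : cdiff (fun=> a) z 0.
Proof.
move=> e e0; exists 1 => // w _; rewrite subrr mul0r subrr cmod0.
by rewrite mulr_ge0 ?cmod_ge0// ltW.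
Qed.

Lemma cdiff_id z : cdiff id z 1.
Proof.
move=> e e0; exists 1 => // w _; rewrite mul1r subrr cmod0.
by rewrite mulr_ge0 ?cmod_ge0// ltW.
Qed.

Lemma cdiffD f g z d d' : cdiff f z d -> cdiff g z d' ->
  cdiff (fun w => f w + g w) z (d + d').
Proof.
move=> Hf Hg e e0; have e2 : 0 < e / 2 by rewrite divr_gt0.
have [r r0 {}Hf] := Hf _ e2; have [s s0 {}Hg] := Hg _ e2.
exists (Num.min r s); first by rewrite lt_min r0.
move=> w; rewrite lt_min => /andP[/Hf {}Hf /Hg {}Hg].
rewrite (_ : _ - _ = (f w - f z - d * (w - z)) + (g w - g z - d' * (w - z))); last by ring.
by apply: le_trans (cmodD _ _) _; lra.
Qed.

Lemma cdiffN f z d : cdiff f z d -> cdiff (fun w => - f w) z (- d).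
Proof.
move=> H e /H[r r0 {}H]; exists r => // w /H.
by rewrite -cmodN; congr (cmod _ <= _); ring.
Qed.

Lemma cdiffB f g z d d' : cdiff f z d -> cdiff g z d' ->
  cdiff (fun w => f w - g w) z (d - d').
Proof. by move=> Hf /cdiffN; exact: cdiffD. Qed.

Lemma cdiff_comp f g z d d' : cdiff f z d -> cdiff g (f z) d' ->
  cdiff (g \o f) z (d' * d).
Proof.
move=> Hf Hg e e0; have [r1 r10 Lf] := cdiff_lipschitz Hf.
have d1 : 0 < cmod d + 1 by rewrite ltr_wpDl// cmod_ge0.
have d'1 : 0 < cmod d' + 1 by rewrite ltr_wpDl// cmod_ge0.
have [r2 r20 {}Hf] := Hf _ (divr_gt0 (divr_gt0 e0 (@ltr0n R 2)) d'1).
have [s s0 {}Hg] := Hg _ (divr_gt0 (divr_gt0 e0 (@ltr0n R 2)) d1).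
exists (Num.min (Num.min r1 r2) (s / (cmod d + 1))).
  by rewrite !lt_min r10 r20 divr_gt0.
move=> w; rewrite !lt_min => /andP[/andP[/Lf {}Lf /Hf {}Hf]].
rewrite ltr_pdivlMr// => ws.
have {}Hg := Hg (f w); rewrite mulrC in ws.
have {}Hg := Hg (le_lt_trans Lf ws).
rewrite /= (_ : _ - _ = (g (f w) - g (f z) - d' * (f w - f z)) +
  d' * (f w - f z - d * (w - z))); last by ring.
apply: le_trans (cmodD _ _) _.
have -> : e * cmod (w - z) = e / 2 / (cmod d + 1) * ((cmod d + 1) * cmod (w - z))
    + (cmod d' + 1) * (e / 2 / (cmod d' + 1) * cmod (w - z)).
  by field; rewrite !lt0r_neq0.
rewrite lerD//; first by rewrite (le_trans Hg)// ler_pM2l// !divr_gt0.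
by rewrite cmodM ler_pM ?cmod_ge0// lerDl.
Qed.

(** This differentiates a continuous lift [f] of [g \o f] through [g]. Since [d'] is nonzero, [g]
    expands near [f z], which first makes [f] Lipschitz at [z]; only then do the two expansions
    compare. *)
Lemma cdiff_lift f g z d d' : {for z, continuous f} -> d' != 0 ->
  cdiff g (f z) d' -> cdiff (g \o f) z d -> cdiff f z (d / d').
Proof.
move=> cf d'0 Hg Hgf e e0; have m0 : 0 < cmod d' by rewrite cmod_gt0.
have [s s0 Hg2] := Hg (cmod d' / 2) (divr_gt0 m0 (@ltr0n R 2)).
have [r1 r10 Lgf] := cdiff_lipschitz Hgf.
(* [K] is the Lipschitz constant of [f] at [z]: [g] expands by at least |d'|/2 and [g \o f]
   stretches by at most |d| + 1. *)
pose K := 2 / cmod d' * (cmod d + 1).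
have K0 : 0 < K by rewrite mulr_gt0 ?divr_gt0// ltr_wpDl// cmod_ge0.
have em : 0 < e * cmod d' / 2 by rewrite divr_gt0// mulr_gt0.
have [s2 s20 {}Hg] := Hg _ (divr_gt0 em K0).
have [r2 r20 {}Hgf] := Hgf _ em.
have ss : 0 < Num.min s s2 by rewrite lt_min s0.
have [r3 r30 {}cf] := (continuousP_cball _ _).1 cf _ ss.
exists (Num.min (Num.min r1 r2) r3); first by rewrite !lt_min r10 r20.
move=> w; rewrite !lt_min => /andP[/andP[/Lgf /= {}Lgf /Hgf /= {}Hgf]] /cf.
rewrite lt_min => /andP[/Hg2 {}Hg2 /Hg {}Hg].
have Kb : cmod (f w - f z) <= K * cmod (w - z).
  have : cmod d' * cmod (f w - f z) <= 2 * ((cmod d + 1) * cmod (w - z)).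
    rewrite -cmodM; have := cmod_lerB (d' * (f w - f z)) (g (f w) - g (f z)).
    rewrite (cmod_distC (d' * _)) cmodM in Hg2 *.
    by lra.
  rewrite mulrC -ler_pdivlMr// => /le_trans; apply.
  by rewrite /K le_eqVlt; apply/orP; left; apply/eqP; field; rewrite lt0r_neq0.
rewrite -(ler_pM2l m0) -cmodM.
rewrite (_ : d' * _ = (g (f w) - g (f z) - d * (w - z)) -
  (g (f w) - g (f z) - d' * (f w - f z))); last by field.
apply: le_trans (cmodB _ _) _.
have -> : cmod d' * (e * cmod (w - z)) = e * cmod d' / 2 * cmod (w - z) +
    e * cmod d' / 2 / K * (K * cmod (w - z)).
  by field; rewrite lt0r_neq0.
by rewrite lerD// (le_trans Hg)// ler_pM2l// (divr_gt0 em).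
Qed.

Lemma cdiffM f g z d d' : cdiff f z d -> cdiff g z d' ->
  cdiff (fun w => f w * g w) z (d * g z + f z * d').
Proof.
move=> Hf Hg e e0.
have pos (x : R[i]) : 0 < cmod x + 1 by rewrite ltr_wpDl// cmod_ge0.
have [r1 r10 Lf] := cdiff_lipschitz Hf; have [r2 r20 Lg] := cdiff_lipschitz Hg.
have e3 : 0 < e / 3 by rewrite divr_gt0.
have [r3 r30 {}Hf] := Hf _ (divr_gt0 e3 (pos (g z))).
have [r4 r40 {}Hg] := Hg _ (divr_gt0 e3 (pos (f z))).
exists (Num.min (Num.min (Num.min r1 r2) (Num.min r3 r4))
    (e / 3 / ((cmod d + 1) * (cmod d' + 1)))).
  by rewrite !lt_min r10 r20 r30 r40 divr_gt0// mulr_gt0.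
move=> w; rewrite !lt_min => /andP[/andP[/andP[/Lf {}Lf /Lg {}Lg]]].
move=> /andP[/Hf {}Hf /Hg {}Hg]; rewrite ltr_pdivlMr ?mulr_gt0// => wz.
rewrite (_ : _ - _ = (f w - f z - d * (w - z)) * g z +
  (g w - g z - d' * (w - z)) * f z + (f w - f z) * (g w - g z)); last by ring.
apply: le_trans (cmodD _ _) _; rewrite cmodM.
apply: le_trans (lerD (cmodD _ _) (lexx _)) _; rewrite !cmodM.
have hz := cmod_ge0 (w - z).
have -> : e * cmod (w - z) = e / 3 / (cmod (g z) + 1) * cmod (w - z) * (cmod (g z) + 1)
   + e / 3 / (cmod (f z) + 1) * cmod (w - z) * (cmod (f z) + 1) + e / 3 * cmod (w - z).
  by field; rewrite !lt0r_neq0.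
rewrite !lerD//.
- by rewrite ler_pM ?cmod_ge0// lerDl.
- by rewrite ler_pM ?cmod_ge0// lerDl.
apply: le_trans (ler_pM _ _ Lf Lg) _; rewrite ?cmod_ge0//.
by rewrite mulrACA mulrA ler_wpM2r// mulrC -?mulrA ltW.
Qed.

Lemma cdiffX f z d n : cdiff f z d ->
  exists d', cdiff (fun w => f w ^+ n) z d'.
Proof.
move=> H; elim: n => [|n [d' IH]]; first by exists 0; exact: cdiff_cst.
exists (d * f z ^+ n + f z * d').
by under eq_fun do rewrite exprS; exact: (cdiffM H IH).
Qed.

Lemma cdiffV z : z != 0 -> cdiff (fun w => w^-1) z (- z ^- 2).
Proof.
move=> z0 e e0; have m0 : 0 < cmod z by rewrite cmod_gt0.
exists (Num.min (cmod z / 2) (e * cmod z ^+ 3 / 2)).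
  by rewrite lt_min !divr_gt0// mulr_gt0// exprn_gt0.
move=> w; rewrite lt_min => /andP[w1 w2].
have w3 : cmod z / 2 <= cmod w.
  by have := cmod_lerB z w; rewrite cmod_distC; lra.
have w0 : w != 0 by rewrite -cmod_gt0; lra.
rewrite (_ : _ - _ = (w - z) * (w - z) / (w * z ^+ 2)); last by field; rewrite z0 w0.
rewrite !cmodM cmodV -mulrA (mulrC e) ler_wpM2l ?cmod_ge0//.
rewrite cmodM cmodX ler_pdivrMr; last by rewrite mulr_gt0 ?exprn_gt0//; lra.
apply: le_trans (ltW w2) _; rewrite (_ : e * _ / 2 = e * (cmod z / 2 * cmod z ^+ 2)).
  by rewrite ler_pM2l// ler_pM2r// exprn_gt0.
by field.
Qed.

Lemma is_derive_eps (phi : R -> R) (t d : R) :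
  (forall e, 0 < e -> exists2 r, 0 < r & forall s, `|s - t| < r ->
    `|phi s - phi t - d * (s - t)| <= e * `|s - t|) -> is_derive t 1 phi d.
Proof.
move=> H.
suff C : (fun h : R => h^-1 *: ((phi \o shift t) (h *: (1 : R)) - phi t)) h @[h --> (0 : R)^'] --> d.
  apply: DeriveDef; first by apply/cvg_ex; exists d.
  exact: cvg_lim C.
apply/cvgrPdist_lt => e e0; have [r r0 {}H] := H _ (divr_gt0 e0 (@ltr0n R 2)).
rewrite /= near_withinE; exists r => // h; rewrite /ball_ /= sub0r normrN => hr h0.
have := H (h + t); rewrite addrK => /(_ hr) => H'.
rewrite /GRing.scale /= mulr1 distrC.
have -> : h^-1 * (phi (h + t) - phi t) - d = (phi (h + t) - phi t - d * h) / h by field.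
rewrite normrM normfV ltr_pdivrMr ?normr_gt0//; apply: le_lt_trans H' _.
by rewrite ltr_pM2r ?normr_gt0//; lra.
Qed.

(** The factor [u] selects a real component: 1 and -i give the real and imaginary parts, the
    conjugate of an increment gives its modulus. *)
Lemma cdiff_line (f : R[i] -> R[i]) (u a b d : R[i]) (t : R) :
  cdiff f (a + (t%:C)%C * b) d ->
  is_derive t 1 (fun s : R => complex.Re (u * f (a + (s%:C)%C * b)))
    (complex.Re (u * (d * b))).
Proof.
move=> H; apply: is_derive_eps => e e0.
have pos (x : R[i]) : 0 < cmod x + 1 by rewrite ltr_wpDl// cmod_ge0.
have [r r0 {}H] := H _ (divr_gt0 (divr_gt0 e0 (pos u)) (pos b)).
exists (r / (cmod b + 1)); first by rewrite divr_gt0.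
move=> s; rewrite ltr_pdivlMr// => st.
have E : a + (s%:C)%C * b - (a + (t%:C)%C * b) = ((s - t)%:C)%C * b.
  by rewrite rmorphB /=; ring.
have nb : cmod (((s - t)%:C)%C * b) <= `|s - t| * (cmod b + 1).
  by rewrite cmodM cmod_real ler_wpM2l// lerDl.
have {H} := H (a + (s%:C)%C * b); rewrite E => /(_ (le_lt_trans nb st)) H.
set z1 := f (a + (s%:C)%C * b) in H *; set z2 := f (a + (t%:C)%C * b) in H *.
have -> : complex.Re (u * z1) - complex.Re (u * z2) - complex.Re (u * (d * b)) * (s - t)
   = complex.Re (u * (z1 - z2 - d * (((s - t)%:C)%C * b))).
  by rewrite !(ReM, ReB, ImM, ImB) /=; ring.
apply: le_trans (cmod_Re _) _; rewrite cmodM.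
apply: le_trans (ler_wpM2l (cmod_ge0 _) H) _.
have -> : e * `|s - t| = (cmod u + 1) * (e / (cmod u + 1) / (cmod b + 1) *
   (`|s - t| * (cmod b + 1))) by field; rewrite !lt0r_neq0.
rewrite ler_pM ?cmod_ge0//; last by rewrite ler_wpM2l// !divr_ge0// ltW.
  by rewrite mulr_ge0 ?cmod_ge0// !divr_ge0// ltW.
by rewrite lerDl.
Qed.

(** The real mean value bound is applied to the real part of [u * f] on the segment, where [u] is
    the conjugate of the increment, so that this real increment is |f b - f a|^2. *)
Lemma cdiff_MVI (f f' : R[i] -> R[i]) (a b : R[i]) (K : R) :
  (forall t : R, 0 <= t <= 1 -> cdiff f (a + (t%:C)%C * (b - a)) (f' (a + (t%:C)%C * (b - a)))) ->
  (forall t : R, 0 <= t <= 1 -> cmod (f' (a + (t%:C)%C * (b - a))) <= K) ->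
  cmod (f b - f a) <= K * cmod (b - a).
Proof.
move=> df bf; pose u := ((f b - f a)^*)%C.
have K0 : 0 <= K by apply: le_trans (cmod_ge0 _) (bf 0 _); rewrite lexx ler01.
have uE : cmod u = cmod (f b - f a) by rewrite /u; case: (_ - _) => x y; rewrite !cmodE /= sqrrN.
have := @MVT_bound_itv R (fun s => complex.Re (u * f (a + (s%:C)%C * (b - a))))
  (fun s => complex.Re (u * (f' (a + (s%:C)%C * (b - a)) * (b - a)))) 0 1
  (cmod u * (K * cmod (b - a))) ler01 => H.
have E1 : a + (1%:C)%C * (b - a) = b by rewrite rmorph1 mul1r subrKC.
have E0 : a + (0%:C)%C * (b - a) = a by rewrite rmorph0 mul0r addr0.
have {}H : `|complex.Re (u * f b) - complex.Re (u * f a)| <= cmod u * (K * cmod (b - a)).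
  move: H; rewrite E1 E0 subr0 mulr1; apply=> t t01.
    by apply: cdiff_line; exact: df.
  apply: le_trans (cmod_Re _) _; rewrite !cmodM ler_wpM2l ?cmod_ge0//.
  by rewrite ler_wpM2r ?cmod_ge0// bf.
move: H; rewrite -ReB -mulrBr.
have -> : complex.Re (u * (f b - f a)) = cmod (f b - f a) ^+ 2.
  by rewrite cmod_sqr /u; case: (f b - f a) => x y /=; ring.
rewrite ger0_norm ?exprn_ge0 ?cmod_ge0// uE.
have [->|D0] := eqVneq (f b - f a) 0.
  by rewrite cmod0 mulr_ge0 ?cmod_ge0.
by rewrite expr2 ler_pM2l// cmod_gt0.
Qed.

Lemma cdiff_MVI_ball (f f' : R[i] -> R[i]) (c : R[i]) (r K : R) :
  (forall z, cmod (z - c) < r -> cdiff f z (f' z)) ->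
  (forall z, cmod (z - c) < r -> cmod (f' z) <= K) ->
  forall z w, cmod (z - c) < r -> cmod (w - c) < r ->
  cmod (f w - f z) <= K * cmod (w - z).
Proof.
move=> df bf z w zr wr.
have cvx (t : R) : 0 <= t <= 1 -> cmod (z + (t%:C)%C * (w - z) - c) < r.
  move=> /andP[t0 t1].
  have -> : z + (t%:C)%C * (w - z) - c =
     ((1 - t)%:C)%C * (z - c) + (t%:C)%C * (w - c) by rewrite rmorphB rmorph1; ring.
  apply: le_lt_trans (cmodD _ _) _; rewrite !cmodM !cmod_real.
  rewrite !ger0_norm ?subr_ge0//.
  by have [t2|t2] := leP t (1 / 2); nra.
by apply: cdiff_MVI => t /cvx; [exact: df|exact: bf].
Qed.

End ComplexDerivative.

(** * Primitives of entire functions *)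

Section Primitive.
Variable R : realType.

Lemma potential_increment (F p q : R -> R -> R) (x y p0 q0 e d : R) :
  (forall x y : R, is_derive x 1 (F ^~ y) (p x y)) ->
  (forall x y : R, is_derive y 1 (F x) (q x y)) ->
  (forall s t : R, `|s - x| < d -> `|t - y| < d ->
     `|p s t - p0| <= e /\ `|q s t - q0| <= e) ->
  forall a b : R, `|a - x| < d -> `|b - y| < d ->
  `|F a b - F x y - (p0 * (a - x) + q0 * (b - y))| <= e * (`|a - x| + `|b - y|).
Proof.
move=> dFx dFy H a b ax by_.
have h1 : `|(F a b - p0 * a) - (F x b - p0 * x)| <= e * `|a - x|.
  apply: (@MVT_bound _ (fun s => F s b - p0 * s) (fun s => p s b - p0)) => t ta.
    by apply: is_derive_eq; rewrite /GRing.scale /=; ring.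
  by have [||] := H t b; [exact: le_lt_trans ta ax|exact: by_|].
have d0 : 0 < d by apply: le_lt_trans ax.
have h2 : `|(F x b - q0 * b) - (F x y - q0 * y)| <= e * `|b - y|.
  apply: (@MVT_bound _ (fun s => F x s - q0 * s) (fun s => q x s - q0)) => t ta.
    by apply: is_derive_eq; rewrite /GRing.scale /=; ring.
  by have [||] := H x t; [rewrite subrr normr0|exact: le_lt_trans ta by_|].
rewrite (_ : _ - _ = (F a b - p0 * a - (F x b - p0 * x)) +
   (F x b - q0 * b - (F x y - q0 * y))); last by ring.
by apply: le_trans (ler_normD _ _) _; lra.
Qed.

(** With f = u + iv, f dz = (u dx - v dy) + i (v dx + u dy), and the Cauchy-Riemann equations make
    both real forms closed. Their potentials are the two components of the primitive, and continuity
    of f makes it complex differentiable. *)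
Lemma entire_primitive (f f' : R[i] -> R[i]) : (forall z, cdiff f z (f' z)) ->
  exists F, forall z, cdiff F z (f z).
Proof.
move=> df.
pose u x y := complex.Re (f (x +i* y)%C); pose v x y := complex.Im (f (x +i* y)%C).
have loc x0 y0 e : 0 < e -> exists2 d, 0 < d & forall x y, `|x - x0| < d -> `|y - y0| < d ->
    let D := f' (x0 +i* y0)%C in
    `|u x y - u x0 y0 - (complex.Re D * (x - x0) - complex.Im D * (y - y0))|
      <= e * (`|x - x0| + `|y - y0|) /\
    `|v x y - v x0 y0 - (complex.Im D * (x - x0) + complex.Re D * (y - y0))|
      <= e * (`|x - x0| + `|y - y0|).
  move=> e0; have [d d0 H] := df (x0 +i* y0)%C e e0.
  exists (d / 2) => [|x y xd yd D]; first by rewrite divr_gt0.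
  have le1 := cmod_le_ReIm ((x +i* y)%C - (x0 +i* y0)%C).
  rewrite /= in le1.
  have {}H := H (x +i* y)%C; have {}H := H (le_lt_trans le1 _).
  have {}H : cmod (f (x +i* y)%C - f (x0 +i* y0)%C - D * ((x +i* y)%C - (x0 +i* y0)%C)) <=
    e * (`|x - x0| + `|y - y0|) by apply: le_trans (H _) _; [lra|rewrite ler_pM2l].
  split.
    apply: le_trans H; apply: le_trans (cmod_Re _).
    by rewrite !(ReB, ReM) /=.
  apply: le_trans H; apply: le_trans (cmod_Im _).
  by rewrite !(ImB, ImM) /= (addrC (complex.Im D * _)).
have c1 : closed_form u (fun x y => - v x y).
  move=> x0 y0; set D := f' (x0 +i* y0)%C.
  exists (complex.Re D), (- complex.Im D), (- complex.Re D) => e /(loc x0 y0)[d d0 H].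
  exists d => // x y xd yd; have [h1 h2] := H x y xd yd; split.
    by apply: le_trans h1; rewrite le_eqVlt; apply/orP; left; apply/eqP; congr (`| _ |); rewrite -/D; ring.
  apply: le_trans h2; rewrite -normrN le_eqVlt; apply/orP; left; apply/eqP.
  by congr (`| _ |); rewrite -/D; ring.
have c2 : closed_form v u.
  move=> x0 y0; set D := f' (x0 +i* y0)%C.
  exists (complex.Im D), (complex.Re D), (- complex.Im D) => e /(loc x0 y0)[d d0 H].
  exists d => // x y xd yd; have [h1 h2] := H x y xd yd; split.
    by apply: le_trans h2; rewrite le_eqVlt; apply/orP; left; apply/eqP; congr (`| _ |); rewrite -/D; ring.
  by apply: le_trans h1; rewrite le_eqVlt; apply/orP; left; apply/eqP; congr (`| _ |); rewrite -/D; ring.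
have [F1 [F1x F1y]] := closed_form_exact c1.
have [F2 [F2x F2y]] := closed_form_exact c2.
exists (fun z => (F1 (complex.Re z) (complex.Im z) +i* F2 (complex.Re z) (complex.Im z))%C).
(* Two components each cost [e / 4] times a sum of two coordinates, and that sum is at most twice
   the modulus. *)
move=> [x y] e e0; have e4 : 0 < e / 4 by rewrite divr_gt0.
have [r r0 {}df] := (continuousP_cball _ _).1 (cdiff_continuous (df (x +i* y)%C)) _ e4.
exists (r / 2); first by rewrite divr_gt0.
have H s t : `|s - x| < r / 2 -> `|t - y| < r / 2 ->
    `|u s t - u x y| <= e / 4 /\ `|v s t - v x y| <= e / 4.
  move=> sx ty; have := df (s +i* t)%C.
  have le1 := cmod_le_ReIm ((s +i* t)%C - (x +i* y)%C).
  rewrite /= in le1; move=> /(_ (le_lt_trans le1 _)) H.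
  by split; rewrite /u /v -?ReB -?ImB; [apply: le_trans (cmod_Re _) _|apply: le_trans (cmod_Im _) _];
    rewrite ltW// H//; lra.
move=> [a b] abr /=.
have ar : `|a - x| < r / 2 by apply: le_lt_trans abr; exact: (cmod_Re ((a +i* b)%C - (x +i* y)%C)).
have br : `|b - y| < r / 2 by apply: le_lt_trans abr; exact: (cmod_Im ((a +i* b)%C - (x +i* y)%C)).
have H1 : `|F1 a b - F1 x y - (u x y * (a - x) + - v x y * (b - y))| <= e / 4 * (`|a - x| + `|b - y|).
  apply: (potential_increment F1x F1y) ar br => s t sx ty.
  have [h1 h2] := H s t sx ty; split => //.
  by rewrite -normrN opprB opprK addrC.
have H2 : `|F2 a b - F2 x y - (v x y * (a - x) + u x y * (b - y))| <= e / 4 * (`|a - x| + `|b - y|).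
  apply: (potential_increment F2x F2y) ar br => s t sx ty.
  by have [h1 h2] := H s t sx ty.
apply: le_trans (cmod_le_ReIm _) _.
rewrite !(ReB, ReM, ImB, ImM) /= -/(u x y) -/(v x y).
rewrite mulNr in H1; rewrite (addrC (u x y * (b - y))).
have := cmod_Re ((a +i* b)%C - (x +i* y)%C).
have := cmod_Im ((a +i* b)%C - (x +i* y)%C).
rewrite /= => m1 m2; nra.
Qed.

End Primitive.

(** * Compact subsets of the plane *)

Section PlaneCompactness.
Variable R : realType.
Implicit Types (K : set R[i]) (z w c : R[i]).

(** Compactness as an exchange of quantifiers: a bound that works near each point, and stays valid
    when increased, can be chosen uniformly. *)
Lemma compact_uniform_nat K (P : nat -> R[i] -> Prop) : compact K ->
  (forall z, K z -> exists r : R, 0 < r /\ exists N, forall w, cball z r w ->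
     forall n, (N <= n)%N -> P n w) ->
  exists N, forall z, K z -> P N z.
Proof.
move=> /compact_near_coveringP cK H.
have [z /H[r [r0 [N HN]]]|N _ HN] := cK nat \oo (fun n z => P n z) _.
  exists (cball z r, [set n | (N <= n)%N]).
    by split; [exact: nbhs_cball|exists N].
  by move=> [w n] [/= wr Nn]; exact: HN.
by exists N; apply: HN => /=.
Qed.

Lemma closed_cmod_le (T : topologicalType) (f : T -> R[i]) (r : R) :
  continuous f -> closed [set t | cmod (f t) <= r].
Proof.
move=> cf; apply: (@preimage_closed _ _ (@cmod R \o f) [set x | x <= r]).
  move=> t _; apply: (@continuous_comp _ _ _ f (@cmod R)); first exact: cf.
  exact: continuous_cmod.
exact: closed_le.
Qed.

Lemma bounded_closed_compactC K (M : R) :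
  closed K -> (forall z, K z -> cmod z <= M) -> compact K.
Proof.
move=> clK bK.
pose f (p : R * R) := (p.1 +i* p.2)%C.
have cf : continuous f.
  move=> [x y]; apply/continuousP_cmod => e e0.
  have e2 : 0 < e / 2 by rewrite divr_gt0.
  exists (ball x (e / 2), ball y (e / 2)).
    by split; exact: nbhsx_ballx.
  move=> [s t] [/= xs yt]; rewrite -[X in X < _]/(cmod (f (s, t) - f (x, y))).
  apply: le_lt_trans (cmod_le_ReIm _) _ => /=.
  by move: xs yt; rewrite /ball/= (distrC s) (distrC t); lra.
apply: (subclosed_compact clK (B := f @` (`[- M, M] `*` `[- M, M]))).
  apply: continuous_compact; first exact: continuous_subspaceT.
  by apply: compact_setX; exact: segment_compact.
move=> z Kz; exists (complex.Re z, complex.Im z); last by case: z {Kz}.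
have := bK _ Kz; have := cmod_Re z; have := cmod_Im z.
by split; rewrite /= in_itv /= -ler_norml; lra.
Qed.

Definition cdisk c (r : R) : set R[i] := [set z | cmod (z - c) <= r].

Lemma continuous_subr c : continuous (fun z => z - c).
Proof. by move=> z; apply: (cdiff_continuous (d := 1 - 0)); apply: cdiffB; [exact: cdiff_id|exact: cdiff_cst]. Qed.

Lemma closed_cdisk c r : closed (cdisk c r).
Proof. have := @closed_cmod_le _ (fun z => z - c) r (@continuous_subr c).
exact. Qed.

Lemma compact_cdisk c r : compact (cdisk c r).
Proof.
apply: (bounded_closed_compactC (M := r + cmod c)); first exact: closed_cdisk.
by move=> z; rewrite /cdisk/= => zr; have := cmodD (z - c) c; rewrite subrK; lra.
Qed.

Lemma uniform_continuity_compact K (f : R[i] -> R[i]) (e : R) :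
  compact K -> continuous f -> 0 < e -> exists2 d : R, 0 < d &
  forall z w, K z -> cmod (w - z) < d -> cmod (f w - f z) < e.
Proof.
move=> cK cf e0.
have [z Kz|N HN] := @compact_uniform_nat K (fun n z => forall w,
    cmod (w - z) < n.+1%:R^-1 -> cmod (f w - f z) < e) cK.
  have [r r0 H] := (continuousP_cball _ _).1 (cf z) _ (divr_gt0 e0 (@ltr0n R 2)).
  have r2 : 0 < r / 2 by rewrite divr_gt0.
  exists (r / 2); split=> //; exists (Num.truncn (r / 2)^-1) => w wr n nN u uw.
  have n2 : n.+1%:R^-1 < r / 2.
    rewrite invf_plt ?posrE//; apply: lt_le_trans (truncnS_gt _) _.
    by rewrite ler_nat ltnS.
  have h1 := H w; have h2 := H u; have h3 := cmod_dist_trans u w z.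
  have h4 := cmod_dist_trans (f u) (f z) (f w).
  rewrite (cmod_distC (f z)) in h4; rewrite /cball/= in wr.
  move: (lt_trans uw n2) => {n2 nN}uw.
  have /h1 ? : cmod (w - z) < r by lra.
  have /h2 ? : cmod (u - z) < r by lra.
  lra.
by exists N.+1%:R^-1 => [|z w Kz]; [rewrite invr_gt0|exact: HN].
Qed.

Lemma continuous_bounded_compact K (f : R[i] -> R[i]) : compact K ->
  continuous f -> exists M : R, forall z, K z -> cmod (f z) <= M.
Proof.
move=> cK cf.
have [z Kz|N HN] := @compact_uniform_nat K (fun n z => cmod (f z) <= n%:R) cK; last by exists N%:R.
have [r r0 H] := (continuousP_cball _ _).1 (cf z) _ ltr01.
exists r; split=> //; exists (Num.truncn (cmod (f z) + 1)).+1 => w /H wr n nN.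
have := truncnS_gt (cmod (f z) + 1); have := cmod_lerB (f w) (f z).
have : (Num.truncn (cmod (f z) + 1)).+1%:R <= n%:R :> R by rewrite ler_nat.
lra.
Qed.

End PlaneCompactness.

(** * The maximum principle for twice differentiable functions *)

Section MaximumModulus.
Variable R : realType.
Implicit Types (f F : R[i] -> R[i]) (z w a b c : R[i]).

(** The remainder has derivative [F1 w - F1 z - d2 (w - z)], which is o(|w - z|) by
    differentiability of [F1] at the single point [z]; the mean value inequality gains the second
    power. *)
Lemma cdiff_taylor2 F F1 z (d2 : R[i]) : (forall w, cdiff F w (F1 w)) ->
  cdiff F1 z d2 -> forall e : R, 0 < e -> exists2 r : R, 0 < r &
  forall h, cmod h < r ->
  cmod (F (z + h) - F z - F1 z * h - d2 / 2 * h ^+ 2) <= e * cmod h ^+ 2.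
Proof.
move=> dF dF1 e e0; have [r r0 H] := dF1 e e0; exists r => // h hr.
pose G w := F w - F1 z * (w - z) - d2 / 2 * (w - z) * (w - z).
pose G' w := F1 w - F1 z - d2 * (w - z).
have dG w : cdiff G w (G' w).
  have dd : cdiff (fun w => w - z) w (1 - 0) by apply: cdiffB; [exact: cdiff_id|exact: cdiff_cst].
  have -> : G' w = F1 w - (0 * (w - z) + F1 z * (1 - 0)) -
     ((0 * (w - z) + d2 / 2 * (1 - 0)) * (w - z) + d2 / 2 * (w - z) * (1 - 0)).
    by rewrite /G'; field.
  apply: cdiffB; last by apply: cdiffM => //; apply: cdiffM => //; exact: cdiff_cst.
  by apply: cdiffB => //; apply: cdiffM => //; exact: cdiff_cst.
have := @cdiff_MVI _ G G' z (z + h) (e * cmod h).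
have E : z + h - z = h by rewrite addrC addKr.
rewrite E -mulrA -expr2 => H'.
have -> : F (z + h) - F z - F1 z * h - d2 / 2 * h ^+ 2 = G (z + h) - G z.
  by rewrite /G E subrr !mulr0; ring.
apply: H' => t /andP[t0 t1]; first exact: dG.
have -> : (t%:C)%C * h = (z + (t%:C)%C * h) - z by rewrite addrC addKr.
have thr : cmod ((z + (t%:C)%C * h) - z) <= cmod h.
  rewrite addrC addKr cmodM cmod_real ger0_norm//.
  by rewrite -[leRHS]mul1r ler_wpM2r// cmod_ge0.
set u := z + _ in thr *; rewrite subrKC.
apply: le_trans (H _ (le_lt_trans thr hr)) _.
by rewrite ler_pM2l.
Qed.

Lemma cmod_sqrD_ge a X : cmod a ^+ 2 +
  2 * (complex.Re a * complex.Re X + complex.Im a * complex.Im X) <= cmod (a + X) ^+ 2.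
Proof. by rewrite !cmod_sqr ReD ImD; nra. Qed.

Lemma cmod_dot a X :
  - (cmod a * cmod X) <= complex.Re a * complex.Re X + complex.Im a * complex.Im X.
Proof.
have := cmod_Re ((a^*)%C * X); rewrite cmodM.
have -> : cmod (a^*)%C = cmod a by case: a => x y; rewrite !cmodE /= sqrrN.
have -> : complex.Re ((a^*)%C * X) = complex.Re a * complex.Re X + complex.Im a * complex.Im X.
  by case: a X => ? ? [? ?] /=; ring.
by rewrite ler_norml => /andP[].
Qed.

Definition max_modulus f := forall c (r M : R),
  (forall z, cmod (z - c) = r -> cmod (f z) <= M) ->
  forall z, cmod (z - c) <= r -> cmod (f z) <= M.

(* At an interior maximum of [|F|^2 + eta |z - c|^2] the mean over the four
   points [z + i^k h] exceeds the central value to second order. *)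
Lemma cdiff2_max_modulus F F1 F2 : (forall w, cdiff F w (F1 w)) ->
  (forall w, cdiff F1 w (F2 w)) -> max_modulus F.
Proof.
move=> dF dF1 c r M bM z zr.
have [zr'|zr'] := eqVneq (cmod (z - c)) r; first exact: bM.
have r0 : 0 < r by rewrite (le_lt_trans (cmod_ge0 (z - c)))// lt_neqAle zr'.
have M0 : 0 <= M.
  by apply: le_trans (cmod_ge0 _) (bM (c + (r%:C)%C) _); rewrite addrC addKr cmod_real gtr0_norm.
rewrite -(ler_pXn2r (n := 2)) ?nnegrE ?cmod_ge0//.
apply/ler_addgt0Pl => e e0.
(* The added term equals exactly [e] on the circle, and inside it gives the four-point mean the
   definite excess eta h^2. *)
pose eta := e / r ^+ 2; have eta0 : 0 < eta by rewrite divr_gt0// exprn_gt0.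
pose w z := cmod (F z) ^+ 2 + eta * cmod (z - c) ^+ 2.
have cw : continuous w.
  have c1 : continuous (fun z => cmod (F z) ^+ 2).
    move=> x; apply: (@continuous_comp _ _ _ (fun z => cmod (F z)) (fun y : R => y ^+ 2)).
      by apply: (@continuous_comp _ _ _ F (@cmod R)); [exact: cdiff_continuous (dF _)|exact: continuous_cmod].
    exact: exprn_continuous.
  have c2 : continuous (fun z => eta * cmod (z - c) ^+ 2).
    move=> x; apply: (@continuous_comp _ _ _ (fun z => cmod (z - c)) (fun y : R => eta * y ^+ 2)).
      apply: (@continuous_comp _ _ _ (fun z => z - c) (@cmod R)); first exact: continuous_subr.
      exact: continuous_cmod.
    apply: (@continuous_comp _ _ _ (fun y : R => y ^+ 2) (fun y : R => eta * y)).
      exact: exprn_continuous.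
    exact: mulrl_continuous.
  by move=> x; exact: (continuousD (c1 x) (c2 x)).
have [|z1] := compact_EVT_max _ (@compact_cdisk R c r) (continuous_subspaceT cw).
  by exists z.
rewrite inE /cdisk/= => z1r z1max.
have {}z1max y : cmod (y - c) <= r -> w y <= w z1 by move=> yr; apply: z1max; rewrite inE.
suff z1r' : cmod (z1 - c) = r.
  apply: (@le_trans _ _ (w z)); first by rewrite lerDl mulr_ge0 ?exprn_ge0 ?cmod_ge0// ltW.
  apply: le_trans (z1max z zr) _; rewrite /w z1r' /eta mulfVK ?lt0r_neq0 ?exprn_gt0// addrC lerD2l.
  by rewrite ler_pXn2r ?nnegrE ?cmod_ge0// bM.
apply/eqP; rewrite eq_le z1r /= leNgt; apply/negP => z1r'.
(* Chosen so that the four Taylor errors, each multiplied by 2|F z1|, together stay below the gain 4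
   eta h^2. *)
pose e' := eta / (4 * (cmod (F z1) + 1)).
have a1 : 0 < cmod (F z1) + 1 by rewrite ltr_wpDl// cmod_ge0.
have e'0 : 0 < e' by rewrite divr_gt0// mulr_gt0.
have [s s0 T] := cdiff_taylor2 dF (dF1 z1) e'0.
have [h [h0 hs hr]] : exists h : R, [/\ 0 < h, h < s & h < r - cmod (z1 - c)].
  have m0 : 0 < Num.min s (r - cmod (z1 - c)) by rewrite lt_min s0 subr_gt0.
  exists (Num.min s (r - cmod (z1 - c)) / 2); split; first by rewrite divr_gt0.
    by apply: (@lt_le_trans _ _ (Num.min s (r - cmod (z1 - c)))); rewrite ?ge_min ?lexx//; lra.
  by apply: (@lt_le_trans _ _ (Num.min s (r - cmod (z1 - c)))); rewrite ?ge_min ?lexx ?orbT//; lra.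
pose k1 : R[i] := (h +i* 0)%C; pose k2 : R[i] := (0 +i* h)%C.
have n1 : cmod k1 = h by rewrite cmodE /= expr0n addr0 sqrtr_sqr gtr0_norm.
have n2 : cmod k2 = h by rewrite cmodE /= expr0n add0r sqrtr_sqr gtr0_norm.
pose X k := F (z1 + k) - F z1.
pose P k := F (z1 + k) - F z1 - F1 z1 * k - F2 z1 / 2 * k ^+ 2.
have B k : cmod k = h -> cmod (P k) <= e' * h ^+ 2 by move=> kh; rewrite -kh; apply: T; rewrite kh.
have L k : cmod k = h -> cmod (F z1) ^+ 2 + 2 * (complex.Re (F z1) * complex.Re (X k) +
   complex.Im (F z1) * complex.Im (X k)) + eta * cmod (z1 + k - c) ^+ 2 <= w z1.
  move=> kh; apply: le_trans (z1max (z1 + k) _); last first.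
    by rewrite addrAC; apply: le_trans (cmodD _ _) _; lra.
  rewrite /w lerD2r (_ : F (z1 + k) = F z1 + X k); last by rewrite /X subrKC.
  exact: cmod_sqrD_ge.
(* Linear terms cancel between k and -k, quadratic terms because (ih)^2 = -h^2; only the Taylor
   errors [P] survive. *)
have XP : X k1 + X (- k1) + X k2 + X (- k2) = P k1 + P (- k1) + P k2 + P (- k2).
  have kk : k2 ^+ 2 = - k1 ^+ 2.
    by apply/eqP; rewrite eq_complex /=; apply/andP; split; apply/eqP; ring.
  by rewrite /X /P !sqrrN kk; field.
have D k : cmod k = h -> - (cmod (F z1) * (e' * h ^+ 2)) <=
    complex.Re (F z1) * complex.Re (P k) + complex.Im (F z1) * complex.Im (P k).
  by move=> /B kh; apply: le_trans (cmod_dot _ _); rewrite lerN2 ler_wpM2l ?cmod_ge0.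
clearbody X P.
have XPr := congr1 (@complex.Re R) XP; have XPi := congr1 (@complex.Im R) XP.
rewrite !ReD in XPr; rewrite !ImD in XPi.
have l1 := L _ n1; have l2 := L (- k1); have l3 := L _ n2; have l4 := L (- k2).
have d1 := D _ n1; have d2 := D (- k1); have d3 := D _ n2; have d4 := D (- k2).
rewrite cmodN in l2 d2; rewrite cmodN in l4 d4.
have {}l2 := l2 n1; have {}l4 := l4 n2; have {}d2 := d2 n1; have {}d4 := d4 n2.
have Ew : w z1 = cmod (F z1) ^+ 2 + eta * cmod (z1 - c) ^+ 2 by [].
have Q : cmod (z1 + k1 - c) ^+ 2 + cmod (z1 - k1 - c) ^+ 2 + cmod (z1 + k2 - c) ^+ 2 +
    cmod (z1 - k2 - c) ^+ 2 = 4 * cmod (z1 - c) ^+ 2 + 4 * h ^+ 2.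
  by rewrite !cmod_sqr !(ReB, ImB, ReD, ImD) /=; ring.
have Q' := congr1 (fun x => eta * x) Q; rewrite /= !mulrDr in Q'.
have hh : 0 < eta * h ^+ 2 by rewrite mulr_gt0// exprn_gt0.
have e'E : cmod (F z1) * (e' * h ^+ 2) * 4 <= eta * h ^+ 2.
  rewrite /e'.
  have -> : cmod (F z1) * (eta / (4 * (cmod (F z1) + 1)) * h ^+ 2) * 4 =
     cmod (F z1) / (cmod (F z1) + 1) * (eta * h ^+ 2) by field; rewrite lt0r_neq0.
  rewrite -[leRHS]mul1r ler_wpM2r ?(ltW hh)//.
  by rewrite ler_pdivrMr// mul1r lerDl.
have F1' := congr1 (fun x => complex.Re (F z1) * x) XPr.
have F2' := congr1 (fun x => complex.Im (F z1) * x) XPi.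
rewrite /= !mulrDr in F1' F2'.
lra.
Qed.

End MaximumModulus.

(** * Maximum modulus for entire functions and continuity of the derivative *)

Section EntireFunctions.
Variable R : realType.
Implicit Types (f F u : R[i] -> R[i]) (z w a b c : R[i]).

Lemma cdiff_shift F z (d h : R[i]) : cdiff F (z + h) d -> cdiff (fun w => F (w + h)) z d.
Proof.
move=> H e /H[r r0 {}H]; exists r => // w wz.
by have := H (w + h); rewrite opprD addrACA subrr addr0; apply.
Qed.

(* [f] is a locally uniform limit of the difference quotients of a primitive,
   which is twice differentiable. *)
Lemma entire_max_modulus f (f' : R[i] -> R[i]) : (forall z, cdiff f z (f' z)) ->
  max_modulus f.
Proof.
move=> df c r M bM z zr; have [F dF] := entire_primitive df.
apply/ler_addgt0Pl => e e0; have e2 : 0 < e / 2 by rewrite divr_gt0.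
have cf : continuous f by move=> x; exact: cdiff_continuous (df x).
have [d d0 Hd] := uniform_continuity_compact (@compact_cdisk R c r) cf e2.
have [h [h0 hd]] : exists h : R, 0 < h /\ h < d by exists (d / 2); lra.
pose k : R[i] := (h%:C)%C; have kh : cmod k = h by rewrite cmod_real gtr0_norm.
pose D w := F (w + k) - F w.
have dD w : cdiff D w (f (w + k) - f w).
  by apply: cdiffB => //; exact: cdiff_shift.
have dD' w : cdiff (fun w => f (w + k) - f w) w (f' (w + k) - f' w).
  by apply: cdiffB => //; exact: cdiff_shift.
have est w : cmod (w - c) <= r -> cmod (D w - k * f w) <= e / 2 * h.
  move=> wr.
  have := @cdiff_MVI R (fun y => F y - f w * y) (fun y => f y - f w) w (w + k) (e / 2).
  rewrite [w + k - w]addrC addKr kh => H.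
  rewrite (_ : _ - _ = F (w + k) - f w * (w + k) - (F w - f w * w)); last by rewrite /D; ring.
  apply: H => t /andP[t0 t1].
    have -> : f (w + (t%:C)%C * k) - f w = f (w + (t%:C)%C * k) - (0 * (w + (t%:C)%C * k) + f w * 1) by ring.
    by apply: cdiffB => //; apply: cdiffM; [exact: cdiff_cst|exact: cdiff_id].
  apply: ltW; apply: Hd => //; rewrite addrC addKr cmodM kh cmod_real ger0_norm//.
  by apply: le_lt_trans hd; rewrite -[leRHS]mul1r ler_wpM2r// ltW.
have bD w : cmod (w - c) <= r -> cmod (D w) <= h * (M + e / 2).
  move=> wr; apply: (cdiff2_max_modulus dD dD') wr => y yr.
  rewrite -(subrK (k * f y) (D y)); apply: le_trans (cmodD _ _) _.
  rewrite cmodM kh; have := est y; rewrite yr lexx => /(_ isT).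
  by have := bM y yr; nra.
have h1 := est z zr; have h2 := bD z zr.
have : h * cmod (f z) <= h * (e + M).
  rewrite -[in leLHS]kh -cmodM.
  rewrite (_ : k * f z = D z - (D z - k * f z)); last by ring.
  by apply: le_trans (cmodB _ _) _; lra.
by rewrite ler_pM2l.
Qed.

(** A factor vanishing at [a] turns continuity there into differentiability, which is how
    exceptional points are absorbed. *)
Lemma cdiff_mul_vanish f a : {for a, continuous f} ->
  cdiff (fun z => f z * (z - a)) a (f a).
Proof.
move=> /continuousP_cball cf e /cf[d d0 H]; exists d => // w /H/ltW h.
rewrite subrr mulr0 subr0 -mulrBl cmodM.
by rewrite ler_wpM2r ?cmod_ge0.
Qed.

(** Geometric growth beats the constant [L / d]: in the limit only the n-th roots of the two sides
    compare. *)
Lemma exp_growth_le (x M d L : R) : 0 <= M -> 0 < d ->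
  (forall n : nat, x ^+ n * d <= M ^+ n * L) -> x <= M.
Proof.
move=> M0 d0 H; rewrite leNgt; apply/negP => Mx.
have x0 : 0 < x by apply: le_lt_trans Mx.
have : (M / x) ^+ n @[n --> \oo] --> 0.
  apply: cvg_expr; rewrite ger0_norm; last by rewrite divr_ge0// ltW.
  by rewrite ltr_pdivrMr// mul1r.
have L1 : 0 < `|L| + 1 by rewrite ltr_wpDl.
move=> /cvgr0_norm_lt/(_ _ (divr_gt0 d0 L1))[n _ /(_ n (leqnn _))] /=.
rewrite ger0_norm; last by rewrite exprn_ge0// divr_ge0// ltW.
rewrite expr_div_n.
rewrite ltr_pdivlMr// mulrAC ltr_pdivrMr ?exprn_gt0// => h.
have := H n; have := ler_norm L; have : 0 <= M ^+ n by rewrite exprn_ge0.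
by move=> ? ? ?; nra.
Qed.

(* [u^n (z - a) (z - b)] is entire for every [n]; let [n] tend to infinity. *)
Lemma max_modulus_removable u a b : continuous u ->
  (forall z, z != a -> z != b -> exists d, cdiff u z d) ->
  forall c (r M : R), (forall z, cmod (z - c) = r -> cmod (u z) <= M) ->
  forall z, cmod (z - c) < r -> cmod (u z) <= M.
Proof.
move=> cu du c r M bM z zr.
have r0 : 0 < r by rewrite (le_lt_trans (cmod_ge0 (z - c))).
have M0 : 0 <= M.
  by apply: le_trans (cmod_ge0 _) (bM (c + (r%:C)%C) _); rewrite addrC addKr cmod_real gtr0_norm.
pose g n w := u w ^+ n * (w - a) * (w - b).
have cun n : continuous (fun w => u w ^+ n).
  move=> x; elim: n => [|n IH]; first by under eq_fun do rewrite expr0; exact: cst_continuous.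
  rewrite (_ : (fun w => u w ^+ n.+1) = u \* (fun w => u w ^+ n)).
    exact: continuousM (cu x) IH.
  by apply/funext => w; rewrite /= exprS.
have dsub x w : exists d, cdiff (fun w => w - x) w d.
  by exists (1 - 0); apply: cdiffB; [exact: cdiff_id|exact: cdiff_cst].
have dg n w : exists d, cdiff (g n) w d.
  have [->|wb] := eqVneq w b.
    exists (u b ^+ n * (b - a)); apply: (@cdiff_mul_vanish (fun w => u w ^+ n * (w - a))).
    by apply: continuousM; [exact: cun|exact: continuous_subr].
  have [->|wa] := eqVneq w a.
    have -> : g n = fun w => u w ^+ n * (w - b) * (w - a) by apply/funext => y; rewrite /g mulrAC.
    exists (u a ^+ n * (a - b)); apply: (@cdiff_mul_vanish (fun w => u w ^+ n * (w - b))).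
    by apply: continuousM; [exact: cun|exact: continuous_subr].
  have [d dud] := du w wa wb; have [d1 d1P] := cdiffX n dud.
  have [d2 d2P] := dsub a w; have [d3 d3P] := dsub b w.
  by eexists; exact: (cdiffM (cdiffM d1P d2P) d3P).
pose L := (r + cmod (c - a)) * (r + cmod (c - b)).
have gL n w : cmod (w - c) <= r -> cmod (g n w) <= M ^+ n * L.
  move=> wr; have [g' dg'] := choice (dg n).
  apply: (entire_max_modulus dg') wr => y yr.
  rewrite /g !cmodM cmodX -mulrA ler_pM ?exprn_ge0 ?mulr_ge0 ?cmod_ge0//.
    by apply: lerXn2r; rewrite ?nnegrE ?cmod_ge0 ?bM.
  have := cmod_dist_trans y c a; have := cmod_dist_trans y c b.
  by rewrite yr => ? ?; rewrite ler_pM ?cmod_ge0.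
have generic w : w != a -> w != b -> cmod (w - c) < r -> cmod (u w) <= M.
  move=> wa wb wr; apply: (@exp_growth_le _ _ (cmod (w - a) * cmod (w - b)) L) => //.
    by rewrite mulr_gt0// cmod_gt0 subr_eq0.
  by move=> n; have := gL n w (ltW wr); rewrite /g !cmodM cmodX mulrA.
(* At [a] and [b] themselves the extra factors vanish; the bound is recovered by continuity from
   nearby points [z + t] distinct from both. *)
apply/ler_addgt0Pl => e e0.
have [d d0 H] := (continuousP_cball _ _).1 (cu z) _ e0.
have [t [t0 td tr [ta tb]]] : exists t : R, [/\ 0 < t, t < d, t < r - cmod (z - c) &
    z + (t%:C)%C != a /\ z + (t%:C)%C != b].
  have pos (x : R[i]) : exists2 s : R, 0 < s & forall t : R, 0 < t -> t < s -> z + (t%:C)%C != x.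
    have [zx|zx] := eqVneq z x.
      exists 1 => // t t0 _; rewrite zx -subr_eq0 addrC addKr.
      by rewrite -cmod_gt0 cmod_real normr_gt0 gt_eqF.
    exists (cmod (z - x)) => [|t t0 tz]; first by rewrite cmod_gt0 subr_eq0.
    apply/eqP => zt; move: tz; rewrite -zt opprD addNKr cmodN cmod_real gtr0_norm//.
    by rewrite ltxx.
  have [s1 s10 H1] := pos a; have [s2 s20 H2] := pos b.
  pose m := Num.min (Num.min s1 s2) (Num.min d (r - cmod (z - c))).
  have m0 : 0 < m by rewrite !lt_min s10 s20 d0 subr_gt0.
  have : m / 2 < m by lra.
  rewrite {2}/m !lt_min => /andP[/andP[h1 h2] /andP[h3 h4]].
  by exists (m / 2); split=> //; rewrite ?divr_gt0//; split; [apply: H1|apply: H2]; rewrite ?divr_gt0.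
have := generic _ ta tb; have := cmod_dist_trans (z + (t%:C)%C) z c.
have zt : cmod (z + (t%:C)%C - z) = t by rewrite addrC addKr cmod_real gtr0_norm.
rewrite zt => h1 h2; have /h2 h3 : cmod (z + (t%:C)%C - c) < r by lra.
have := H (z + (t%:C)%C); rewrite zt => /(_ td); rewrite cmod_distC.
by have := cmod_lerB (u z) (u (z + (t%:C)%C)); lra.
Qed.

(** The difference quotient, continued by the derivative at [a]: continuous everywhere and
    differentiable off [a], as [max_modulus_removable] requires. *)
Definition dslope f (f' : R[i] -> R[i]) a z :=
  if z == a then f' a else (f z - f a) / (z - a).

Lemma dslope_cdiff f (f' : R[i] -> R[i]) a z : (forall z, cdiff f z (f' z)) ->
  z != a -> exists d, cdiff (dslope f f' a) z d.
Proof.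
move=> df za.
have zam : z - a != 0 by rewrite subr_eq0.
have d1 : cdiff (fun w => f w - f a) z (f' z - 0).
  by apply: cdiffB => //; exact: cdiff_cst.
have d2 : cdiff (fun w => w - a) z (1 - 0) by apply: cdiffB; [exact: cdiff_id|exact: cdiff_cst].
have d3 : cdiff ((fun w => w^-1) \o (fun w => w - a)) z _ := cdiff_comp d2 (cdiffV zam).
eexists; apply: (cdiff_near (r := cmod (z - a))) (cdiffM d1 d3); first by rewrite cmod_gt0.
move=> w wz; rewrite /dslope; case: eqVneq => // wa.
by move: wz; rewrite wa cmod_distC ltxx.
Qed.

Lemma dslope_continuous f (f' : R[i] -> R[i]) a : (forall z, cdiff f z (f' z)) ->
  continuous (dslope f f' a).
Proof.
move=> df z; have [->|za] := eqVneq z a; last first.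
  by have [d /cdiff_continuous] := dslope_cdiff df za.
apply/continuousP_cball => e e0.
have [r r0 H] := df a _ (divr_gt0 e0 (@ltr0n R 2)); exists r => // w /H {}H.
rewrite /dslope eqxx; case: eqVneq => [_|wa]; first by rewrite subrr cmod0.
have wam : w - a != 0 by rewrite subr_eq0.
rewrite (_ : _ - _ = (f w - f a - f' a * (w - a)) / (w - a)); last by field.
rewrite cmodM cmodV ltr_pdivrMr ?cmod_gt0//; apply: le_lt_trans H _.
by rewrite ltr_pM2r ?cmod_gt0//; lra.
Qed.

(** The values of the slope functions based at [a] and [b] are [f' a] and the chord slope at the
    point a, the chord slope and [f' b] at the point b. Their difference is O(|a - b|) on the unit
    circle around [c], hence inside it by the maximum principle, and the two estimates add up. *)
Lemma entire_derivative_lipschitz f (f' : R[i] -> R[i]) c :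
  (forall z, cdiff f z (f' z)) -> exists K : R, forall a b,
  cmod (a - c) < 1 / 2 -> cmod (b - c) < 1 / 2 -> cmod (f' a - f' b) <= K * cmod (a - b).
Proof.
move=> df.
have cf : continuous f by move=> x; exact: cdiff_continuous (df x).
have [B HB] := continuous_bounded_compact (@compact_cdisk R c 1) cf.
have far z a : cmod (z - c) = 1 -> cmod (a - c) < 1 / 2 ->
    1 / 2 <= cmod (z - a) <= 2 /\ z != a.
  move=> z1 a2; have := cmod_dist_trans z a c; have := cmod_dist_trans z c a.
  rewrite (cmod_distC c a) z1 => h1 h2; split; first by apply/andP; split; lra.
  by rewrite -subr_eq0 -cmod_gt0; lra.
have gB a b : cmod (a - c) < 1 / 2 -> cmod (b - c) < 1 / 2 -> cmod (dslope f f' a b) <= 4 * B.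
  move=> a2 b2.
  apply: (@max_modulus_removable (dslope f f' a) a a (dslope_continuous df) _ c 1); last by lra.
    by move=> z za _; exact: dslope_cdiff.
  move=> z z1; have [/andP[h1 h2] za] := far z a z1 a2.
  rewrite /dslope (negPf za) cmodM cmodV ler_pdivrMr; last by lra.
  have hz : cmod (f z) <= B by apply: HB; rewrite /cdisk/= z1.
  have ha : cmod (f a) <= B by apply: HB; rewrite /cdisk/=; lra.
  apply: le_trans (cmodB _ _) _.
  by have := cmod_ge0 (f z); nra.
have L a b : cmod (a - c) < 1 / 2 -> cmod (b - c) < 1 / 2 ->
    cmod (f b - f a) <= 4 * B * cmod (b - a).
  move=> a2 b2; have [->|ba] := eqVneq b a; first by rewrite !subrr cmod0 mulr0.
  have := gB a b a2 b2; rewrite /dslope (negPf ba) cmodM cmodV ler_pdivrMr//.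
  by rewrite cmod_gt0 subr_eq0.
(* On the circle the numerator is at most (2 B + 8 B)|a - b| and the denominator at least 1/4,
   whence 40 B. *)
have G a b : cmod (a - c) < 1 / 2 -> cmod (b - c) < 1 / 2 ->
    forall z, cmod (z - c) < 1 -> cmod (dslope f f' a z - dslope f f' b z) <= 40 * B * cmod (a - b).
  move=> a2 b2.
  apply: (@max_modulus_removable _ a b).
  - by move=> x; apply: continuousB; exact: dslope_continuous.
  - move=> z za zb; have [d1 h1] := dslope_cdiff df za; have [d2 h2] := dslope_cdiff df zb.
    by exists (d1 - d2); exact: cdiffB.
  move=> z z1; have [/andP[h1 h2] za] := far z a z1 a2; have [/andP[h3 h4] zb] := far z b z1 b2.
  have za' : z - a != 0 by rewrite subr_eq0. have zb' : z - b != 0 by rewrite subr_eq0.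
  rewrite /dslope (negPf za) (negPf zb).
  rewrite (_ : _ - _ = ((f z - f a) * (a - b) + (f b - f a) * (z - a)) / ((z - a) * (z - b))); last first.
    by field; rewrite za' zb'.
  have hz : cmod (f z) <= B by apply: HB; rewrite /cdisk/= z1.
  have ha : cmod (f a) <= B by apply: HB; rewrite /cdisk/=; lra.
  have Lab := L a b a2 b2; rewrite (cmod_distC b a) in Lab.
  rewrite !cmodM cmodV cmodM ler_pdivrMr; last by rewrite mulr_gt0; lra.
  apply: le_trans (cmodD _ _) _; rewrite !cmodM.
  have B0 : 0 <= B by apply: le_trans hz; exact: cmod_ge0.
  have ab0 := cmod_ge0 (a - b).
  have t1 : cmod (f z - f a) * cmod (a - b) <= 2 * B * cmod (a - b).
    by rewrite ler_wpM2r//; apply: le_trans (cmodB _ _) _; lra.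
  have t2 : cmod (f b - f a) * cmod (z - a) <= 4 * B * cmod (a - b) * 2.
    by rewrite ler_pM ?cmod_ge0.
  have Bab : 0 <= B * cmod (a - b) by rewrite mulr_ge0.
  have t3 : 1 / 4 <= cmod (z - a) * cmod (z - b) by nra.
  by nra.
exists (80 * B) => a b a2 b2; have [->|ab] := eqVneq a b; first by rewrite !subrr cmod0 mulr0.
have a1 : cmod (a - c) < 1 by lra. have b1 : cmod (b - c) < 1 by lra.
have h1 := G a b a2 b2 a a1; have h2 := G a b a2 b2 b b1.
rewrite /dslope !eqxx (negPf ab) (eq_sym b) (negPf ab) in h1 h2.
rewrite (_ : f' a - f' b = (f' a - (f a - f b) / (a - b)) + ((f b - f a) / (b - a) - f' b)).
  by apply: le_trans (cmodD _ _) _; lra.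
have abm : a - b != 0 by rewrite subr_eq0.
by rewrite -(opprB a b) -(opprB (f a) (f b)) invrN mulrNN; ring.
Qed.

Lemma entire_derivative_continuous f (f' : R[i] -> R[i]) :
  (forall z, cdiff f z (f' z)) -> continuous f'.
Proof.
move=> df z; have [K HK] := entire_derivative_lipschitz z df.
apply/continuousP_cball => e e0.
have K1 : 0 < `|K| + 1 by rewrite ltr_wpDl.
exists (Num.min (1 / 2) (e / (`|K| + 1))); first by rewrite lt_min !divr_gt0.
move=> w; rewrite lt_min => /andP[w1]; rewrite ltr_pdivlMr// => w2.
have := HK w z w1; rewrite subrr cmod0 divr_gt0// => /(_ isT).
by have := ler_norm K; have := cmod_ge0 (w - z); nra.
Qed.

End EntireFunctions.

(** * The inverse function theorem *)

Section LocalInverse.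
Variable R : realType.
Variables (F F' : R[i] -> R[i]).
Hypothesis dF : forall z, cdiff F z (F' z).
Hypothesis cF' : continuous F'.

(** Near [w] the map is a small perturbation of multiplication by [F' w], hence expanding and
    injective. A solution of F z = y is found by minimising |F - y| over a closed disc. *)
Lemma local_inverse w (r0 : R) : F' w != 0 -> 0 < r0 ->
  exists r m s : R, [/\ 0 < r <= r0, 0 < m, 0 < s,
    forall z z', cball w r z -> cball w r z' -> m * cmod (z - z') <= cmod (F z - F z') &
    forall y, cball (F w) s y -> exists2 z, cball w r z & F z = y].
Proof.
move=> d0 r00; have m0 : 0 < cmod (F' w) by rewrite cmod_gt0.
have [r1 r10 H] := (continuousP_cball _ _).1 (@cF' w) _ (divr_gt0 m0 (@ltr0n R 2)).
pose r := Num.min r0 r1; have r_gt0 : 0 < r by rewrite lt_min r00.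
have rr0 : r <= r0 by rewrite ge_min lexx.
have rr1 : r <= r1 by rewrite ge_min lexx orbT.
pose m := cmod (F' w) / 2; have m_gt0 : 0 < m by rewrite divr_gt0.
have lip z z' : cball w r z -> cball w r z' -> m * cmod (z - z') <= cmod (F z - F z').
  move=> zr zr'.
  have dG y : cdiff (fun y => F y - F' w * y) y (F' y - (0 * y + F' w * 1)).
    by apply: cdiffB => //; apply: cdiffM; [exact: cdiff_cst|exact: cdiff_id].
  have := @cdiff_MVI_ball R (fun y => F y - F' w * y) (fun y => F' y - (0 * y + F' w * 1))
    w r m (fun y _ => dG y) _ z' z zr' zr.
  have b y : cmod (y - w) < r -> cmod (F' y - (0 * y + F' w * 1)) <= m.
    move=> yr; rewrite mul0r add0r mulr1 ltW// H//; exact: lt_le_trans yr rr1.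
  move=> /(_ b); have := cmod_lerB (F' w * (z - z')) (F z - F z').
  rewrite (_ : F' w * (z - z') - (F z - F z') = - (F z - F' w * z - (F z' - F' w * z'))); last by ring.
  by rewrite cmodN cmodM /m; lra.
(* On the circle of radius [r2], F is at distance at least m r2 = 2 s from [F w], so for |y - F w| <
   s the minimum is attained in the interior. *)
pose r2 := r / 2; pose s := m * r2 / 2.
have r20 : 0 < r2 by rewrite divr_gt0.
have s0 : 0 < s by rewrite divr_gt0// mulr_gt0.
exists r, m, s; split => //; first by rewrite r_gt0.
move=> y ys.
have cFy : continuous (fun z => cmod (F z - y)).
  move=> x; apply: (@continuous_comp _ _ _ (fun z => F z - y) (@cmod R)).
    by apply: (cdiff_continuous (d := F' x - 0)); apply: cdiffB => //; exact: cdiff_cst.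
  exact: continuous_cmod.
have [|z1] := compact_EVT_min _ (@compact_cdisk R w r2) (continuous_subspaceT cFy).
  by exists w; rewrite /cdisk/= subrr cmod0 ltW.
rewrite inE /cdisk/= => z1r z1min.
have {}z1min z : cmod (z - w) <= r2 -> cmod (F z1 - y) <= cmod (F z - y).
  by move=> zr; apply: z1min; rewrite inE.
have z1s : cmod (F z1 - y) < s.
  apply: le_lt_trans (z1min w _) _; first by rewrite subrr cmod0 ltW.
  by rewrite cmod_distC.
have in_r z : cmod (z - w) <= r2 -> cball w r z by rewrite /cball/= /r2; lra.
have z1in : cmod (z1 - w) < r2.
  rewrite lt_neqAle z1r andbT; apply/eqP => z1E.
  have := lip z1 w (in_r _ z1r) (cballxx w r_gt0); rewrite z1E.
  have := cmod_dist_trans (F z1) y (F w); move: ys; rewrite /cball/= => ys.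
  by rewrite /s in z1s ys; lra.
exists z1; first exact: in_r.
apply/eqP; rewrite -subr_eq0; apply/negPn/negP => Fz1.
have a0 : 0 < cmod (F z1 - y) by rewrite cmod_gt0.
have d10 : F' z1 != 0.
  apply/eqP => F0; have := H z1; rewrite F0 sub0r cmodN.
  have := in_r _ z1r; rewrite /cball/= => h1 h2.
  by have := h2 (lt_le_trans h1 rr1); lra.
(* [h] is the Newton step. A fraction [t] of it decreases |F - y| by the factor 1 - t/2,
   contradicting minimality; [t] is chosen to stay in the disc and in the range of the first-order
   expansion. *)
pose h := (y - F z1) / F' z1.
have h0 : 0 < cmod h by rewrite cmod_gt0 mulf_neq0 ?invr_neq0// -opprB oppr_eq0.
have [r3 r30 T] := @dF z1 _ (divr_gt0 (divr_gt0 a0 (@ltr0n R 2)) h0).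
have [t [t0 t1 tr tw]] : exists t : R, [/\ 0 < t, t < 1, t * cmod h < r3 & t * cmod h < r2 - cmod (z1 - w)].
  pose k := Num.min r3 (r2 - cmod (z1 - w)).
  have k0 : 0 < k by rewrite lt_min r30 subr_gt0.
  pose t := k / (cmod h + k + 1).
  have den : 0 < cmod h + k + 1 by rewrite !addr_gt0.
  have th : t * cmod h < k.
    rewrite /t mulrAC ltr_pdivrMr// ltr_pM2l//; lra.
  exists t; split; first by rewrite divr_gt0.
  - by rewrite ltr_pdivrMr//; lra.
  - by apply: lt_le_trans th _; rewrite ge_min lexx.
  - by apply: lt_le_trans th _; rewrite ge_min lexx orbT.
pose z := z1 + (t%:C)%C * h.
have zz : z - z1 = (t%:C)%C * h by rewrite addrC addKr.
have nz : cmod (z - z1) = t * cmod h by rewrite zz cmodM cmod_real gtr0_norm.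
have := z1min z; have := T z; rewrite nz => /(_ tr) T1 T2.
have /T2 : cmod (z - w) <= r2 by have := cmod_dist_trans z z1 w; rewrite nz; lra.
rewrite leNgt => /negP; apply.
have -> : F z - y = (F z - F z1 - F' z1 * (z - z1)) + ((1 - t)%:C)%C * (F z1 - y).
  by rewrite zz /h rmorphB rmorph1; field.
apply: le_lt_trans (cmodD _ _) _; rewrite cmodM cmod_real ger0_norm ?subr_ge0 ?(ltW t1)//.
move: T1; rewrite (_ : _ / cmod h * (t * cmod h) = cmod (F z1 - y) / 2 * t); last by field; rewrite lt0r_neq0.
by nra.
Qed.

End LocalInverse.

(** * Connectedness of the unit interval as an induction principle *)

Section SegmentInduction.
Variable R : realType.

(** The hypothesis is symmetric in [s] and [s'], so it says that [P] is locally constant; both [P]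
    and its negation are then relatively open in the segment. *)
Lemma segment_ind (P : R -> Prop) : P 0 ->
  (forall t, 0 <= t <= 1 -> exists2 d, 0 < d & forall s s', 0 <= s <= 1 -> 0 <= s' <= 1 ->
     `|s - t| < d -> `|s' - t| < d -> P s -> P s') -> P 1.
Proof.
move=> P0 H.
pose A : set R := `[0, 1].
pose C (Q : R -> Prop) : set R := [set x | exists t d, [/\ 0 <= t <= 1, Q t, `|x - t| < d &
   forall s s', 0 <= s <= 1 -> 0 <= s' <= 1 -> `|s - t| < d -> `|s' - t| < d -> P s -> P s']].
have oC Q : open (C Q).
  rewrite openE => x [t [d [t01 Qt xt K]]].
  have e0 : 0 < d - `|x - t| by rewrite subr_gt0.
  apply/nbhs_ballP; exists (d - `|x - t|) => // y; rewrite /ball/= => xy.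
  exists t, d; split=> //; have := ler_distD x y t; rewrite (distrC y x); lra.
have sub t d : 0 <= t <= 1 -> 0 < d -> `|t - t| < d by rewrite subrr normr0.
have AE t : A t <-> 0 <= t <= 1 by rewrite /A/= in_itv.
have conn := @segment_connected R 0 1 [set t | A t /\ P t].
have : [set t | A t /\ P t] = A.
  apply: conn.
  - by exists 0; split=> //; apply/AE; rewrite lexx ler01.
  - exists (C P) => //; apply/seteqP; split=> x.
      move=> [Ax Px]; split=> //; have /AE x01 := Ax.
      have [d d0 K] := H x x01; exists x, d; split=> //; exact: sub.
    move=> [Ax [t [d [t01 Pt xt K]]]]; split=> //.
    have /AE x01 := Ax; apply: (K t x) => //.
    by apply: sub => //; exact: le_lt_trans xt.
  - exists (~` C (fun t => ~ P t)); first by rewrite closedC; exact: oC.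
    apply/seteqP; split=> x.
      move=> [Ax Px]; split=> // -[t [d [t01 Pt xt K]]]; apply: Pt.
      have /AE x01 := Ax; apply: (K x t) => //.
      by apply: sub => //; exact: le_lt_trans xt.
    move=> [Ax Cx]; split=> //; apply: contrapT => Px; apply: Cx.
    have /AE x01 := Ax; have [d d0 K] := H x x01.
    by exists x, d; split=> //; exact: sub.
move=> E; suff : A 1 by rewrite -E => -[].
by apply/AE; rewrite ler01 lexx.
Qed.

End SegmentInduction.

(** * Lifting a map of the unit disc through a proper local homeomorphism *)

Section DiscLifting.
Variable R : realType.
Implicit Types (z w zeta : R[i]) (E U S : set R[i]).

Lemma bounded_cluster (u : nat -> R[i]) (M : R) : (forall n, cmod (u n) <= M) ->
  exists w, forall (r : R) N, 0 < r -> exists2 n, (N <= n)%N & cmod (u n - w) < r.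
Proof.
move=> uM; apply: contrapT => H.
have [z _|N HN] := @compact_uniform_nat R (cdisk 0 M) (fun n z => forall k, (n <= k)%N -> u k <> z) (@compact_cdisk _ _ _).
  have {}H : ~ forall (r : R) N, 0 < r -> exists2 n, (N <= n)%N & cmod (u n - z) < r.
    by move=> Hz; apply: H; exists z.
  have /existsNP[r /existsNP[N /not_implyP[r0 K]]] := H.
  exists r; split=> //; exists N => w wr n Nn k nk uk; apply: K.
  by exists k; [exact: leq_trans nk|rewrite uk].
by have := HN (u N) _ N (leqnn N) erefl; apply; rewrite /cdisk/= subr0.
Qed.

Definition convex_subset S := forall a b, S a -> S b ->
  forall t : R, 0 <= t <= 1 -> S (a + (t%:C)%C * (b - a)).

Lemma cball_convex c (r : R) : convex_subset (cball c r).
Proof.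
move=> z w; rewrite /cball/= => zr wr t /andP[t0 t1].
have -> : z + (t%:C)%C * (w - z) - c =
   ((1 - t)%:C)%C * (z - c) + (t%:C)%C * (w - c) by rewrite rmorphB rmorph1; ring.
apply: le_lt_trans (cmodD _ _) _; rewrite !cmodM !cmod_real.
rewrite !ger0_norm ?subr_ge0//.
by have [t2|t2] := leP t (1 / 2); nra.
Qed.

Lemma convex_subsetI S S' : convex_subset S -> convex_subset S' ->
  convex_subset (S `&` S').
Proof. by move=> cS cS' a b [? ?] [? ?] t t01; split; [exact: cS|exact: cS']. Qed.

(** A convex neighbourhood of the segment from 0 to z. Two tubes meet in a convex set containing 0,
    and this makes lifts defined on them agree. *)
Definition tube z (e : R) : set R[i] :=
  [set w | exists2 s : R, 0 <= s <= 1 & cmod (w - (s%:C)%C * z) < e].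

Lemma tube0 z e : 0 < e -> tube z e 0.
Proof. by exists 0; rewrite ?lexx ?ler01// rmorph0 mul0r subrr cmod0. Qed.

Lemma tube_end z e : 0 < e -> tube z e z.
Proof. by exists 1; rewrite ?lexx ?ler01// rmorph1 mul1r subrr cmod0. Qed.

Lemma tube_near z e w : tube z e w -> exists2 r : R, 0 < r & cball w r `<=` tube z e.
Proof.
move=> [s s01 /cball_shrink[r r0 H]]; exists r => // y /H ?; by exists s.
Qed.

Lemma tube_convex z e : convex_subset (tube z e).
Proof.
move=> a b [s /andP[s0 s1] sa] [s' /andP[s'0 s'1] sb] t /andP[t0 t1].
exists (s + t * (s' - s)); first by apply/andP; split; nra.
have := @cball_convex 0 e (a - (s%:C)%C * z) (b - (s'%:C)%C * z).
rewrite /cball/= !subr0 => /(_ sa sb t); rewrite t0 t1 => /(_ isT).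
congr (cmod _ < _); rewrite rmorphD rmorphM rmorphB; ring.
Qed.

Section Lift.
Variables (F phi : R[i] -> R[i]) (U : set R[i]) (M : R).
Hypothesis cF : continuous F.
Hypothesis cphi : forall z, cball 0 1 z -> {for z, continuous phi}.
Hypothesis U_bounded : forall w, U w -> cmod w <= M.
Hypothesis U_proper : forall w z, closure U w -> cball 0 1 z -> F w = phi z -> U w.
Hypothesis U_open : open U.
Hypothesis F_local_inverse : forall w z, U w -> cball 0 1 z -> F w = phi z ->
  forall r0 : R, 0 < r0 -> exists r m s : R, [/\ 0 < r <= r0, 0 < m, 0 < s,
    forall z z', cball w r z -> cball w r z' -> m * cmod (z - z') <= cmod (F z - F z') &
    forall y, cball (F w) s y -> exists2 z, cball w r z & F z = y].

Definition is_lift S (psi : R[i] -> R[i]) := forall z, S z ->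
  [/\ cball 0 1 z, U (psi z), F (psi z) = phi z & {for z, continuous psi}].

(** The last clause, injectivity of [F] near [w], is what later forces lifts that agree at a point
    to agree nearby. *)
Lemma lift_section w z : U w -> cball 0 1 z -> F w = phi z ->
  exists e r psi, [/\ 0 < e, 0 < r, is_lift (cball z e) psi,
    forall y, cball z e y -> cball w r (psi y) &
    forall y y', cball w r y -> cball w r y' -> F y = F y' -> y = y'].
Proof.
move=> Uw z1 Fw; have [r0 r00 r0U] := (openP U).1 U_open _ Uw.
have [r [m [s [/andP[rpos rr0] m0 s0 inj surj]]]] := F_local_inverse Uw z1 Fw r00.
have inj' y y' : cball w r y -> cball w r y' -> F y = F y' -> y = y'.
  move=> yr y'r Fy; have := inj y y' yr y'r; rewrite Fy subrr cmod0 => h.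
  apply/eqP; rewrite -subr_eq0 -cmod_eq0 eq_le cmod_ge0 andbT.
  by rewrite -(ler_pM2l m0) mulr0.
have [e1 e10 He1] := cball_shrink z1.
have [e2 e20 He2] := (continuousP_cball _ _).1 (cphi z1) _ s0.
pose e := Num.min e1 e2.
have ee y : cball z e y -> cball 0 1 y /\ cball (F w) s (phi y).
  by rewrite /cball/= lt_min => /andP[h1 h2]; split; [exact: He1|rewrite Fw; exact: He2].
have ex y : exists x, cball z e y -> cball w r x /\ F x = phi y.
  have [ye|ye] := pselect (cball z e y); last by exists 0.
  by have [x xr Fx] := surj _ (ee _ ye).2; exists x.
have [psi psiP] := choice ex.
exists e, r, psi; split=> //; first by rewrite lt_min e10.
  move=> y ye; have [yr Fy] := psiP y ye; have [y1 ys] := ee y ye.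
  split=> //; first by apply: r0U; exact: lt_le_trans yr rr0.
  apply/continuousP_cball => d d0; have [t t0 te] := cball_shrink ye.
  have [t' t'0 Ht'] := (continuousP_cball _ _).1 (cphi y1) _ (mulr_gt0 m0 d0).
  exists (Num.min t t'); first by rewrite lt_min t0.
  move=> x; rewrite lt_min => /andP[xt /Ht' xt'].
  have [xr Fx] := psiP x (te _ xt).
  rewrite -(ltr_pM2l m0); apply: le_lt_trans (inj _ _ xr yr) _.
  by rewrite Fx Fy.
by move=> y ye; have [] := psiP y ye.
Qed.

(** Along the segment from [a] to [b], agreement is an open condition by local injectivity and
    disagreement is one by continuity. *)
Lemma lift_unique S psi1 psi2 a b : convex_subset S -> is_lift S psi1 ->
  is_lift S psi2 -> S a -> S b -> psi1 a = psi2 a -> psi1 b = psi2 b.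
Proof.
move=> cS l1 l2 Sa Sb ab.
pose g (t : R) := a + (t%:C)%C * (b - a).
suff : psi1 (g 1) = psi2 (g 1) by rewrite /g rmorph1 mul1r subrKC.
apply: (@segment_ind R (fun t => psi1 (g t) = psi2 (g t))).
  by rewrite /g rmorph0 mul0r addr0.
move=> t t01; have Sg : S (g t) := cS _ _ Sa Sb t t01.
have gd s : cmod (g s - g t) = `|s - t| * cmod (b - a).
  by rewrite -cmod_real -cmodM /g rmorphB; congr cmod; ring.
have ba : 0 < cmod (b - a) + 1 by rewrite ltr_wpDl// cmod_ge0.
have near_g (d : R) : 0 < d -> exists2 d' : R, 0 < d' & forall s, `|s - t| < d' -> cmod (g s - g t) < d.
  move=> d0; exists (d / (cmod (b - a) + 1)); first by rewrite divr_gt0.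
  move=> s; rewrite ltr_pdivlMr// gd; have := normr_ge0 (s - t); nra.
have [B1 U1 F1 c1] := l1 _ Sg; have [_ U2 F2 c2] := l2 _ Sg.
have [e12|e12] := eqVneq (psi1 (g t)) (psi2 (g t)).
  have [e [r [_ [_ r0 _ _ inj]]]] := lift_section U1 B1 F1.
  have [d1 d10 H1] := (continuousP_cball _ _).1 c1 _ r0.
  have [d2 d20 H2] := (continuousP_cball _ _).1 c2 _ r0.
  have [|d d0 H] := near_g (Num.min d1 d2); first by rewrite lt_min d10.
  exists d => // s s' s01 s'01 _ /H; rewrite lt_min => /andP[/H1 h1 /H2 h2] _.
  have Ss' := cS _ _ Sa Sb s' s'01.
  apply: inj => //; first by rewrite /cball/= e12.
  by have [_ _ -> _] := l1 _ Ss'; have [_ _ -> _] := l2 _ Ss'.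
have e0 : 0 < cmod (psi1 (g t) - psi2 (g t)) by rewrite cmod_gt0 subr_eq0.
have [d1 d10 H1] := (continuousP_cball _ _).1 c1 _ (divr_gt0 e0 (@ltr0n R 2)).
have [d2 d20 H2] := (continuousP_cball _ _).1 c2 _ (divr_gt0 e0 (@ltr0n R 2)).
have [|d d0 H] := near_g (Num.min d1 d2); first by rewrite lt_min d10.
exists d => // s s' _ _ /H; rewrite lt_min => /andP[/H1 h1 /H2 h2] _ E.
exfalso; have := cmod_dist_trans (psi1 (g t)) (psi1 (g s)) (psi2 (g t)).
by rewrite (cmod_distC _ (psi1 (g s))) E in h1 *; lra.
Qed.

Definition tube_lift w0 z := exists e psi,
  [/\ 0 < e, is_lift (tube z e) psi & psi 0 = w0].

(** End values of lifts with parameters tending to [t] cluster in the plane because [U] is bounded.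
    The cluster point lies over [phi (t z)], so [U_proper] puts it in [U], and the local section
    there continues one of these lifts across [t]. *)
Lemma tube_lift_step w0 z (t : R) : cball 0 1 z -> 0 <= t <= 1 ->
  (forall d : R, 0 < d -> exists s : R,
     [/\ 0 <= s <= 1, `|s - t| < d & tube_lift w0 ((s%:C)%C * z)]) ->
  exists2 d : R, 0 < d & forall s : R, 0 <= s <= 1 -> `|s - t| < d ->
    tube_lift w0 ((s%:C)%C * z).
Proof.
move=> z1 t01 H.
have cz0 := cmod_ge0 z.
have tz1 : cball 0 1 ((t%:C)%C * z).
  have := @cball_convex 0 1 0 z (cballxx 0 ltr01) z1 t t01.
  by rewrite add0r subr0.
have {H} H (n : nat) : exists p : R * (R * (R[i] -> R[i])),
   [/\ 0 <= p.1 <= 1, `|p.1 - t| < n.+1%:R^-1, 0 < p.2.1,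
     is_lift (tube ((p.1%:C)%C * z) p.2.1) p.2.2 & p.2.2 0 = w0].
  have [|s [s01 st [e [psi [e0 lp p0]]]]] := H n.+1%:R^-1; first by rewrite invr_gt0.
  by exists (s, (e, psi)).
have [p Hp] := choice H.
pose s n := (p n).1; pose ep n := (p n).2.1; pose psi n := (p n).2.2.
have lp n : is_lift (tube ((s n)%:C%C * z) (ep n)) (psi n) by have [] := Hp n.
have ep0 n : 0 < ep n by have [] := Hp n.
pose w n := psi n ((s n)%:C%C * z).
have wP n : U (w n) /\ F (w n) = phi ((s n)%:C%C * z).
  by have [_ ? ? _] := lp n _ (tube_end ((s n)%:C%C * z) (ep0 n)).
have [ws wsP] := bounded_cluster (fun n => U_bounded (wP n).1).
have sd n : cmod ((s n)%:C%C * z - t%:C%C * z) <= n.+1%:R^-1.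
  rewrite -mulrBl -rmorphB cmodM cmod_real.
  have [_ st _ _ _] := Hp n; apply: le_trans (ltW st).
  by rewrite -[leRHS]mulr1 ler_wpM2l//; move: z1; rewrite /cball/= subr0 => /ltW.
have small (d : R) : 0 < d -> exists N, forall n, (N <= n)%N -> n.+1%:R^-1 < d.
  move=> d0; exists (Num.truncn d^-1) => n nN.
  rewrite invf_plt ?posrE//; apply: lt_le_trans (truncnS_gt _) _.
  by rewrite ler_nat ltnS.
have Fws : F ws = phi (t%:C%C * z).
  apply/eqP; rewrite -subr_eq0; apply/eqP; apply: cmod_eq_small => e e0.
  have e2 : 0 < e / 2 by rewrite divr_gt0.
  have [d1 d10 H1] := (continuousP_cball _ _).1 (@cF ws) _ e2.
  have [d2 d20 H2] := (continuousP_cball _ _).1 (cphi tz1) _ e2.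
  have [N HN] := small _ d20; have [n nN /H1 h1] := wsP _ N d10.
  have := H2 _ (le_lt_trans (sd n) (HN n nN)); rewrite -(wP n).2 => h2.
  have := cmod_dist_trans (F ws) (F (w n)) (phi (t%:C%C * z)).
  by rewrite (cmod_distC (F ws) (F (w n))); lra.
have Uws : U ws.
  apply: (U_proper _ tz1 Fws) => B /nbhs_cballP[r r0 rB].
  have [n _ nr] := wsP r 0%N r0; exists (w n); split; first exact: (wP n).1.
  exact: rB.
have [e [r [chi [e0 r0 lchi chir inj]]]] := lift_section Uws tz1 Fws.
have e4 : 0 < e / 4 by rewrite divr_gt0.
have [N HN] := small _ e4; have [n nN nr] := wsP r N r0.
have snt : cmod ((s n)%:C%C * z - t%:C%C * z) < e / 4 := le_lt_trans (sd n) (HN n nN).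
have snball : cball (t%:C%C * z) e ((s n)%:C%C * z) by rewrite /cball/=; lra.
have chiw : chi ((s n)%:C%C * z) = w n.
  apply: inj => //; first exact: chir.
  by have [_ _ -> _] := lchi _ snball; rewrite (wP n).2.
(* Quarters leave room: the tube width and the distances of s_n z and s' z from t z are each at most
   e / 4, so the part of the new tube outside the old one stays within the ball where [chi] is
   defined. *)
pose ee := Num.min (ep n) (e / 4).
have ee0 : 0 < ee by rewrite lt_min ep0.
have eeep : ee <= ep n by rewrite ge_min lexx.
have eee : ee <= e / 4 by rewrite ge_min lexx orbT.
have sub_tube y : tube ((s n)%:C%C * z) ee y -> tube ((s n)%:C%C * z) (ep n) y.
  by move=> [l l01 yl]; exists l => //; exact: lt_le_trans yl eeep.
have agree y : tube ((s n)%:C%C * z) ee y -> cball (t%:C%C * z) e y -> psi n y = chi y.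
  move=> yt yb.
  apply: (@lift_unique (tube ((s n)%:C%C * z) ee `&` cball (t%:C%C * z) e) _ _ ((s n)%:C%C * z)) => //.
  - by apply: convex_subsetI; [exact: tube_convex|exact: cball_convex].
  - by move=> x [/sub_tube xt _]; exact: lp.
  - by move=> x [_ xb]; exact: lchi.
  - by split=> //; exact: tube_end.
have [/andP[sn0 sn1] _ _ _ pn0] := Hp n; rewrite -/(s n) in sn0 sn1.
have d0 : 0 < e / 4 / (cmod z + 1) by rewrite divr_gt0// ltr_wpDl.
exists (e / 4 / (cmod z + 1)) => // s' /andP[s'0 s'1]; rewrite ltr_pdivlMr ?ltr_wpDl// => s't.
have s't' : cmod (s'%:C%C * z - t%:C%C * z) < e / 4.
  by rewrite -mulrBl -rmorphB cmodM cmod_real; have := normr_ge0 (s' - t); nra.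
(* A point near the segment to s' z but not near the one to s_n z is close to some l s' z beyond s_n
   z; such a point is no farther from t z than one of the two ends. *)
have key y : tube (s'%:C%C * z) ee y -> ~ tube ((s n)%:C%C * z) ee y -> cball (t%:C%C * z) e y.
  move=> [l /andP[l0 l1] ly] ny.
  have ly' : cmod (y - ((l * s')%:C)%C * z) < ee by rewrite rmorphM -mulrA.
  have [lt|lt] := leP (l * s') (s n).
    exfalso; apply: ny; have [sn00|sn00] := eqVneq (s n) 0.
      exists 0; first by rewrite lexx ler01.
      have ls0 : l * s' = 0.
        by apply/eqP; rewrite eq_le mulr_ge0// andbT -sn00.
      by move: ly'; rewrite ls0 rmorph0 !mul0r.
    have sn_gt0 : 0 < s n by rewrite lt_neqAle eq_sym sn00.
    exists (l * s' / s n); first by rewrite divr_ge0 ?mulr_ge0//= ler_pdivrMr// mul1r.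
    by move: ly'; congr (cmod (y - _) < _); rewrite mulrA -rmorphM /= divfK.
  have ls : cmod (((l * s')%:C)%C * z - t%:C%C * z) < e / 4.
    have ab (x : R) : cmod ((x%:C)%C * z - t%:C%C * z) = `|x - t| * cmod z.
      by rewrite -mulrBl -rmorphB cmodM cmod_real.
    rewrite !ab in snt s't' *.
    have ls' : l * s' <= s' by rewrite -[leRHS]mul1r ler_wpM2r.
    have [lt'|lt'] := leP (l * s') t.
      apply: le_lt_trans snt; rewrite ler_wpM2r//.
      by rewrite ler0_norm ?subr_le0// ler0_norm ?subr_le0; lra.
    apply: le_lt_trans s't'; rewrite ler_wpM2r//.
    by rewrite gtr0_norm ?subr_gt0// gtr0_norm ?subr_gt0; lra.
  rewrite /cball/=; have := cmod_dist_trans y (((l * s')%:C)%C * z) (t%:C%C * z); lra.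
pose Psi y := if pselect (tube ((s n)%:C%C * z) ee y) then psi n y else chi y.
have PsiT y : tube ((s n)%:C%C * z) ee y -> Psi y = psi n y by rewrite /Psi; case: pselect.
have PsiB y : cball (t%:C%C * z) e y -> Psi y = chi y.
  by rewrite /Psi; case: pselect => // yt /(agree _ yt).
have local_eq y f (e' : R) : 0 < e' -> (forall x, cball y e' x -> Psi x = f x) ->
    {for y, continuous f} -> {for y, continuous Psi}.
  move=> e'0 Pf /continuousP_cball cf; apply/continuousP_cball => d /cf[d' d'0 Hd'].
  exists (Num.min e' d'); first by rewrite lt_min e'0.
  move=> x; rewrite lt_min => /andP[xe /Hd' xd].
  by rewrite !Pf// /cball/= subrr cmod0.
exists ee, Psi; split=> //; last by rewrite PsiT//; exact: tube0.
move=> y yt; have [ys|ys] := pselect (tube ((s n)%:C%C * z) ee y).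
  have [B1 U1 F1 c1] := lp n _ (sub_tube _ ys); rewrite (PsiT _ ys).
  split; [exact: B1|exact: U1|exact: F1|have [e' e'0 He'] := tube_near ys;
    by apply: (local_eq y (psi n) e' e'0 _ c1) => x /He' /PsiT].
have yb := key _ yt ys; have [B1 U1 F1 c1] := lchi _ yb; rewrite (PsiB _ yb).
split; [exact: B1|exact: U1|exact: F1|].
have [e' e'0 He'] := cball_shrink yb.
by apply: (local_eq y chi e' e'0 _ c1) => x /He' /PsiB.
Qed.

Lemma tube_lift_exists w0 z : U w0 -> F w0 = phi 0 -> cball 0 1 z -> tube_lift w0 z.
Proof.
move=> Uw0 Fw0 z1.
suff : tube_lift w0 ((1%:C)%C * z) by rewrite rmorph1 mul1r.
apply: (@segment_ind R (fun t => tube_lift w0 ((t%:C)%C * z))).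
  rewrite rmorph0 mul0r.
  have [e [r [psi [e0 r0 lpsi psir inj]]]] := lift_section Uw0 (cballxx 0 ltr01) Fw0.
  exists e, psi; split=> // [y [s _]|]; first by rewrite mulr0 => ye; exact: lpsi.
  have b0 := cballxx (0 : R[i]) e0.
  apply: inj; [exact: psir|exact: cballxx|].
  by have [_ _ -> _] := lpsi _ b0.
move=> t t01.
have [H|H] := pselect (forall d : R, 0 < d -> exists s : R,
     [/\ 0 <= s <= 1, `|s - t| < d & tube_lift w0 ((s%:C)%C * z)]).
  have [d d0 K] := tube_lift_step z1 t01 H; exists d => // s s' _ s'01 _ s't _; exact: K.
have /existsNP[d /not_implyP[d0 K]] := H.
by exists d => // s s' s01 _ st _ Ps; exfalso; apply: K; exists s.
Qed.

(** Each ray is lifted on a tube of its own and the lift is read off at the end of the ray.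
    Neighbouring tubes give the same value by uniqueness, starting from the common value at 0. *)
Lemma lift_exists w0 : U w0 -> F w0 = phi 0 ->
  exists2 psi, is_lift (cball 0 1) psi & psi 0 = w0.
Proof.
move=> Uw0 Fw0.
have ex z : exists p : R * (R[i] -> R[i]), cball 0 1 z ->
    [/\ 0 < p.1, is_lift (tube z p.1) p.2 & p.2 0 = w0].
  have [z1|z1] := pselect (cball 0 1 z); last by exists (0, id).
  by have [e [psi H]] := tube_lift_exists Uw0 Fw0 z1; exists (e, psi).
have [p Hp] := choice ex.
pose Psi z := (p z).2 z.
have E z y : cball 0 1 z -> cball z (p z).1 y -> cball 0 1 y -> Psi y = (p z).2 y.
  move=> z1 yz y1; have [e0 l p0] := Hp z z1; have [e0' l' p0'] := Hp y y1.
  apply: (@lift_unique (tube y (p y).1 `&` tube z (p z).1) (p y).2 _ 0).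
  - by apply: convex_subsetI; exact: tube_convex.
  - by move=> x [? _]; exact: l'.
  - by move=> x [_ ?]; exact: l.
  - by split; exact: tube0.
  - by split; [exact: tube_end|exists 1; rewrite ?ler01 ?lexx// rmorph1 mul1r].
  - by rewrite p0 p0'.
exists Psi; last by have [] := Hp 0 (cballxx 0 ltr01).
move=> z z1; have [e0 l p0] := Hp z z1.
have [_ Uz Fz cz] := l z (tube_end z e0).
split; [exact: z1|exact: Uz|exact: Fz|].
have [r r0 rb] := cball_shrink z1.
apply/continuousP_cball => d /((continuousP_cball _ _).1 cz)[d' d'0 Hd'].
exists (Num.min d' (Num.min r (p z).1)); first by rewrite !lt_min d'0 r0.
move=> y; rewrite !lt_min => /and3P[/Hd' yd yr yp].
by rewrite (E z y z1 yp (rb _ yr)).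
Qed.

End Lift.
End DiscLifting.

(** * Holomorphic discs, chains of discs and their lifts *)

Section HolomorphicDiscs.
Variable R : realType.
Implicit Types (E U V : set R[i]) (x y z w b : R[i]).

(* The continuity of the derivative is only demanded because [C1_curve] needs it. *)
Definition hol_disc E (phi : R[i] -> R[i]) := exists phi', forall z, cball 0 1 z ->
  [/\ E (phi z), cdiff phi z (phi' z) & {for z, continuous phi'}].

Lemma hol_disc_sub E V phi : E `<=` V -> hol_disc E phi -> hol_disc V phi.
Proof. by move=> EV [phi' H]; exists phi' => z /H[/EV ? ? ?]. Qed.

Lemma cdiff_affine (a c w : R[i]) : cdiff (fun w => c + a * w) w a.
Proof.
have := cdiffD (@cdiff_cst R c w) (cdiffM (@cdiff_cst R a w) (@cdiff_id R w)).
by rewrite mul0r !add0r mulr1.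
Qed.

Lemma hol_disc_affine E z (r : R) : 0 <= r -> (forall w, cball 0 1 w -> E (z + (r%:C)%C * w)) ->
  hol_disc E (fun w => z + (r%:C)%C * w).
Proof.
move=> r0 H; exists (fun=> (r%:C)%C) => w w1; split; [exact: H| |exact: cst_continuous].
exact: cdiff_affine.
Qed.

(** Properness and a nonzero derivative are demanded only over [E], so that [E] may be a domain from
    which critical values have been removed. *)
Lemma disc_lift (F F' phi : R[i] -> R[i]) E U (M : R) w0 :
  (forall z, cdiff F z (F' z)) -> continuous F' -> hol_disc E phi ->
  open U -> (forall w, U w -> cmod w <= M) ->
  (forall w, closure U w -> E (F w) -> U w) ->
  (forall w, U w -> E (F w) -> F' w != 0) ->
  U w0 -> F w0 = phi 0 ->
  exists psi, [/\ hol_disc (U `&` F @^-1` E) psi, psi 0 = w0 &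
    forall z, cball 0 1 z -> F (psi z) = phi z].
Proof.
move=> dF cF' [phi' Hphi] oU bU pU nU Uw0 Fw0.
have cF : continuous F by move=> z; exact: cdiff_continuous (dF z).
have [|||psi lpsi psi0] := @lift_exists R F phi U M cF _ bU _ oU _ w0 Uw0 Fw0.
- by move=> z /Hphi[_ + _]; exact: cdiff_continuous.
- by move=> w z cw z1 Fw; apply: pU => //; rewrite Fw; have [] := Hphi z z1.
- move=> w z Uw z1 Fw r0 r00; apply: (local_inverse dF cF') => //.
  by apply: nU => //; rewrite Fw; have [] := Hphi z z1.
exists psi; split=> //; last by move=> z /lpsi[].
have nz z : cball 0 1 z -> F' (psi z) != 0.
  by move=> z1; have [_ Uz Fz _] := lpsi z z1; apply: nU => //; rewrite Fz; have [] := Hphi z z1.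
exists (fun z => phi' z / F' (psi z)) => z z1.
have [_ Uz Fz cz] := lpsi z z1; have [Ez dz cphi'] := Hphi z z1; split.
- by split=> //=; rewrite Fz.
- apply: (cdiff_lift cz (nz z z1) (dF _)).
  have [r r0 rb] := cball_shrink z1.
  apply: (cdiff_near r0 _ dz) => w /rb /lpsi[_ _ <- _] //.
- have c1 : {for z, continuous (fun z => F' (psi z))}.
    by apply: (@continuous_comp _ _ _ psi F'); [exact: cz|exact: cF'].
  have c2 : {for F' (psi z), continuous (fun w : R[i] => w^-1)}.
    exact: cdiff_continuous (cdiffV (nz z z1)).
  have c3 : {for z, continuous (fun z => (F' (psi z))^-1)}.
    exact: (continuous_comp c1 c2).
  exact: continuousM cphi' c3.
Qed.

(** The bound 1/2 keeps the segment from 0 to [b] at distance at least 1/2 from the unit circle,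
    which bounds the Kobayashi metric along its image. Unlike a curve length, the datum is carried
    unchanged to a lifted disc. *)
Definition disc_step E x y := exists phi b,
  [/\ hol_disc E phi, cmod b <= 1 / 2, phi 0 = x & phi b = y].

Fixpoint disc_chain E n x y := if n is m.+1 then
  exists2 x', disc_step E x x' & disc_chain E m x' y else x = y.

Lemma disc_step_sub E V x y : E `<=` V -> disc_step E x y -> disc_step V x y.
Proof. by move=> EV [phi [b [h1 h2 h3 h4]]]; exists phi, b; split=> //; exact: hol_disc_sub h1. Qed.

Lemma disc_chain_sub E V n x y : E `<=` V -> disc_chain E n x y -> disc_chain V n x y.
Proof.
move=> EV; elim: n x => // n IH x [x' /(disc_step_sub EV) s c]; exists x' => //.
exact: IH.
Qed.

Lemma disc_stepxx E x : E x -> disc_step E x x.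
Proof.
move=> Ex; exists (fun w => x + (0%:C)%C * w), 0; split; rewrite ?rmorph0 ?mul0r ?addr0//.
  by apply: (hol_disc_affine (r := 0)) => // w _; rewrite mul0r addr0.
by rewrite cmod0.
Qed.

Lemma disc_step_mem E x y : disc_step E x y -> E x /\ E y.
Proof.
move=> [phi [b [[phi' H] b1 <- <-]]]; split.
  by have [] := H 0 (cballxx 0 ltr01).
have b1' : cball 0 1 b by rewrite /cball/= subr0; lra.
by have [] := H b b1'.
Qed.

Lemma disc_step_ball E x y (r : R) : cball x r `<=` E -> 0 < r -> cmod (y - x) <= r / 2 ->
  disc_step E x y.
Proof.
move=> rE r0 yx; exists (fun w => x + (r%:C)%C * w), ((y - x) / (r%:C)%C); split.
- apply: hol_disc_affine; first exact: ltW.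
  move=> w; rewrite /cball/= subr0 => w1; apply: rE.
  by rewrite /cball/= addrC addKr cmodM cmod_real gtr0_norm// -[ltRHS]mulr1 ltr_pM2l.
- by rewrite cmodM cmodV cmod_real gtr0_norm// ler_pdivrMr//; lra.
- by rewrite mulr0 addr0.
- rewrite mulrC divfK ?subrKC//.
  by rewrite -cmod_gt0 cmod_real normr_gt0 gt_eqF.
Qed.

Lemma disc_chain_cat E n m x y z : disc_chain E n x y -> disc_chain E m y z ->
  disc_chain E (n + m) x z.
Proof.
elim: n x => [|n IH] x /=; first by move=> ->.
by move=> [x' s c] c'; exists x' => //; exact: IH.
Qed.

Lemma disc_chain_mono E n m x y : E x -> (n <= m)%N -> disc_chain E n x y -> disc_chain E m x y.
Proof.
move=> Ex nm c; rewrite -(subnK nm); elim: (m - n)%N => [//|k IH].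
by rewrite addSn; exists x => //; exact: disc_stepxx.
Qed.

Lemma disc_chain_funs E n x y : disc_chain E n x y ->
  exists (phi : nat -> R[i] -> R[i]) (b p : nat -> R[i]),
  [/\ p 0%N = x, p n = y & forall j, (j < n)%N ->
    [/\ hol_disc E (phi j), cmod (b j) <= 1 / 2, phi j 0 = p j & phi j (b j) = p j.+1]].
Proof.
elim: n x => [|n IH] x /=; first by move=> ->; exists (fun=> id), (fun=> 0), (fun=> y).
move=> [x' [phi0 [b0 [h1 h2 h3 h4]]] /IH[phi [b [p [p0 pn H]]]]].
exists (fun j => if j is k.+1 then phi k else phi0), (fun j => if j is k.+1 then b k else b0),
  (fun j => if j is k.+1 then p k else x).
by split=> // -[_|j /H//]; split=> //; rewrite p0.
Qed.

Lemma disc_step_lift (F F' : R[i] -> R[i]) E U (M : R) x y w0 :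
  (forall z, cdiff F z (F' z)) -> continuous F' ->
  open U -> (forall w, U w -> cmod w <= M) ->
  (forall w, closure U w -> E (F w) -> U w) ->
  (forall w, U w -> E (F w) -> F' w != 0) ->
  U w0 -> F w0 = x -> disc_step E x y ->
  exists2 w, F w = y & disc_step (U `&` F @^-1` E) w0 w.
Proof.
move=> dF cF' oU bU pU nU Uw0 Fw0 [phi [b [h1 h2 h3 h4]]].
rewrite -h3 in Fw0.
have [psi [g1 g2 g3]] := disc_lift dF cF' h1 oU bU pU nU Uw0 Fw0.
exists (psi b); last by exists psi, b.
by rewrite g3// /cball/= subr0; lra.
Qed.

Lemma disc_chain_lift (F F' : R[i] -> R[i]) E U (M : R) n x y w0 :
  (forall z, cdiff F z (F' z)) -> continuous F' ->
  open U -> (forall w, U w -> cmod w <= M) ->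
  (forall w, closure U w -> E (F w) -> U w) ->
  (forall w, U w -> E (F w) -> F' w != 0) ->
  U w0 -> F w0 = x -> disc_chain E n x y ->
  exists2 w, F w = y & disc_chain (U `&` F @^-1` E) n w0 w.
Proof.
move=> dF cF' oU bU pU nU; elim: n x w0 => [|n IH] x w0 Uw0 Fw0 /=.
  by move=> xy; exists w0; rewrite ?Fw0.
move=> [x' s c]; have [w Fw sw] := disc_step_lift dF cF' oU bU pU nU Uw0 Fw0 s.
have [_ [Uw _]] := disc_step_mem sw.
by have [w' Fw' cw'] := IH _ _ Uw Fw c; exists w' => //; exists w.
Qed.

End HolomorphicDiscs.

(** * Kobayashi length of a chain of discs *)

Section KobayashiBound.
Variable R : realType.
Implicit Types (E U : set R[i]) (x y z w b : R[i]).

(** No measurability of [K] is assumed: the integral of a nonnegative function is a supremum over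
    simple functions below it, hence monotone. The comparison function is infinite on the null set
    [N]. *)
Lemma integral_le_cst_off_finite (K : R -> \bar R) (N : set R) (L : R) :
  finite_set N -> 0 <= L -> (forall t, (0%R <= K t)%E) ->
  (forall t, 0 <= t <= 1 -> ~ N t -> (K t <= L%:E)%E) ->
  (\int[lebesgue_measure]_(t in `[0%R, 1%R]) K t <= L%:E)%E.
Proof.
move=> fN L0 K0 KL.
have mN : measurable N.
  by apply: countable_measurable => [t|]; [exact: measurable_set1|exact: finite_set_countable].
pose G t : \bar R := if t \in N then +oo%E else L%:E.
have G0 t : (0%R <= G t)%E by rewrite /G; case: ifP => _; rewrite ?lee_fin.
have mG : measurable_fun [set: R] G.
  apply: measurable_fun_ifT; [|exact: measurable_cst|exact: measurable_cst].
  apply: (measurable_fun_bool true); rewrite setTI.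
  rewrite (_ : _ @^-1` _ = N)//; apply/seteqP; split=> t /=; first by move=> /set_mem.
  by move=> /mem_set.
have le1 : (\int[lebesgue_measure]_(t in `[0%R, 1%R]) K t <=
   \int[lebesgue_measure]_(t in `[0%R, 1%R]) G t)%E.
  rewrite !ge0_integralE//; apply: ereal_sup_le => _ [h hK <-]; exists h => //= t.
  apply: le_trans (hK t) _; rewrite /patch; case: ifP => //; rewrite inE /= in_itv /= => t01.
  rewrite /G; case: ifPn => tN; first exact: leey.
  by apply: KL => // Nt; rewrite mem_set in tN.
apply: le_trans le1 _.
rewrite (@ge0_ae_eq_integral _ _ _ _ _ _ (cst L%:E))//.
- by rewrite integral_cst//= lebesgue_measure_itv/= lte_fin ltr01 -EFinB subr0 mule1.
- exact: measurable_funTS.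
exists N; split=> //; first exact: countable_lebesgue_measure0 (finite_set_countable fN).
move=> t /= H; apply: contrapT => Nt; apply: H => _.
by rewrite /G memNset.
Qed.

Lemma kobayashi_metric_ge0 U z (xi : R[i]) : (0%R <= kobayashi_metric U z xi)%E.
Proof. by apply/ereal_infP => _ [l [l0 _] <-]; rewrite lee_fin ltW. Qed.

(** The competitor is [phi] precomposed with [w |-> p + a w], where |a| <= 1/2 keeps the argument in
    the unit disc; the factor 2 in the bound is what makes [a] so small. *)
Lemma kobayashi_metric_disc E phi (phi' : R[i] -> R[i]) p (k : R[i]) (L : R) :
  (forall z, cball 0 1 z -> [/\ E (phi z), cdiff phi z (phi' z) & {for z, continuous phi'}]) ->
  cmod p <= 1 / 2 -> cmod k <= L -> 0 < L ->
  (kobayashi_metric E (phi p) (phi' p * k)%R <= (2 * L)%:E)%E.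
Proof.
move=> H p2 kL L0; apply: ereal_inf_lbound; exists (2 * L) => //; split.
  by rewrite mulr_gt0.
have L20 : ((2 * L)%:C)%C != 0 :> R[i].
  by rewrite -cmod_gt0 cmod_real normr_gt0 gt_eqF// mulr_gt0.
pose a := k / ((2 * L)%:C)%C.
have a2 : cmod a <= 1 / 2.
  rewrite /a cmodM cmodV cmod_real gtr0_norm ?mulr_gt0// ler_pdivrMr ?mulr_gt0//; lra.
have in1 w : cball 0 1 w -> cball 0 1 (p + a * w).
  rewrite /cball/= !subr0 => w1; apply: le_lt_trans (cmodD _ _) _; rewrite cmodM.
  have := cmod_ge0 w; have := cmod_ge0 a; nra.
have in1' (w : R[i]) : `|w| < 1 -> cball 0 1 w.
  by rewrite normrC -[1]/((1%:C)%C) ltcR /cball/= subr0.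
exists (fun w => phi (p + a * w)); split.
- move=> w /in1' /in1 w1; have [_ d _] := H _ w1.
  exact: cdiff_derivable (cdiff_comp (@cdiff_affine R a p w) d).
- by move=> w /in1' /in1 w1; have [] := H _ w1.
- by rewrite mulr0 addr0.
have [_ d _] := H _ (in1 0 (cballxx 0 ltr01)).
rewrite (cdiff_derive1E (cdiff_comp (@cdiff_affine R a p 0) d)) mulr0 addr0 /a.
by rewrite mulrC -!mulrA (mulVf L20) mulr1.
Qed.

Section DiscCurve.
Variables (E : set R[i]) (phi phi' : R[i] -> R[i]) (b : R[i]) (c j : R).
Hypothesis Hphi : forall z, cball 0 1 z ->
  [/\ E (phi z), cdiff phi z (phi' z) & {for z, continuous phi'}].
Hypothesis b2 : cmod b <= 1 / 2.
Hypothesis c0 : 0 < c.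

(* The parameter stays in [0, 1] for all real times, so the curve is [C^1] on
   the whole line although [phi] is only controlled on the unit disc. *)
Definition disc_param (t : R) : R := (1 - cos (pi * (c * t - j))) / 2.
Definition disc_param' (t : R) : R := pi * c * sin (pi * (c * t - j)) / 2.
(** For [c] pieces, the one with index [j] runs from [phi 0] to [phi b] while [c * t] goes from [j]
    to [j + 1]. *)
Definition disc_curve t := phi ((disc_param t)%:C%C * b).
Definition disc_velocity t := phi' ((disc_param t)%:C%C * b) * ((disc_param' t)%:C%C * b).

Lemma is_derive_disc_param (t : R) : is_derive t 1 disc_param (disc_param' t).
Proof.
have d1 : is_derive t 1 (fun t : R => pi * (c * t - j)) (pi * c).
  by apply: is_derive_eq; rewrite /GRing.scale /=; ring.
have d2 := @is_derive1_comp R cos (fun t : R => pi * (c * t - j)) t _ _ (is_derive_cos _) d1.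
rewrite /disc_param /disc_param'.
by apply: is_derive_eq; rewrite /GRing.scale /=; field.
Qed.

Lemma disc_param_in t : cmod ((disc_param t)%:C%C * b) <= 1 / 2.
Proof.
rewrite cmodM cmod_real; have := cos_le1 (pi * (c * t - j)); have := cos_geN1 (pi * (c * t - j)).
rewrite -/(disc_param t) => h1 h2; have p1 : 0 <= disc_param t <= 1 by rewrite /disc_param; lra.
move: p1 => /andP[p1 p2]; rewrite ger0_norm//; apply: le_trans b2.
by rewrite -[leRHS]mul1r ler_wpM2r ?cmod_ge0.
Qed.

Lemma disc_param_in1 t : cball 0 1 ((disc_param t)%:C%C * b).
Proof. by rewrite /cball/= subr0; have := disc_param_in t; lra. Qed.

Lemma is_derive_disc_curve (u : R[i]) (t : R) :
  is_derive t 1 (fun t : R => complex.Re (u * disc_curve t)) (complex.Re (u * disc_velocity t)).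
Proof.
have [_ d _] := Hphi (disc_param_in1 t).
have d1 : is_derive (disc_param t) 1 (fun s : R => complex.Re (u * phi (0 + (s%:C)%C * b)))
    (complex.Re (u * (phi' ((disc_param t)%:C%C * b) * b))).
  by apply: cdiff_line; rewrite add0r.
have := is_derive1_comp d1 (is_derive_disc_param t).
rewrite (_ : _ \o _ = fun t => complex.Re (u * disc_curve t)); last first.
  by apply/funext => s /=; rewrite add0r.
rewrite (_ : complex.Re _ * _ = complex.Re (u * disc_velocity t))//.
by rewrite /disc_velocity; move: (phi' _) => v; rewrite !(ReM, ImM) /=; ring.
Qed.

Lemma is_derive_disc_curveRe (t : R) :
  is_derive t 1 (@complex.Re R \o disc_curve) (complex.Re (disc_velocity t)).
Proof.
have := is_derive_disc_curve 1 t; rewrite mul1r.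
by rewrite (_ : (fun t => _) = @complex.Re R \o disc_curve)//; apply/funext => s; rewrite mul1r.
Qed.

Lemma is_derive_disc_curveIm (t : R) :
  is_derive t 1 (@complex.Im R \o disc_curve) (complex.Im (disc_velocity t)).
Proof.
have Ni z : complex.Re (- ('i)%C * z) = complex.Im z by case: z => p q /=; ring.
have := is_derive_disc_curve (- ('i)%C) t; rewrite Ni.
by rewrite (_ : (fun t => _) = @complex.Im R \o disc_curve)//; apply/funext => s; rewrite Ni.
Qed.

Lemma curve_derive_disc_curve : curve_derive disc_curve = disc_velocity.
Proof.
apply/funext => t; rewrite /curve_derive !derive1E.
rewrite (@derive_val _ _ _ _ _ _ _ (is_derive_disc_curveRe t)).
rewrite (@derive_val _ _ _ _ _ _ _ (is_derive_disc_curveIm t)).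
by case: (disc_velocity t).
Qed.

Lemma continuous_disc_velocity : continuous disc_velocity.
Proof.
have cC (a : R -> R) : continuous a -> continuous (fun t => (a t)%:C%C * b).
  move=> ca t; apply/continuousP_cmod => e e0.
  have b1 : 0 < cmod b + 1 by rewrite ltr_wpDl// cmod_ge0.
  have := @cvgr_dist_lt _ _ _ _ _ a (a t) (ca t) _ (divr_gt0 e0 b1).
  move=> /(_ (nbhs_filter t)).
  apply: filterS => s; rewrite ltr_pdivlMr// => H.
  rewrite -mulrBl -rmorphB cmodM cmod_real distrC.
  by have := normr_ge0 (a t - a s); nra.
have cp : continuous disc_param.
  move=> t; apply: differentiable_continuous; apply/derivable1_diffP.
  exact: (@ex_derive _ _ _ _ _ _ _ (is_derive_disc_param t)).
have cp' : continuous disc_param'.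
  move=> t; have d1 : is_derive t 1 (fun t : R => pi * (c * t - j)) (pi * c).
    by apply: is_derive_eq; rewrite /GRing.scale /=; ring.
  have d2 := @is_derive1_comp R sin (fun t : R => pi * (c * t - j)) t _ _ (is_derive_sin _) d1.
  apply: differentiable_continuous; apply/derivable1_diffP.
  apply: derivableM => //; apply: derivableM => //.
move=> t.
have c1 : {for t, continuous (fun t => phi' ((disc_param t)%:C%C * b))}.
  have [_ _ c1] := Hphi (disc_param_in1 t).
  by have := continuous_comp (cC _ cp t) c1.
exact: continuousM c1 (cC _ cp' t).
Qed.

Lemma C1_disc_curve : C1_curve disc_curve.
Proof.
split=> [t|t|].
- exact: (@ex_derive _ _ _ _ _ _ _ (is_derive_disc_curveRe t)).
- exact: (@ex_derive _ _ _ _ _ _ _ (is_derive_disc_curveIm t)).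
by rewrite curve_derive_disc_curve; exact: continuous_disc_velocity.
Qed.

Lemma kobayashi_metric_disc_curve t :
  (kobayashi_metric E (disc_curve t) (disc_velocity t) <= (2 * (pi * c))%:E)%E.
Proof.
apply: kobayashi_metric_disc => //; first exact: disc_param_in.
  rewrite cmodM cmod_real /disc_param' normrM normrM.
  have := sin_le1 (pi * (c * t - j)); have := sin_geN1 (pi * (c * t - j)).
  set s := sin _ => h1 h2; have s1 : `|s| <= 1 by rewrite ler_norml h1 h2.
  have pc : 0 < pi * c :> R by rewrite mulr_gt0// pi_gt0.
  rewrite (gtr0_norm pc) (ger0_norm (_ : 0 <= 2^-1 :> R)) ?invr_ge0//.
  have := normr_ge0 s; have := cmod_ge0 b; move: (pi * c) pc (`|s|) s1 => q q0 u u1 hb hu.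
  have h3 : q * u <= q by rewrite -[leRHS]mulr1 ler_pM2l.
  have h4 : q * u * cmod b <= q * cmod b by rewrite ler_wpM2r.
  have h5 : q * cmod b <= q * (1 / 2) by rewrite ler_pM2l.
  lra.
by rewrite mulr_gt0// pi_gt0.
Qed.

Lemma disc_curve_mem t : E (disc_curve t).
Proof. by have [] := Hphi (disc_param_in1 t). Qed.

Lemma disc_curve_start t : c * t = j -> disc_curve t = phi 0.
Proof. by move=> ctj; rewrite /disc_curve /disc_param ctj subrr mulr0 cos0 subrr mul0r rmorph0 mul0r. Qed.

Lemma disc_curve_end t : c * t = j + 1 -> disc_curve t = phi b.
Proof.
move=> ctj; rewrite /disc_curve /disc_param ctj addrAC subrr add0r mulr1 cospi opprK.
by rewrite divff// rmorph1 mul1r.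
Qed.

End DiscCurve.

Lemma curve_derive_near (g1 g2 : R -> R[i]) t : (\forall s \near t, g1 s = g2 s) ->
  curve_derive g1 t = curve_derive g2 t.
Proof.
move=> H; rewrite /curve_derive !derive1E.
congr (_ +i* _)%C; apply: near_eq_derive.
  by apply: filterS H => s /= ->.
by apply: filterS H => s /= ->.
Qed.

Lemma kobayashi_dist_disc_chain E n x y : E x -> disc_chain E n x y ->
  (kobayashi_dist E x y <= (2 * (pi * n.+1%:R))%:E)%E.
Proof.
(* A constant step is added so that there is at least one piece and the number [c] of pieces is
   nonzero. *)
move=> Ex /(disc_chain_mono Ex (leqnSn n)) /disc_chain_funs[phi [b [p [p0 pn H]]]].
pose c : R := n.+1%:R; have c0 : 0 < c by rewrite ltr0n.
have cn0 : c != 0 by rewrite gt_eqF.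
have ex j : exists phi' : R[i] -> R[i], (j < n.+1)%N -> forall z, cball 0 1 z ->
    [/\ E (phi j z), cdiff (phi j) z (phi' z) & {for z, continuous phi'}].
  by have [/H[[phi' Hp] _ _ _]|_] := ltnP j n.+1; [exists phi'|exists id].
have [phi' Hphi] := choice ex.
pose delta (j : nat) := disc_curve (phi j) (b j) c j%:R.
(* At [t = 1] the truncation equals [n.+1], one past the last piece; [minn] assigns this endpoint to
   piece [n]. *)
pose gamma t := delta (minn (Num.truncn (c * t)) n) t.
pose tau (j : nat) : R := j%:R / c.
have ctau j : c * tau j = j%:R by rewrite /tau mulrC divfK.
have trunc (j : nat) (t : R) : j%:R <= c * t -> c * t < j%:R + 1 -> Num.truncn (c * t) = j.
  by move=> h1 h2; apply/truncn_def; rewrite h1 -natr1 h2.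
have gammaE j t : (j < n.+1)%N -> tau j <= t <= tau j.+1 -> gamma t = delta j t.
  move=> jn /andP[jt tj]; have ct : c * t <= j%:R + 1.
    by rewrite natr1 -ctau ler_pM2l.
  have ct' : j%:R <= c * t by rewrite -ctau ler_pM2l.
  move: ct; rewrite le_eqVlt => /predU1P[ct|ct]; last first.
    by rewrite /gamma (trunc j) // (minn_idPl _).
  have tr : Num.truncn (c * t) = j.+1 by apply: trunc; rewrite ct -natr1// ltrDl.
  rewrite /gamma tr; have [jn'|jn'] := ltnP j n.
    rewrite (minn_idPl _)// /delta (disc_curve_end _ _ ct).
    rewrite disc_curve_start ?ct ?natr1//.
    have jn1 : (j.+1 < n.+1)%N by rewrite ltnS.
    have [_ _ -> _] := H _ jn1.
    by have [_ _ _ ->] := H j jn.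
  by rewrite (minn_idPr _) ?(leqW jn')//; have -> : n = j by apply/eqP; rewrite eqn_leq jn'.
have find t : 0 <= t <= 1 -> exists2 j, (j < n.+1)%N & tau j <= t <= tau j.+1.
  move=> /andP[t0 t1]; have ct0 : 0 <= c * t by rewrite mulr_ge0// ltW.
  have /andP[h1 h2] := truncn_itv ct0.
  have [tn|tn] := ltnP (Num.truncn (c * t)) n.+1.
    exists (Num.truncn (c * t)) => //.
    by rewrite -(ler_pM2l c0) ctau -[X in _ && X](ler_pM2l c0) ctau h1 ltW.
  have ct1 : c <= c * t by apply: le_trans h1; rewrite ler_nat.
  exists n => //; rewrite -(ler_pM2l c0) ctau -[X in _ && X](ler_pM2l c0) ctau.
  apply/andP; split; first by apply: le_trans ct1; rewrite ler_nat.
  by rewrite -/c -[leRHS]mulr1 ler_pM2l.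
have mem t : 0 <= t <= 1 -> E (gamma t).
  move=> /find[j jn jt]; rewrite (gammaE j)//.
  by apply: (@disc_curve_mem E (phi j) (phi' j)); [exact: Hphi|have [] := H j jn].
have len : (kobayashi_length E gamma <= (2 * (pi * c))%:E)%E.
  apply: (@integral_le_cst_off_finite _ [set tau j | j in [set j | (j < n.+2)%N]]).
  - by apply: finite_image; exact: finite_II.
  - by rewrite mulr_ge0// mulr_ge0// ?pi_ge0// ltW.
  - by move=> t; exact: kobayashi_metric_ge0.
  move=> t t01 Nt; have [j jn /andP[jt tj]] := find t t01.
  have jt' : tau j < t.
    by rewrite lt_neqAle jt andbT; apply/eqP => e; apply: Nt; exists j => //=; exact: ltnW.
  have tj' : t < tau j.+1.
    by rewrite lt_neqAle tj andbT; apply/eqP => e; apply: Nt; exists j.+1.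
  have Hj := Hphi j jn; have [_ bj _ _] := H j jn.
  rewrite (gammaE j)//; last by rewrite jt tj.
  rewrite (@curve_derive_near _ (delta j)).
    by rewrite (curve_derive_disc_curve _ _ Hj bj); exact: kobayashi_metric_disc_curve.
  have tin : t \in `]tau j, tau j.+1[%R by rewrite in_itv /= jt' tj'.
  have := near_in_itvoo tin.
  apply: filterS => s; rewrite in_itv /= => /andP[s1 s2].
  by apply: gammaE => //; rewrite !ltW.
apply: le_trans len; apply: ereal_inf_lbound; exists gamma => //; split.
- exists n.+1, tau; split.
  + by rewrite /tau mul0r.
  + by rewrite /tau divff.
  + by move=> j _; rewrite /tau ltr_pM2r ?invr_gt0// ltr_nat.
  + move=> j jn; exists (delta j); last by move=> t; rewrite /= in_itv /=; exact: gammaE.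
    by have [_ bj _ _] := H j jn; exact: C1_disc_curve (Hphi j jn) bj.
- by move=> t; rewrite /= in_itv /=; exact: mem.
- rewrite (gammaE 0%N)//; last by rewrite /tau mul0r lexx divr_ge0// ltW.
  by rewrite /delta disc_curve_start ?mulr0//; have [_ _ -> _] := H 0%N isT.
- rewrite (gammaE n)//; last by rewrite /tau ler_pdivrMr// mul1r ler_nat leqnSn -/c divff//=.
  by rewrite /delta disc_curve_end ?mulr1 ?natr1//; have [_ _ _ ->] := H n (leqnn _).
Qed.

End KobayashiBound.

(** * Connectedness of plane domains under removal of discs and points *)

Section PlaneConnectedness.
Variable R : realType.
Implicit Types (A E G S : set R[i]) (x y z w u v : R[i]).

(* connectedness of an open set, stated with balls *)
Definition clopen_full G := forall S, S `<=` G -> S !=set0 -> open S ->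
  (forall z, G z -> ~ S z -> exists2 r : R, 0 < r & forall w, cball z r w -> ~ S w) ->
  G `<=` S.

Lemma connected_clopen_full G : connected G -> clopen_full G.
Proof.
move=> cG S SG S0 oS H.
have -> : S = G; last by [].
apply: cG => //.
  by exists S => //; rewrite setIC setIidl.
exists (closure S); first exact: closed_closure.
apply/seteqP; split=> z; first by move=> Sz; split; [exact: SG|exact: subset_closure].
move=> [Gz cz]; apply: contrapT => Sz; have [r r0 Hr] := H z Gz Sz.
by have [w [Sw /Hr]] := cz _ (nbhs_cball z r0).
Qed.

Lemma continuous_real_scale (a : R -> R) b (t : R) : {for t, continuous a} ->
  {for t, continuous (fun t => (a t)%:C%C * b)}.
Proof.
move=> ca; apply/continuousP_cmod => e e0.
have b1 : 0 < cmod b + 1 by rewrite ltr_wpDl// cmod_ge0.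
have := @cvgr_dist_lt _ _ _ _ _ a (a t) ca _ (divr_gt0 e0 b1).
move=> /(_ (nbhs_filter t)); apply: filterS => s; rewrite ltr_pdivlMr// => H.
rewrite -mulrBl -rmorphB cmodM cmod_real distrC.
by have := normr_ge0 (a t - a s); nra.
Qed.

Lemma continuous_segment u v : continuous (fun t : R => u + (t%:C)%C * (v - u)).
Proof.
move=> t; apply: (@continuousD _ R[i] _ (fun=> u) (fun t : R => (t%:C)%C * (v - u))).
  exact: cst_continuous.
by apply: (@continuous_real_scale id); exact: cvg_id.
Qed.

Lemma clopen_path G S (g : R -> R[i]) : open S ->
  (forall z, G z -> ~ S z -> exists2 r : R, 0 < r & forall w, cball z r w -> ~ S w) ->
  (forall t : R, 0 <= t <= 1 -> G (g t) /\ {for t, continuous g}) -> S (g 0) -> S (g 1).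
Proof.
move=> /openP oS cS Hg S0; apply: (@segment_ind R (fun t => S (g t))) => // t t01.
have [Gt ct] := Hg t t01.
have near_g (r : R) : 0 < r -> exists2 d : R, 0 < d & forall s, `|s - t| < d -> cball (g t) r (g s).
  move=> r0; have [d d0 H] := (continuousP_cmod _ _).1 ct r r0.
  by exists d => // s st; apply: H; rewrite /ball_/= distrC.
have [St|St] := pselect (S (g t)).
  by have [r r0 rS] := oS _ St; have [d d0 H] := near_g r r0; exists d => // s s' _ _ _ /H/rS.
have [r r0 rS] := cS _ Gt St; have [d d0 H] := near_g r r0.
by exists d => // s s' _ _ /H/rS.
Qed.

Lemma connected_cball x (r : R) : connected (cball x r).
Proof.
move=> B [b Bb] [C oC BC] [D clD BD].
have Bsub : B `<=` cball x r by rewrite BC => z [].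
have oB : open B by rewrite BC; apply: openI => //; exact: open_cball.
apply/seteqP; split=> // z zr.
suff : B (b + (1%:C)%C * (z - b)) by rewrite rmorph1 mul1r subrKC.
apply: (@clopen_path (cball x r) B (fun t : R => b + (t%:C)%C * (z - b))) => //.
- move=> w wr Bw; have oD : open (~` D) by exact: closed_openC.
  have [|r1 r10 H] := (openP _).1 oD w; first by move=> Dw; apply: Bw; rewrite BD.
  by exists r1 => // y /H Dy; rewrite BD => -[].
- move=> t t01; split; last exact: continuous_segment.
  by apply: cball_convex => //; exact: Bsub.
- by rewrite rmorph0 mul0r addr0.
Qed.

Lemma open_component A x : open A -> open (connected_component A x).
Proof.
move=> /openP oA; apply/openP => z cz.
have [r r0 rA] := oA z (connected_component_sub cz); exists r => // w wr.
apply: connected_component_trans cz _.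
by apply: (connected_component_max (cballxx z r0) rA (@connected_cball z r)).
Qed.

Lemma closed_component A x w : open A -> A w ->
  closure (connected_component A x) w -> connected_component A x w.
Proof.
move=> /openP oA Aw cw; have [r r0 rA] := oA w Aw.
have [z [cz wz]] := cw _ (nbhs_cball w r0).
apply: connected_component_trans cz _; apply: connected_component_sym.
exact: (connected_component_max (cballxx w r0) rA (@connected_cball w r)).
Qed.

Lemma component_image A E (g : R[i] -> R[i]) x y : continuous g ->
  (forall z, A z -> E (g z)) -> connected_component A x y ->
  connected_component E (g x) (g y).
Proof.
move=> cg gAE xy.
have Ax := connected_component_sub (connected_component_sym xy).
have : (g @` connected_component A x) (g y) by exists y.
apply: connected_component_max.
- by exists x => //; exact: connected_component_refl.
- by move=> _ [z /connected_component_sub/gAE Ez <-].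
apply: connected_continuous_connected; first exact: component_connected.
exact: continuous_subspaceT.
Qed.

(** The points reached by chains form an open and relatively closed set. A disc step is not visibly
    symmetric, so on a quarter ball steps are produced in both directions, one for each half of the
    argument. *)
Lemma clopen_full_chain G x y : open G -> clopen_full G -> G x -> G y ->
  exists n, disc_chain G n x y.
Proof.
move=> oG cG Gx Gy; pose S := [set y | G y /\ exists n, disc_chain G n x y].
suff : S y by case.
have oG' := (openP _).1 oG.
have half (r : R) : 0 < r -> 0 < r / 4 /\ r / 4 <= r by lra.
have step z (r : R) w : 0 < r -> cball z r `<=` G -> cball z (r / 4) w ->
    disc_step G z w /\ disc_step G w z.
  move=> r0 rG; rewrite /cball/= => wz; split.
    by apply: (disc_step_ball rG r0); lra.
  apply: (@disc_step_ball _ _ _ _ (r / 2)); rewrite ?divr_gt0//.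
    move=> v; rewrite /cball/= => vw; apply: rG; rewrite /cball/=.
    by have := cmod_dist_trans v w z; lra.
  by rewrite cmod_distC; lra.
have add n z w : disc_chain G n x z -> disc_step G z w -> disc_chain G (n + 1) x w.
  by move=> c s; apply: disc_chain_cat c _; exists w.
apply: (cG S) => //.
- by move=> z [].
- by exists x; split=> //; exists 0%N.
- apply/openP => z [Gz [n c]]; have [r r0 rG] := oG' z Gz; have [r4 r4'] := half r r0.
  exists (r / 4) => // w wz; have [s _] := step z r w r0 rG wz; split.
    by apply: rG; exact: lt_le_trans wz r4'.
  by exists (n + 1)%N; exact: add s.
- move=> z Gz Sz; have [r r0 rG] := oG' z Gz; have [r4 r4'] := half r r0.
  exists (r / 4) => // w wz [_ [n c]]; apply: Sz; split=> //.
  by have [_ s] := step z r w r0 rG wz; exists (n + 1)%N; exact: add s.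
Qed.

(* interpolates modulus and direction, so stays in any annulus around [0]
   containing both endpoints *)
Lemma annulus_path (s s' : R) u v : 0 <= s -> s < cmod u < s' -> s < cmod v < s' ->
  u / (cmod u)%:C%C + v / (cmod v)%:C%C != 0 ->
  exists g : R -> R[i], [/\ g 0 = u, g 1 = v &
    forall t : R, 0 <= t <= 1 -> s < cmod (g t) < s' /\ {for t, continuous g}].
Proof.
move=> s0 /andP[u1 u2] /andP[v1 v2] uv.
have nz z : s < cmod z -> (cmod z)%:C%C != 0 :> R[i].
  by move=> sz; rewrite -cmod_gt0 cmod_real normr_gt0 gt_eqF//; lra.
pose u' := u / (cmod u)%:C%C; pose v' := v / (cmod v)%:C%C.
have unit z : s < cmod z -> cmod (z / (cmod z)%:C%C) = 1.
  move=> sz; rewrite cmodM cmodV cmod_real ger0_norm ?cmod_ge0// divff// gt_eqF//; lra.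
have un : cmod u' = 1 by exact: unit. have vn : cmod v' = 1 by exact: unit.
pose n (t : R) := u' + (t%:C)%C * (v' - u').
pose m (t : R) := cmod u + t * (cmod v - cmod u).
pose g t := (m t)%:C%C * (n t / (cmod (n t))%:C%C).
have n0 t : 0 <= t <= 1 -> n t != 0.
  move=> t01; apply/eqP => nt0.
  have e : ((1 - t)%:C)%C * u' = - ((t%:C)%C * v').
    by apply/eqP; rewrite -addr_eq0 -[X in _ == X]nt0 /n rmorphB rmorph1; apply/eqP; ring.
  have := congr1 (@cmod R) e; rewrite cmodN (cmodM _ u') (cmodM _ v') !cmod_real un vn !mulr1.
  rewrite ger0_norm; last by lra.
  rewrite ger0_norm; last by lra.
  move=> tE; have t2 : t = 1 / 2 by lra.
  have : ((1 / 2)%:C)%C * (u' + v') = 0 :> R[i].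
    by rewrite -[RHS]nt0 /n t2 rmorphM rmorph1 fmorphV rmorph_nat; field.
  move=> /eqP; rewrite mulf_eq0 (negPf uv) orbF -cmod_eq0 cmod_real.
  by rewrite normr_eq0 gt_eqF.
have cn0 t : 0 <= t <= 1 -> (cmod (n t))%:C%C != 0 :> R[i].
  by move=> /n0 nt; rewrite -cmod_eq0 cmod_real normr_eq0 cmod_eq0.
exists g; split.
- rewrite /g /m /n rmorph0 !mul0r !addr0 unit// divr1 /u' mulrC divfK//; exact: nz.
- rewrite /g /m /n rmorph1 !mul1r !subrKC unit// divr1 /v' mulrC divfK//; exact: nz.
move=> t t01; split.
  have -> : cmod (g t) = m t.
    rewrite /g cmodM cmod_real cmodM cmodV cmod_real (ger0_norm (cmod_ge0 _)).
    rewrite divff ?cmod_eq0 ?n0// mulr1 ger0_norm// /m; move: t01 => /andP[? ?]; nra.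
  rewrite /m; move: t01 => /andP[t0 t1]; apply/andP; split; have [?|?] := leP t (1/2); nra.
have cn : continuous n by exact: continuous_segment.
have c1 : {for t, continuous (fun t => (cmod (n t))%:C%C * 1)}.
  apply: (@continuous_real_scale (fun t => cmod (n t))).
  by apply: (@continuous_comp _ _ _ n (@cmod R)); [exact: cn|exact: continuous_cmod].
have cm : {for t, continuous m}.
  apply: (@continuousD _ R^o _ (fun=> cmod u) (fun t : R => t * (cmod v - cmod u))).
    exact: cst_continuous.
  exact: mulrr_continuous.
have c2 : {for (cmod (n t))%:C%C * 1, continuous (fun w : R[i] => w^-1)}.
  by apply: cdiff_continuous (cdiffV _); rewrite mulr1 cn0.
have c3 := continuous_comp c1 c2.
have c4 := @continuous_real_scale m 1 t cm.
have c5 := continuousM c4 (continuousM (cn t) c3).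
suff -> : g = (fun t => (m t)%:C%C * 1) \* (n \* ((fun w : R[i] => w^-1) \o
    (fun t => (cmod (n t))%:C%C * 1))) by exact: c5.
by apply/funext => r; rewrite /g /= !mulr1.
Qed.

(** An annulus around the disc is connected, so it lies in [S] or misses it. In the first case [S]
    together with the disc is clopen in [G], hence everything; in the second [S] itself is, although
    it misses the centre. *)
Lemma clopen_full_remove_disk G x (s s' : R) : 0 <= s -> s < s' -> open G ->
  cball x s' `<=` G -> clopen_full G -> clopen_full (G `\` cdisk x s).
Proof.
move=> s0 ss' oG s'G cG S SG S0 oS cS.
pose N := [set z | s < cmod (z - x) < s'].
have NG : N `<=` G `\` cdisk x s.
  move=> z /andP[z1 z2]; split; first exact: s'G.
  by rewrite /cdisk/= => /(lt_le_trans z1); rewrite ltxx.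
have Nconn u v : N u -> N v -> S u -> S v.
  have path a b : N a -> N b -> (a - x) / (cmod (a - x))%:C%C + (b - x) / (cmod (b - x))%:C%C != 0 -> S a -> S b.
    move=> Na Nb ab Sa.
    have [g [g0 g1 Hg]] := annulus_path s0 Na Nb ab.
    rewrite -(subrK x b) -g1; apply: (@clopen_path _ S (fun t => g t + x) oS cS).
      move=> t t01; have [gt ct] := Hg t t01; split; first by apply: NG; rewrite /N/= addrK.
      by apply: (@continuousD _ R[i] _ g (fun=> x)); [exact: ct|exact: cst_continuous].
    by rewrite g0 subrK.
  move=> Nu Nv Su.
  have [uv|uv] := eqVneq ((u - x) / (cmod (u - x))%:C%C + (v - x) / (cmod (v - x))%:C%C) 0; last exact: path uv Su.
  have nz : (cmod (u - x))%:C%C != 0 :> R[i].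
    by move: Nu => /andP[u1 _]; rewrite -cmod_eq0 cmod_real normr_eq0 gt_eqF//; lra.
  have u0 : u - x != 0 by move: nz; apply: contra => /eqP ->; rewrite cmod0.
  (* For opposite directions the interpolation would pass through the centre, so the path makes a
     detour via a quarter turn. *)
  pose w := x + ('i)%C * (u - x).
  have wE : w - x = ('i)%C * (u - x) by rewrite addrC addKr.
  have wm : cmod (w - x) = cmod (u - x) by rewrite wE cmodM cmod_i mul1r.
  have Nw : N w by rewrite /N/= wm.
  have i1 (a : R[i]) : a = 1 \/ a = -1 -> ('i)%C + a != 0 :> R[i].
    by case=> ->; rewrite -cmod_eq0 cmodE /= !(addr0, add0r) sqrtr_eq0 -ltNge; rewrite ?sqrrN expr1n ltr_wpDl.
  have d0 : (u - x) / (cmod (u - x))%:C%C != 0 by rewrite mulf_neq0// invr_neq0.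
  have Sw : S w.
    apply: (path u w) => //; rewrite wm wE -mulrA -{1}[_ / _]mul1r -mulrDl mulf_neq0//.
    by rewrite addrC i1//; left.
  apply: (path w v) => //.
  have -> : (v - x) / (cmod (v - x))%:C%C = - ((u - x) / (cmod (u - x))%:C%C).
    by apply/eqP; rewrite -addr_eq0 addrC uv.
  rewrite wm wE -mulrA -[X in _ - X]mul1r -mulrBl mulf_neq0//.
  by apply: i1; right.
have Sopen := (openP _).1 oS.
have [e [e1 e2]] : exists e : R, s < e /\ e < s' by exists ((s + s') / 2); lra.
pose p := x + (e%:C)%C; have Np : N p.
  by rewrite /N/= addrC addKr cmod_real ger0_norm ?e1//; lra.
have near_disk z : cdisk x s z -> cball x s' z by rewrite /cdisk/cball/=; lra.
have annulus z : cball x s' z -> ~ cdisk x s z -> N z.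
  by rewrite /cdisk/cball/N/= => h /negP; rewrite -ltNge => ->.
have [Sp|Sp] := pselect (S p).
  move=> z [Gz Dz].
  have : (S `|` cdisk x s) z; last by case.
  apply: (cG (S `|` cdisk x s)) => //.
  - by move=> y [/SG[]//|/near_disk/s'G].
  - by exists p; left.
  - apply/openP => y [/Sopen[r r0 rS]|yD]; first by exists r => // w /rS; left.
    have [r r0 rs'] := cball_shrink (near_disk _ yD); exists r => // w /rs' ws'.
    have [wD|wD] := pselect (cdisk x s w); first by right.
    by left; apply: Nconn Sp => //; exact: annulus.
  - move=> y Gy /not_orP[Sy Dy]; have [r r0 rS] := cS y (conj Gy Dy) Sy.
    have oD : open (~` cdisk x s) by apply: closed_openC; exact: closed_cdisk.
    have [r1 r10 rD] := (openP _).1 oD y Dy.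
    exists (Num.min r r1); first by rewrite lt_min r0.
    by move=> w; rewrite /cball/= lt_min => /andP[/rS ? /rD ?] [].
have Nempty z : N z -> ~ S z by move=> Nz Sz; apply: Sp; exact: Nconn Sz.
have SxF : S x.
  apply: (cG S) => //; first by move=> z /SG[].
    move=> z Gz Sz; have [zs'|zs'] := pselect (cball x s' z).
      have [r r0 rs'] := cball_shrink zs'; exists r => // w /rs' ws' Sw.
      by apply: (Nempty w) => //; apply: annulus => //; have [] := SG _ Sw.
    apply: cS => //; split=> // /near_disk //.
  by apply: s'G; apply: cballxx; lra.
by have [_ []] := SG _ SxF; rewrite /cdisk/= subrr cmod0.
Qed.

Lemma clopen_full_remove_finite G F : finite_set F -> open G -> clopen_full G ->
  open (G `\` F) /\ clopen_full (G `\` F).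
Proof.
move=> /finite_seqP[l ->]; elim: l => [|x l IH] oG cG.
  by rewrite (_ : [set` [::]] = set0) ?setD0//; apply/seteqP; split.
have [oG' cG'] := IH oG cG.
(* A point is removed as a closed disc of radius 0. *)
have E : G `\` [set` x :: l] = (G `\` [set` l]) `\` cdisk x 0.
  apply/seteqP; split=> z /=.
    move=> [Gz]; rewrite inE => /negP; rewrite negb_or => /andP[zx zl]; split; first by split=> //; apply/negP.
    rewrite /cdisk/= => zx0; move/eqP: zx; apply; apply/eqP; rewrite -subr_eq0 -cmod_eq0.
    by rewrite eq_le zx0 cmod_ge0.
  move=> [[Gz zl] zx]; split=> //; rewrite inE => /orP[/eqP zE|//].
  by apply: zx; rewrite /cdisk/= zE subrr cmod0.
rewrite E; split; first by rewrite setDE; apply: openI => //; apply: closed_openC; exact: closed_cdisk.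
have [Gx|Gx] := pselect ((G `\` [set` l]) x).
  by have [r r0 rG] := (openP _).1 oG' x Gx; exact: (clopen_full_remove_disk (lexx 0) r0).
rewrite (_ : _ `\` cdisk x 0 = G `\` [set` l])//; apply/seteqP; split=> z; first by case.
move=> Gz; split=> //; rewrite /cdisk/= => zx; apply: Gx.
have -> : x = z; last by [].
by apply/eqP; rewrite eq_sym -subr_eq0 -cmod_eq0 eq_le zx cmod_ge0.
Qed.

End PlaneConnectedness.

(** * The basin of attraction and its components *)

Section BasinDynamics.
Variable R : realType.
Implicit Types (E G K U V : set R[i]) (x y z w q : R[i]).

Lemma ex_min_nat (P : nat -> Prop) : (exists n, P n) ->
  exists n, P n /\ forall m, (m < n)%N -> ~ P m.
Proof.
move=> [n Pn]; elim/ltn_ind: n Pn => n IH Pn.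
have [[m [mn Pm]]|H] := pselect (exists m, (m < n)%N /\ P m); first exact: IH Pm.
by exists n; split=> // m mn Pm; apply: H; exists m.
Qed.

Lemma finite_uniform_nat (F : set R[i]) (P : R[i] -> nat -> Prop) : finite_set F ->
  (forall x, F x -> exists N, forall n, (N <= n)%N -> P x n) ->
  exists N, forall x, F x -> forall n, (N <= n)%N -> P x n.
Proof.
move=> /finite_seqP[l ->]; elim: l => [|a l IH] H.
  by exists 0%N => x; rewrite /= in_nil.
have [x xl|N HN] := IH; first by apply: H; rewrite /= inE xl orbT.
have [|N' HN'] := H a; first by rewrite /= inE eqxx.
exists (maxn N N') => x /=; rewrite inE => /orP[/eqP ->|xl] n; rewrite geq_max => /andP[h1 h2].
  exact: HN'.
exact: HN.
Qed.

Variables (f f' : R[i] -> R[i]).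
Hypothesis df : forall z, cdiff f z (f' z).
Hypothesis f0 : f 0 = 0.
Hypothesis f_attr : cmod (f' 0) < 1.

Let cf : continuous f. Proof. by move=> z; exact: cdiff_continuous (df z). Qed.

Let cf' : continuous f'. Proof. exact: entire_derivative_continuous df. Qed.

Let A := basin f 0.

Fixpoint iter_derive n z := if n is m.+1 then f' (iter m f z) * iter_derive m z else 1.

Lemma cdiff_iter n z : cdiff (iter n f) z (iter_derive n z).
Proof.
elim: n => [|n IH] /=; first exact: cdiff_id.
exact: (cdiff_comp IH (df _)).
Qed.

Lemma continuous_iter n : continuous (iter n f).
Proof. by move=> z; exact: cdiff_continuous (cdiff_iter n z). Qed.

Lemma continuous_iter_derive n : continuous (iter_derive n).
Proof.
elim: n => [|n IH] z; first exact: cst_continuous.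
apply: (@continuousM _ _ (fun z => f' (iter n f z)) (iter_derive n)); last exact: IH.
by apply: (@continuous_comp _ _ _ (iter n f) f'); [exact: continuous_iter|exact: cf'].
Qed.

Lemma iter_derive_neq0 n z : (forall i, (i < n)%N -> f' (iter i f z) != 0) ->
  iter_derive n z != 0.
Proof.
elim: n => [|n IH] H /=; first exact: oner_neq0.
by rewrite mulf_neq0// ?H// IH// => i /leqW; exact: H.
Qed.

Lemma iter0 n : iter n f 0 = 0.
Proof. by elim: n => [//|n IH]; rewrite iterS IH. Qed.

Lemma attracting_contraction : exists l d : R, [/\ 0 <= l, l < 1, 0 < d &
  forall z, cmod z < d -> cmod (f z) <= l * cmod z].
Proof.
have e0 : 0 < (1 - cmod (f' 0)) / 2 by have := f_attr; lra.
have [d d0 H] := df 0 e0; exists ((1 + cmod (f' 0)) / 2), d.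
have c0 := cmod_ge0 (f' 0); have f1 := f_attr.
split=> //; [lra|lra|move=> z zd].
have := H z; rewrite f0 !subr0 => /(_ zd) {}H.
rewrite -(subrK (f' 0 * z) (f z)); apply: le_trans (cmodD _ _) _; rewrite cmodM.
by have := cmod_ge0 z; lra.
Qed.

Lemma basinP z : A z <-> forall e : R, 0 < e -> exists N, forall n, (N <= n)%N -> cmod (iter n f z) < e.
Proof.
split=> [Az e e0|H].
  have [N _ HN] := Az _ (nbhs_cball 0 e0); exists N => n /HN.
  by rewrite /cball/= subr0.
move=> B /nbhs_cballP[e e0 eB]; have [N HN] := H e e0.
by exists N => // n /= /HN ne; apply: eB; rewrite /cball/= subr0.
Qed.

Lemma basin_shift n z : A (iter n f z) <-> A z.
Proof.
rewrite !basinP; split=> H e /H[N HN].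
  exists (N + n)%N => m Nm; have nm : (n <= m)%N by apply: leq_trans Nm; exact: leq_addl.
  by rewrite -(subnK nm) iterD; apply: HN; rewrite leq_subRL// addnC.
by exists N => m Nm; rewrite -iterD; apply: HN; exact: leq_trans (leq_addr _ _).
Qed.

Lemma iter_contraction (l d : R) : 0 <= l -> l < 1 ->
  (forall z, cmod z < d -> cmod (f z) <= l * cmod z) ->
  forall n z, cmod z < d -> cmod (iter n f z) <= l ^+ n * cmod z.
Proof.
move=> l0 l1 H; elim=> [|n IH] z zd; first by rewrite expr0 mul1r.
have h1 := H z zd; have cz := cmod_ge0 z.
have h2 : cmod (f z) < d by nra.
rewrite iterSr; apply: le_trans (IH _ h2) _.
by rewrite exprSr -mulrA ler_wpM2l ?exprn_ge0.
Qed.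

Lemma disk_sub_basin (l d : R) : 0 <= l -> l < 1 ->
  (forall z, cmod z < d -> cmod (f z) <= l * cmod z) -> cball 0 d `<=` A.
Proof.
move=> l0 l1 H z; rewrite /cball/= subr0 => zd; apply/basinP => e e0.
have c1 : 0 < cmod z + 1 by rewrite ltr_wpDl// cmod_ge0.
have : l ^+ n @[n --> \oo] --> 0 by apply: cvg_expr; rewrite ger0_norm.
move=> /cvgr0_norm_lt/(_ _ (divr_gt0 e0 c1))[N _ HN]; exists N => n /HN.
rewrite /= ger0_norm ?exprn_ge0// ltr_pdivlMr// => h.
apply: le_lt_trans (iter_contraction l0 l1 H n zd) _.
by have := exprn_ge0 n l0; lra.
Qed.

Lemma open_basin : open A.
Proof.
have [l [d [l0 l1 d0 H]]] := attracting_contraction.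
apply/openP => z /basinP/(_ _ d0)[N HN].
have zN : cball 0 d (iter N f z) by rewrite /cball/= subr0; exact: HN.
have [e e0 He] := cball_shrink zN.
have [r r0 Hr] := (continuousP_cball _ _).1 (@continuous_iter N z) _ e0.
exists r => // w /Hr/He/(disk_sub_basin l0 l1 H) Aw.
exact/(basin_shift N).
Qed.

Lemma basin0 : A 0.
Proof. by apply/basinP => e e0; exists 0%N => n _; rewrite iter0 cmod0. Qed.

Lemma component_iter n x y : connected_component A x y ->
  connected_component A (iter n f x) (iter n f y).
Proof.
apply: component_image; first exact: continuous_iter.
by move=> z Az; exact/basin_shift.
Qed.

(** Applied to the exponents of a sequence of iterates: either one iterate recurs, which gives a
    constant subsequence, or the exponents tend to infinity and the iterates converge to 0. *)
Lemma subsequence_cst_or_infty (k : nat -> nat) :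
  (exists c phi, {homo phi : m n / (m < n)%N} /\ forall n, k (phi n) = c) \/
  (forall M, exists N, forall n, (N <= n)%N -> (M <= k n)%N).
Proof.
have [[c Hc]|H] := pselect (exists c, forall N, exists n, (N <= n)%N /\ k n = c).
  left; have [s Hs] := choice Hc.
  pose phi := fix phi n := if n is m.+1 then s (phi m).+1 else s 0%N.
  exists c, phi; split; last by case=> [|n]; exact: (Hs _).2.
  by apply: homo_ltn => [? ? ?|n]; [exact: ltn_trans|have [] := Hs (phi n).+1].
right; elim=> [|M [N HN]]; first by exists 0%N.
have {}H : ~ forall N, exists n, (N <= n)%N /\ k n = M by move=> HM; apply: H; exists M.
have /existsNP[N' HN'] := H.
exists (maxn N N') => n; rewrite geq_max => /andP[Nn N'n].
rewrite ltn_neqAle HN// andbT; apply/eqP => Mk; apply: HN'; exists n; by split.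
Qed.

Lemma cvg_uniform_cmod K (u : nat -> R[i] -> R[i]) g :
  (forall e : R, 0 < e -> exists N, forall n, (N <= n)%N -> forall z, K z -> cmod (u n z - g z) < e) ->
  {uniform K, u @ \oo --> g}.
Proof.
move=> H P /uniform_nbhs[E [entE EP]].
move: entE; rewrite -entourage_from_ballE => -[e /gt0_real_complex[r r0 ->] rE].
have [N HN] := H r r0; exists N => // n /HN nr; apply: EP => z Kz; apply: rE.
by rewrite /= -ball_normE /= normrC ltcR cmod_distC; exact: nr.
Qed.

(** This transfers boundedness: a component of the basin, being connected, lies in a Fatou
    component. Normality holds because some iterate maps a small ball into the contracting disc. *)
Lemma basin_sub_fatou : A `<=` fatou_set f.
Proof.
move=> z0 Az0; exists A => //; split; first exact: open_basin.
move=> z Az; have [l [d [l0 l1 d0 H]]] := attracting_contraction.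
have [N HN] := (basinP z).1 Az _ d0.
have zN : cball 0 d (iter N f z) by rewrite /cball/= subr0; exact: HN.
have [e e0 He] := cball_shrink zN.
have [r r0 Hr] := (continuousP_cball _ _).1 (@continuous_iter N z) _ e0.
have rN w : cball z r w -> cmod (iter N f w) < d.
  by move=> /Hr/He; rewrite /cball/= subr0.
exists (cball z r); split.
- exact: open_cball.
- exact: connected_cball.
- exact: cballxx.
- move=> w /rN wd; apply/(basin_shift N); apply: (disk_sub_basin l0 l1 H).
  by rewrite /cball/= subr0.
move=> u Hu; have /choice[k kP] : forall n, exists k, u n = iter k f.
  by move=> n; have [k _ <-] := Hu n; exists k.
have [[c [phi [phim kc]]]|kinf] := subsequence_cst_or_infty k.
  exists phi => //; left; exists (iter c f) => K _ _; apply: cvg_uniform_cmod => e' e'0.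
  by exists 0%N => n _ w _; rewrite /= kP kc subrr cmod0.
exists id => //; left; exists (fun=> 0) => K _ Kr; apply: cvg_uniform_cmod => e' e'0.
have : l ^+ n @[n --> \oo] --> 0 by apply: cvg_expr; rewrite ger0_norm.
move=> /cvgr0_norm_lt/(_ _ (divr_gt0 e'0 d0))[M _ HM].
have [M' HM'] := kinf (M + N)%N; exists M' => n /HM' kn w /Kr/rN wd.
have Nk : (N <= k n)%N := leq_trans (leq_addl _ _) kn.
rewrite /= subr0 kP -(subnK Nk) iterD.
apply: le_lt_trans (iter_contraction l0 l1 H _ wd) _.
have := HM (k n - N)%N; rewrite /= leq_subRL// addnC => /(_ kn).
rewrite ger0_norm ?exprn_ge0// ltr_pdivlMr//; apply: le_lt_trans.
by rewrite ler_wpM2l ?exprn_ge0// ltW.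
Qed.

(** * Uniformly short chains to the backward orbit of [p] *)

Section Core.
Variables (p : R[i]).
Hypothesis f_crit : finite_set [set z | f' z = 0].
Hypothesis component_bounded : forall x, A x -> exists M : R,
  forall w, connected_component A x w -> cmod w <= M.
Hypothesis p_component : connected_component A 0 p.
Hypothesis p_neq0 : p <> 0.

Let Omega := connected_component A 0.

(** A nonzero derivative keeps [F w] away from [F z] for nearby [w != z], and continuity keeps it
    away from the other points of the finite set. *)
Lemma avoid_finite F z d (P : set R[i]) : cdiff F z d -> d != 0 -> finite_set P ->
  exists2 r : R, 0 < r & forall w, w != z -> cmod (w - z) < r -> ~ P (F w).
Proof.
move=> dF d0 finP.
have m0 : 0 < cmod d by rewrite cmod_gt0.
have [r1 r10 H1] := dF _ (divr_gt0 m0 (@ltr0n R 2)).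
have finP' : finite_set (P `\ F z) by exact: finite_setD.
have [x [Px /= xFz]|N HN] := finite_uniform_nat
    (P := fun x n => forall w, cmod (w - F z) < n.+1%:R^-1 -> w <> x) finP'.
  have x0 : 0 < cmod (x - F z) by rewrite cmod_gt0 subr_eq0; apply/eqP.
  exists (Num.truncn (cmod (x - F z))^-1) => n nN w wn wx; move: wn; rewrite wx.
  apply/negP; rewrite -leNgt ltW// invf_plt ?posrE//; apply: lt_le_trans (truncnS_gt _) _.
  by rewrite ler_nat ltnS.
have N0 : 0 < N.+1%:R^-1 :> R by rewrite invr_gt0.
have [r2 r20 H2] := (continuousP_cball _ _).1 (cdiff_continuous dF) _ N0.
exists (Num.min r1 r2); first by rewrite lt_min r10.
move=> w wz; rewrite lt_min => /andP[/H1 h1 /H2 h2] PFw.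
have FwFz : F w <> F z.
  move=> e; move: h1; rewrite e subrr sub0r cmodN cmodM.
  by have : 0 < cmod (w - z); [rewrite cmod_gt0 subr_eq0|move=> ? ?; nra].
by apply: (HN (F w) _ N (leqnn _) (F w)).
Qed.

Lemma cball_other z (r : R) : 0 < r -> exists2 w, w != z & cmod (w - z) < r.
Proof.
move=> r0; exists (z + ((r / 2)%:C)%C); have e : z + ((r / 2)%:C)%C - z = ((r / 2)%:C)%C by rewrite addrC addKr.
  by rewrite -subr_eq0 e -cmod_eq0 cmod_real normr_eq0 gt_eqF// divr_gt0.
by rewrite e cmod_real gtr0_norm ?divr_gt0//; lra.
Qed.

(** Where the derivative of [iter n f] is nonzero, a small displacement moves the image off the
    finitely many critical points, so one more factor of the chain rule becomes nonzero. *)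
Lemma iter_derive_dense n z (r : R) : 0 < r -> exists2 y, cball z r y & iter_derive n y != 0.
Proof.
elim: n z r => [|n IH] z r r0; first by exists z; [exact: cballxx|exact: oner_neq0].
have [y yr dy] := IH z r r0.
have [r1 r10 H1] := avoid_finite (cdiff_iter n y) dy f_crit.
have m0 : 0 < cmod (iter_derive n y) by rewrite cmod_gt0.
have [r2 r20 H2] := (continuousP_cball _ _).1 (@continuous_iter_derive n y) _ m0.
have [r3 r30 H3] := cball_shrink yr.
have [|w wy] := @cball_other y (Num.min r1 (Num.min r2 r3)); first by rewrite !lt_min r10 r20.
rewrite !lt_min => /and3P[/(H1 _ wy) w1 /H2 w2 /H3 w3]; exists w => //=.
rewrite mulf_neq0//; first exact/eqP.
apply/eqP => w0; move: w2; rewrite w0 sub0r cmodN ltxx//.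
Qed.

Lemma iter_avoid_finite n (P : set R[i]) z (r : R) : finite_set P -> 0 < r ->
  exists2 y, cball z r y & ~ P (iter n f y).
Proof.
move=> finP r0; have [y yr dy] := iter_derive_dense n z r0.
have [r1 r10 H1] := avoid_finite (cdiff_iter n y) dy finP.
have [r3 r30 H3] := cball_shrink yr.
have [|w wy] := @cball_other y (Num.min r1 r3); first by rewrite !lt_min r10.
by rewrite !lt_min => /andP[/(H1 _ wy) w1 /H3 w3]; exists w.
Qed.

(* By the chain rule these are the critical values of [iter n f]. *)
Definition postcritical n : set R[i] :=
  [set w | exists c j, [/\ f' c = 0, (0 < j <= n)%N & iter j f c = w]].

Lemma finite_postcritical n : finite_set (postcritical n).
Proof.
elim: n => [|n IH].
  rewrite (_ : postcritical 0 = set0)//; apply/seteqP; split=> // w [c [j [_ + _]]].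
  by case: j.
rewrite (_ : postcritical n.+1 = postcritical n `|` (iter n.+1 f) @` [set z | f' z = 0]).
  by rewrite finite_setU; split=> //; exact: finite_image.
apply/seteqP; split=> w.
  move=> [c [j [c0 /andP[j0]]]]; rewrite leq_eqVlt => /orP[/eqP ->|jn] jw.
    by right; exists c.
  by left; exists c, j; rewrite j0 -ltnS.
case=> [[c [j [c0 /andP[j0 jn] jw]]]|[c c0 cw]].
  by exists c, j; rewrite j0 leqW.
by exists c, n.+1; rewrite ltnSn.
Qed.

Lemma iter_derive_neq0_postcritical n w : ~ postcritical n (iter n f w) ->
  iter_derive n w != 0.
Proof.
move=> H; apply: iter_derive_neq0 => i ilt; apply/eqP => fi; apply: H.
exists (iter i f w), (n - i)%N; split=> //; first by rewrite subn_gt0 ilt leq_subr.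
by rewrite -iterD subnK// ltnW.
Qed.

(** Properness comes from the basin being completely invariant: a limit point of the component whose
    image lies in the basin is itself in the basin, and components are relatively closed there. *)
Lemma chain_lift_iter n k V x y z : V `<=` A -> A x -> iter n f x = y ->
  (forall w, connected_component A x w -> V (iter n f w) -> iter_derive n w != 0) ->
  disc_chain V k y z -> exists2 w, iter n f w = z &
    disc_chain (connected_component A x `&` (iter n f) @^-1` V) k x w.
Proof.
move=> VA Ax xy H c; have [M HM] := component_bounded Ax.
have pU w : closure (connected_component A x) w -> V (iter n f w) -> connected_component A x w.
  by move=> cw /VA/basin_shift Aw; apply: closed_component => //; exact: open_basin.
exact: (disc_chain_lift (@cdiff_iter n) (@continuous_iter_derive n)
  (open_component open_basin) HM pU H (connected_component_refl Ax) xy c).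
Qed.

(** The image of [y] may be a critical value, so [y] is first moved by one small step; from then on
    the chain in [G] avoids the finite set [postcritical n] and lifts. *)
Lemma chain_to_preimage G n y q : open G -> G `<=` A -> clopen_full G -> A y ->
  G (iter n f y) -> G q -> ~ postcritical n q ->
  exists k w, iter n f w = q /\
    disc_chain (connected_component A y `&` (iter n f) @^-1` G) k y w.
Proof.
move=> oG GA cG Ay Gy Gq Pq.
set V := connected_component A y `&` _.
have oV : open V.
  apply: openI; first exact: open_component open_basin.
  by move: (@continuous_iter n) => /continuousP; exact.
have Vy : V y by split=> //; exact: connected_component_refl.
have [r r0 rV] := (openP _).1 oV _ Vy.
have r2 : 0 < r / 2 by rewrite divr_gt0.
have [y1 y1r Py1] := iter_avoid_finite n y (finite_postcritical n) r2.
have s : disc_step V y y1 by apply: (disc_step_ball rV r0); exact: ltW.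
have [_ [cy1 Gy1]] := disc_step_mem s.
have [oE cE] := clopen_full_remove_finite (finite_postcritical n) oG cG.
have [k c] := clopen_full_chain oE cE (conj Gy1 Py1) (conj Gq Pq).
have [|||w wq cw] := @chain_lift_iter n k _ y1 _ _ _ _ erefl _ c.
- by move=> w [/GA].
- exact: connected_component_sub cy1.
- by move=> w _ [_]; exact: iter_derive_neq0_postcritical.
exists k.+1, w; split=> //; exists y1 => //; apply: disc_chain_sub cw => z [cz [Gz _]].
by split=> //; exact: connected_component_trans cy1 cz.
Qed.

Lemma open_Omega : open Omega. Proof. exact: open_component open_basin. Qed.

Lemma Omega_sub : Omega `<=` A. Proof. exact: connected_component_sub. Qed.

Lemma clopen_Omega : clopen_full Omega.
Proof. by apply: connected_clopen_full; exact: component_connected. Qed.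

Lemma Omega0 : Omega 0. Proof. exact: connected_component_refl basin0. Qed.

Lemma disc_chain_mem E n x y : E x -> disc_chain E n x y -> E y.
Proof.
elim: n x => [|n IH] x Ex /=; first by move=> <-.
by move=> [x' s c]; have [_ Ex'] := disc_step_mem s; exact: IH c.
Qed.

(** Lifting chains that start at the fixed point 0 reaches noncritical values arbitrarily close to
    [x]; boundedness of the component provides a limit of the preimages. *)
Lemma Omega_surjective x : Omega x -> exists2 w, Omega w & f w = x.
Proof.
move=> Ox; have [M HM] := component_bounded basin0.
have ex (k : nat) : exists w, Omega w /\ cmod (f w - x) < k.+1%:R^-1.
  have [r r0 rO] := (openP _).1 open_Omega _ Ox.
  have m0 : 0 < Num.min r k.+1%:R^-1 by rewrite lt_min r0 invr_gt0 ltr0n.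
  have [y yr Py] := iter_avoid_finite 0 x (finite_postcritical 1) m0.
  move: yr; rewrite /cball/= lt_min => /andP[/rO Oy yk].
  have O1 : Omega (iter 1 f 0) by rewrite iter0; exact: Omega0.
  have [n [w [wy c]]] := chain_to_preimage open_Omega Omega_sub clopen_Omega basin0 O1 Oy Py.
  exists w; split; last by move: wy => /= ->.
  by have [] := disc_chain_mem (conj Omega0 O1) c.
have [w Hw] := choice ex.
have [ws wsP] := bounded_cluster (fun n => HM _ (Hw n).1).
have fws : f ws = x.
  apply/eqP; rewrite -subr_eq0; apply/eqP; apply: cmod_eq_small => e e0.
  have e2 : 0 < e / 2 by rewrite divr_gt0.
  have [d d0 Hd] := (continuousP_cball _ _).1 (@cf ws) _ e2.
  have [n nN /Hd h1] := wsP _ (Num.truncn (e / 2)^-1) d0.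
  have h2 : n.+1%:R^-1 < e / 2.
    rewrite invf_plt ?posrE//; apply: lt_le_trans (truncnS_gt _) _.
    by rewrite ler_nat ltnS.
  have h3 := lt_trans (Hw n).2 h2.
  have := cmod_dist_trans (f ws) (f (w n)) x.
  by rewrite (cmod_distC (f ws) (f (w n))); lra.
exists ws => //; apply: closed_component; first exact: open_basin.
  by apply/(basin_shift 1); rewrite /= fws; exact: Omega_sub.
move=> B /nbhs_cballP[r r0 rB]; have [n _ nr] := wsP r 0%N r0.
by exists (w n); split; [exact: (Hw n).1|exact: rB].
Qed.

(** Follow a backward orbit of [p] in [Omega]. Orbits of the finitely many points of [P] in the
    basin tend to 0, so from some time on none is at [p], and a deep enough backward point is not in
    [P]. It is outside the disc because the disc is forward invariant and misses [p]. *)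
Lemma backward_point (P : set R[i]) (d : R) : finite_set P -> d < cmod p ->
  (forall z, cmod z <= d -> cmod (f z) <= d) ->
  exists q j, [/\ Omega q, iter j f q = p, ~ P q & d < cmod q].
Proof.
move=> finP dp H.
have ex x : exists w, Omega x -> Omega w /\ f w = x.
  have [/Omega_surjective[w Ow fw]|Ox] := pselect (Omega x); first by exists w.
  by exists 0.
have [g Hg] := choice ex.
have b n : Omega (iter n g p) /\ iter n f (iter n g p) = p.
  elim: n => [//|n [IH1 IH2]]; have [h1 h2] := Hg _ IH1.
  by split=> //; rewrite iterSr /= h2.
have [x Px|N HN] := @finite_uniform_nat P (fun x n => A x -> cmod (iter n f x) < cmod p) finP.
  have [Ax|Ax] := pselect (A x); last by exists 0%N.
  have p0 : 0 < cmod p by rewrite cmod_gt0; apply/eqP.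
  by have [N HN] := (basinP x).1 Ax _ p0; exists N => n /HN.
have [ON iN] := b N; exists (iter N g p), N; split=> //.
  by move=> /HN/(_ N (leqnn _) (Omega_sub ON)); rewrite iN ltxx.
rewrite ltNge; apply/negP => h; move: dp; rewrite ltNge => /negP; apply.
rewrite -iN; elim: {1}N => [//|n IH].
by rewrite iterS; exact: H.
Qed.

(** A nearby starting point is joined to [y] by one extra step, so the length is locally bounded. *)
Lemma chain_uniform K V : open V -> compact K -> K `<=` V ->
  (forall y, K y -> exists n q, backward_orbit f p q /\ disc_chain V n y q) ->
  exists n, forall y, K y -> exists q, backward_orbit f p q /\ disc_chain V n y q.
Proof.
move=> oV cK KV H.
have [y Ky|n Hn] := @compact_uniform_nat R K
   (fun n y => exists q, backward_orbit f p q /\ disc_chain V n y q) cK; last by exists n.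
have [n [q [bq c]]] := H y Ky; have [r r0 rV] := (openP _).1 oV _ (KV _ Ky).
exists (r / 4); split; first by rewrite divr_gt0.
exists n.+1 => w; rewrite /cball/= => wr m nm; exists q; split=> //.
have r2 : 0 < r / 2 by rewrite divr_gt0.
have wV : cball w (r / 2) `<=` V.
  move=> v; rewrite /cball/= => vw; apply: rV; rewrite /cball/=.
  by have := cmod_dist_trans v w y; lra.
apply: (disc_chain_mono (wV _ (cballxx w r2)) nm); exists y => //.
by apply: (disc_step_ball wV r2); rewrite cmod_distC; lra.
Qed.

Lemma closed_subset_compact K (M : R) : closure K `<=` K -> (forall z, K z -> cmod z <= M) ->
  compact K.
Proof.
move=> clK; apply: bounded_closed_compactC; apply/closure_id.
by apply/seteqP; split=> //; exact: subset_closure.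
Qed.

Lemma closure_cmod_le (g : R[i] -> R[i]) (r : R) K z : continuous g ->
  (forall w, K w -> cmod (g w) <= r) -> closure K z -> cmod (g z) <= r.
Proof.
move=> cg H cz; apply/ler_addgt0Pl => e e0.
have [d d0 Hd] := (continuousP_cball _ _).1 (cg z) _ e0.
have [w [/H wr /Hd wz]] := cz _ (nbhs_cball z d0).
by have := cmod_lerB (g z) (g w); rewrite cmod_distC; lra.
Qed.

Lemma closure_cmod_ge (g : R[i] -> R[i]) (r : R) K z : continuous g ->
  (forall w, K w -> r <= cmod (g w)) -> closure K z -> r <= cmod (g z).
Proof.
move=> cg H cz; apply/ler_addgt0Pl => e e0.
have [d d0 Hd] := (continuousP_cball _ _).1 (cg z) _ e0.
have [w [/H wr /Hd wz]] := cz _ (nbhs_cball z d0).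
by have := cmod_lerB (g w) (g z); lra.
Qed.

(** The point 0 is included so that [B] below contains [Omega], hence every orbit in the basin
    eventually enters [B]. *)
Let L : set R[i] := [set c | c = 0 \/ f' c = 0 /\ A c].

Let finite_L : finite_set L.
Proof.
apply: (@sub_finite_set _ _ ([set 0] `|` [set z | f' z = 0])).
  by move=> c [->|[? _]]; [left|right].
by rewrite finite_setU; split; [exact: finite_set1|exact: f_crit].
Qed.

Let L_sub : L `<=` A. Proof. by move=> c [->|[]//]; exact: basin0. Qed.

(* Meets only finitely many components, since every orbit of [L] ends in [Omega]. *)
Let B : set R[i] := [set y | A y /\ exists c j, L c /\ connected_component A y (iter j f c)].

Let B_saturated y z : B y -> connected_component A y z -> B z.
Proof.
move=> [Ay [c [j [Lc yc]]]] yz; split; first exact: connected_component_sub yz.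
by exists c, j; split=> //; exact: connected_component_trans (connected_component_sym yz) yc.
Qed.

Let B_iter n y : B y -> B (iter n f y).
Proof.
move=> [Ay [c [j [Lc yc]]]]; split; first exact/basin_shift.
by exists c, (n + j)%N; split=> //; rewrite iterD; exact: component_iter.
Qed.

Let L_sub_B c : L c -> B c.
Proof.
move=> Lc; split; first exact: L_sub.
by exists c, 0%N; split=> //; exact: connected_component_refl (L_sub Lc).
Qed.

Let open_B : open B.
Proof.
apply/openP => y By; have Ay := By.1.
have [r r0 rc] := (openP _).1 (@open_component _ _ y open_basin) _ (connected_component_refl Ay).
by exists r => // w /rc; exact: B_saturated.
Qed.

Let closed_B y : closure B y -> A y -> B y.
Proof.
move=> cy Ay; have cc := connected_component_refl Ay.
have [r r0 rc] := (openP _).1 (@open_component _ _ y open_basin) _ cc.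
have [w [Bw /rc yw]] := cy _ (nbhs_cball y r0).
exact: B_saturated Bw (connected_component_sym yw).
Qed.

Let B_bounded : exists M : R, forall y, B y -> cmod y <= M.
Proof.
have [l [d [l0 l1 d0 H]]] := attracting_contraction.
have dO : cball 0 d `<=` Omega.
  by apply: connected_component_max (disk_sub_basin l0 l1 H) (@connected_cball _ 0 d); exact: cballxx.
have [c Lc|N HN] := finite_uniform_nat (P := fun c n => forall m, (n <= m)%N -> Omega (iter m f c)) finite_L.
  have [N HN] := (basinP c).1 (L_sub Lc) _ d0; exists N => n Nn m nm.
  by apply: dO; rewrite /cball/= subr0; apply: HN; exact: leq_trans nm.
have [c Lc|M HM] := finite_uniform_nat (P := fun c n => forall j, (j <= N)%N -> forall w,
     connected_component A (iter j f c) w -> cmod w <= n%:R) finite_L.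
  elim: N {HN} => [|N [M HM]].
    have [M HM] := component_bounded (L_sub Lc); exists (Num.truncn M).+1 => n Mn j.
    rewrite leqn0 => /eqP -> w /HM wM; apply: le_trans wM _; apply: ltW.
    by apply: lt_le_trans (truncnS_gt _) _; rewrite ler_nat.
  have [M' HM'] := component_bounded ((basin_shift N.+1 c).2 (L_sub Lc)).
  exists (maxn M (Num.truncn M').+1) => n; rewrite geq_max => /andP[Mn M'n] j.
  rewrite leq_eqVlt => /orP[/eqP ->|jN] w; last by apply: HM.
  move=> /HM' wM; apply: le_trans wM _; apply: ltW.
  by apply: lt_le_trans (truncnS_gt _) _; rewrite ler_nat.
have [M0 HM0] := component_bounded basin0.
exists (Num.max M%:R M0) => y [Ay [c [j [Lc yc]]]].
have [jN|Nj] := leqP j N.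
  rewrite le_max; apply/orP; left; apply: (HM c Lc M (leqnn _) j jN).
  exact: connected_component_sym.
rewrite le_max; apply/orP; right; apply: HM0.
apply: connected_component_trans (HN c Lc N (leqnn _) j (ltnW Nj)) _.
exact: connected_component_sym.
Qed.

Lemma basin_chain_bound : exists N, forall x, A x -> exists2 q, backward_orbit f p q &
  disc_chain (connected_component A x) N x q.
Proof.
have [l [d0 [l0 l1 d00 H]]] := attracting_contraction.
have p0 : 0 < cmod p by rewrite cmod_gt0; apply/eqP.
(* Being smaller than [d0] makes the disc of radius [d] forward invariant, and being smaller than
   |p| leaves the backward orbit of [p] outside it. *)
pose d := Num.min d0 (cmod p) / 2.
have m0 : 0 < Num.min d0 (cmod p) by rewrite lt_min d00.
have d_gt0 : 0 < d by rewrite divr_gt0.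
have dd0 : d < d0 by apply: (@lt_le_trans _ _ (Num.min d0 (cmod p))); [rewrite /d; lra|rewrite ge_min lexx].
have dp : d < cmod p by apply: (@lt_le_trans _ _ (Num.min d0 (cmod p))); [rewrite /d; lra|rewrite ge_min lexx orbT].
clearbody d.
have shrink (e : R) z : e < d0 -> cmod z <= e -> cmod (f z) <= e.
  by move=> ed ze; have := H z (le_lt_trans ze ed); have := cmod_ge0 z; nra.
have shrink_iter (e : R) n z : e < d0 -> cmod z <= e -> cmod (iter n f z) <= e.
  by move=> ed ze; elim: n => [//|n IH]; rewrite iterS; exact: shrink.
have dO : cball 0 d0 `<=` Omega.
  by apply: connected_component_max (disk_sub_basin l0 l1 H) (@connected_cball _ 0 d0); exact: cballxx.
have d2 : 0 < d / 2 by rewrite divr_gt0.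
(* The gap between [d / 2] and [d] matters: critical orbits end up in the smaller disc, while the
   points of [K2] below have their n-th iterate outside the larger open disc, hence in the open set
   [G]. *)
have [c Lc|n Hn] := finite_uniform_nat (P := fun c n => cmod (iter n f c) < d / 2) finite_L.
  by have [N HN] := (basinP c).1 (L_sub Lc) _ d2; exists N => n /HN.
have BO y : B y -> Omega (iter n f y).
  move=> [Ay [c [j [Lc yc]]]].
  have h : Omega (iter n f (iter j f c)).
    apply: dO; rewrite /cball/= subr0 -iterD; apply: le_lt_trans dd0.
    by apply: le_trans (ltW (Hn c Lc (n + j)%N (leq_addr _ _))) _; lra.
  exact: connected_component_trans h (connected_component_sym (component_iter n yc)).
pose G := Omega `\` cdisk 0 (d / 2).
have cG : clopen_full G.
  apply: (@clopen_full_remove_disk _ _ _ _ d0) => //; [lra|lra|exact: open_Omega|exact: clopen_Omega].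
have oG : open G.
  by rewrite /G setDE; apply: openI; [exact: open_Omega|apply: closed_openC; exact: closed_cdisk].
have GA : G `<=` A by move=> z [/Omega_sub].
have [q [j [Oq jq Pq dq]]] := backward_point (finite_postcritical n) dp (fun z => @shrink d z dd0).
have bq w : iter n f w = q -> backward_orbit f p w.
  by move=> wq; exists (j + n)%N => //=; rewrite iterD wq.
have Gq : G q by split=> //; rewrite /cdisk/= subr0 => ?; lra.
pose V := B `&` (iter n f) @^-1` (~` cdisk 0 (d / 2)).
have oV : open V.
  apply: openI; first exact: open_B.
  by move: (@continuous_iter n) => /continuousP; apply; apply: closed_openC; exact: closed_cdisk.
have VA : V `<=` A by move=> z [[]].
have BA : B `<=` A by move=> z [].
have [MB HMB] := B_bounded.
pose K1 := [set y | B y /\ cmod (iter n f y) <= d].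
pose K2 := [set y | [/\ B y, cmod (iter n.+1 f y) <= d & d <= cmod (iter n f y)]].
(* A limit of points of [B] could leave the basin; a bound by [d] on some iterate excludes this and
   makes [K1] and [K2] closed. *)
have disk_A m y : cmod (iter m f y) <= d -> A y.
  move=> yd; apply/(basin_shift m); apply: Omega_sub; apply: dO.
  by rewrite /cball/= subr0; lra.
have cK1 : compact K1.
  apply: (closed_subset_compact (M := MB)); last by move=> z [/HMB].
  move=> y cy; have yd : cmod (iter n f y) <= d.
    by apply: (closure_cmod_le (@continuous_iter n) _ cy) => w [].
  split; last exact: yd.
  apply: closed_B; last exact: disk_A yd.
  by apply: closureS cy => w [].
have cK2 : compact K2.
  apply: (closed_subset_compact (M := MB)); last by move=> z [/HMB].
  move=> y cy; have yd : cmod (iter n.+1 f y) <= d.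
    by apply: (closure_cmod_le (@continuous_iter n.+1) _ cy) => w [].
  split; [|exact: yd|]; last by apply: (closure_cmod_ge (@continuous_iter n) _ cy) => w [].
  apply: closed_B; last exact: disk_A yd.
  by apply: closureS cy => w [].
have [|y Ky|N1 HN1] := chain_uniform open_B cK1; first by move=> y [].
  have [By _] := Ky; have [k [w [wq c]]] := chain_to_preimage open_Omega Omega_sub clopen_Omega
    (BA _ By) (BO _ By) Oq Pq.
  exists k, w; split; first exact: bq.
  by apply: disc_chain_sub c => z [yz _]; exact: B_saturated By yz.
have [|y Ky|N2 HN2] := chain_uniform oV cK2.
- by move=> y [By _ dy]; split=> //; rewrite /cdisk/= subr0 => ?; lra.
- have [By _ dy] := Ky.
  have Gy : G (iter n f y) by split; [exact: BO|rewrite /cdisk/= subr0 => ?; lra].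
  have [k [w [wq c]]] := chain_to_preimage oG GA cG (BA _ By) Gy Gq Pq.
  exists k, w; split; first exact: bq.
  by apply: disc_chain_sub c => z [yz [_ Dz]]; split=> //; exact: B_saturated By yz.
(* Both regimes end alike: lift the chain from [f^m x] through [f^m]. They differ in the set [W],
   which is [B] or [V], and in why no critical point is met over it. *)
have finish x m k W y : W `<=` A -> A x -> iter m f x = y ->
    (forall w, connected_component A x w -> W (iter m f w) -> iter_derive m w != 0) ->
    (k <= maxn N1 N2)%N -> (exists q, backward_orbit f p q /\ disc_chain W k y q) ->
    exists2 q, backward_orbit f p q & disc_chain (connected_component A x) (maxn N1 N2) x q.
  move=> WA Ax xy Wd kN [q' [[i _ iq'] c]].
  have [w wq' cw] := chain_lift_iter WA Ax xy Wd c.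
  exists w; first by exists (i + m)%N => //=; rewrite iterD wq'.
  apply: disc_chain_mono (connected_component_refl Ax) kN _.
  by apply: disc_chain_sub cw => z [].
exists (maxn N1 N2) => x Ax.
have [m [Bm mmin]] : exists m, B (iter m f x) /\ forall i, (i < m)%N -> ~ B (iter i f x).
  apply: ex_min_nat; have [N HN] := (basinP x).1 Ax _ d00; exists N.
  split; first exact/basin_shift.
  exists 0, 0%N; split; first by left.
  by apply: connected_component_sym; apply: dO; rewrite /cball/= subr0; exact: HN.
have [ym|ym] := leP (cmod (iter n f (iter m f x))) d.
  apply: (finish x m N1 B _ BA Ax erefl); first last.
  - exact: HN1.
  - exact: leq_maxl.
  (* A critical point met at time i < m by a point in the component of [x] would put [iter i f x] in
     [B], by saturation, against the minimality of [m]. *)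
  move=> w xw Bw; apply: iter_derive_neq0 => i im; apply/eqP => fi.
  apply: (mmin i im); have Aw := connected_component_sub (component_iter i xw).
  apply: B_saturated (connected_component_sym (component_iter i xw)).
  by apply: L_sub_B; right.
(* The first such [k] is positive, and its predecessor is the stopping time: there the n-th further
   iterate is outside the disc and the next one inside, as in [K2]. *)
have [k [kd kmin]] : exists k, cmod (iter n f (iter k f (iter m f x))) <= d /\
    forall i, (i < k)%N -> ~ cmod (iter n f (iter i f (iter m f x))) <= d.
  apply: ex_min_nat; have [N HN] := (basinP x).1 Ax _ d_gt0; exists N.
  by rewrite -!iterD; apply: ltW; apply: HN; rewrite addnAC leq_addl.
case: k kd kmin => [|k] kd kmin; first by move: kd; rewrite leNgt ym.
apply: (finish x (k + m)%N N2 V _ VA Ax erefl); first last.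
- apply: HN2; split.
  + by rewrite iterD; exact: B_iter.
  + by rewrite iterSr iterD.
  + by rewrite iterD leNgt; apply/negP => /ltW; exact: kmin.
- exact: leq_maxr.
move=> w xw [_ Vw]; apply: iter_derive_neq0 => i im; apply/eqP => fi.
have Lc : L (iter i f w).
  by right; split=> //; exact: connected_component_sub (component_iter i xw).
(* After a critical point at time [i], [n] more steps lead into the invariant disc of radius
   [d / 2]. This time n + i precedes n + (k + m), where membership in [V] requires being outside. *)
apply: Vw; rewrite /cdisk/= subr0 -iterD.
have -> : (n + (k + m) = (k + m - i) + (n + i))%N.
  by rewrite [RHS]addnCA subnK// ltnW.
rewrite iterD; apply: shrink_iter; first lra.
by rewrite iterD; apply: ltW; exact: Hn.
Qed.

End Core.
End BasinDynamics.

Theorem theorem5p1 (R : realType) (f : R[i] -> R[i])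
    (f_entire : holomorphic_on setT f)
    (f_fix : f 0 = 0)
    (f_attracting : `|derive1 f 0| < 1)
    (f_deriv_neq0 : derive1 f 0 <> 0)
    (f_crit : finite_set [set z | derive1 f z = 0])
    (f_fatou : forall U, components (fatou_set f) U ->
       bounded_set U /\ open U) :
  (* (a) *)
  ((forall U, components (basin f 0) U -> simply_connected U) ->
   f @^-1` [set 0] `&` connected_component (basin f 0) 0 <> [set 0] ->
   exists C : R, forall U, components (basin f 0) U -> forall z0, U z0 ->
     exists q, [/\ U q, backward_orbit f 0 q &
                   (kobayashi_dist U z0 q <= C%:E)%E])
  /\
  (* (b) *)
  (((forall U, components (basin f 0) U -> simply_connected U) /\
    f @^-1` [set 0] `&` connected_component (basin f 0) 0 = [set 0])
   \/ (exists2 U, components (basin f 0) U & ~ simply_connected U) ->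
   \forall p0 \near (0 : R[i]),
     connected_component (basin f 0) 0 p0 -> p0 <> 0 ->
     exists C : R, forall U, components (basin f 0) U -> forall z0, U z0 ->
       exists q, [/\ U q, backward_orbit f p0 q &
                     (kobayashi_dist U z0 q <= C%:E)%E]).
Proof.
have df z : cdiff f z (derive1 f z) by apply: cdiff_derive1; exact: f_entire.
have f_attr : cmod (derive1 f 0) < 1 by move: f_attracting; rewrite normrC (ltcR _ 1).
have component_bounded x : basin f 0 x -> exists M : R,
    forall w, connected_component (basin f 0) x w -> cmod w <= M.
  move=> Ax; have Fx := basin_sub_fatou df f_fix f_attr Ax.
  have [+ _] := f_fatou _ (ex_intro2 _ _ x Fx erefl).
  (* The bound [M] delivered here is an element of [R[i]]; its real part serves as the real
     bound. *)
  move=> /pinfty_ex_gt0[M _ HM]; exists (complex.Re M) => w xw.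
  have : `|w| <= M.
    apply: HM; apply: connected_component_max xw; last exact: component_connected.
      exact: connected_component_refl.
    by move=> z /connected_component_sub; exact: (basin_sub_fatou df f_fix f_attr).
  by rewrite normrC lecE => /andP[].
have main p : connected_component (basin f 0) 0 p -> p <> 0 -> exists C : R,
    forall U, components (basin f 0) U -> forall z, U z ->
    exists q, [/\ U q, backward_orbit f p q & (kobayashi_dist U z q <= C%:E)%E].
  move=> Op p0.
  have [N HN] := basin_chain_bound df f_fix f_attr f_crit component_bounded Op p0.
  exists (2 * (pi * N.+1%:R)) => _ [x Ax <-] z xz.
  have Az := connected_component_sub xz.
  have [q bq c] := HN z Az; exists q.
  rewrite (same_connected_component xz).
  have zz := connected_component_refl Az.
  by split=> //; [exact: disc_chain_mem c|exact: kobayashi_dist_disc_chain].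
split=> [_ fib|_]; last by apply: (@filterE _ _ (nbhs_filter (0 : R[i]))) => p; exact: main.
have [p [fp Op] p0] : exists2 p, f p = 0 /\ connected_component (basin f 0) 0 p & p <> 0.
  apply: contrapT => none; apply: fib; apply/seteqP; split=> [p [fp Op]|_ ->].
    by apply: contrapT => p0; apply: none; exists p.
  by split=> //; apply: connected_component_refl; exact: basin0.
(* Since [f p = 0], one further iterate carries the backward orbit of [p] into that of 0. *)
have [C HC] := main p Op p0; exists C => U cU z Uz.
have [q [Uq [k _ kq] dq]] := HC U cU z Uz; exists q; split=> //.
by exists k.+1 => //=; rewrite kq.
Qed.
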